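(* Let $d\ge2$, let $A$ be a real symmetric positive definite $d\times d$ matrix, and put $v_j=A^{-1/2}e_j$, $w_j=A^{1/2}e_j$ for $1\le j\le d$. Let $\omega$ be a weight function satisfying $(\alpha)$, $(\delta)$, and $\omega(t)=o(t^2)$ as $t\to\infty$, but not quadratic interpolation of dimension $d$. For $f\in L^2(\mathbb{R}^d)$ and $\lambda>0$, consider the condition that for all $1\le j\le d$ $$|f(x)|\lesssim e^{-\frac12|\langle Ax,v_j\rangle|^2+\lambda\omega(|\langle Ax,v_j\rangle|)}\quad\text{and}\quad|\widehat f(\xi)|\lesssim e^{-\frac12|\langle A^{-1}\xi,w_j\rangle|^2+\lambda\omega(|\langle A^{-1}\xi,w_j\rangle|)}.\qquad( * )_\lambda$$ (i) For any $\lambda>0$, there exists $f\in L^2(\mathbb{R}^d)$ such that $$\sup_{\alpha\in\mathbb{N}^d}\frac{|H_A(f,\alpha)|}{\sqrt{\alpha!}\,e^{-\frac1\varepsilon\varphi^*(\varepsilon|\alpha|)}}=\infty\qquad( ** )$$ for every $\varepsilon>0$, but such that $f$ satisfies $( * )_\lambda$ and, for some $r>0$, $$\limsup_{|\alpha|\to\infty}\frac{|H_A(f,\alpha)|}{(\alpha!)^{\frac1{2d}}\,e^{-\frac1r\varphi^*\left(\frac{r|\alpha|}{d}\right)}}>0.$$ (ii) There exists $f\in L^2(\mathbb{R}^d)$ for which $( ** )$ holds for every $\varepsilon>0$, but for which $( * )_\lambda$ is satisfied for any $\lambda>0$.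
   Context: A weight function is an unbounded non-decreasing $\omega:[0,\infty)\to[0,\infty)$. Conditions: $(\alpha)$: there is $L\ge1$ with $\omega(t+s)\le L[\omega(t)+\omega(s)+1]$ for all $t,s\ge0$; $(\delta)$: $\varphi(u)=\omega(e^u)$ is convex. The Young conjugate is $\varphi^*(v)=\sup_{u\ge0}[uv-\varphi(u)]$, $v\ge0$. A weight function satisfying $(\delta)$ and $\omega(t)=o(t^2)$ satisfies quadratic interpolation of dimension $d\ge2$ if for some $L>0$ there is $C>0$ such that for all $t\ge0$ there is $\sigma\in[1,d]$ with $t^{2\frac{d-\sigma}{d-1}}+\omega(t^\sigma)\le L\omega(t)+C$. $\langle\cdot,\cdot\rangle$ is the Euclidean inner product and $\{e_j\}$ the standard basis of $\mathbb{R}^d$. $\widehat f(\xi)=(2\pi)^{-d/2}\int_{\mathbb{R}^d}f(x)e^{-i\langle x,\xi\rangle}dx$. For $\alpha\in\mathbb{N}^d$ ($0\in\mathbb{N}$), $|\alpha|=\sum\alpha_j$, $\alpha!=\prod\alpha_j!$. Hermite functions: $h_\alpha(x)=(-1)^{|\alpha|}\pi^{-d/4}(2^{|\alpha|}\alpha!)^{-1/2}e^{\frac12|x|^2}\partial^\alpha[e^{-|x|^2}]$; $h_{A,\alpha}(x)=(\det A)^{1/4}h_\alpha(A^{1/2}x)$ (an orthonormal basis of $L^2(\mathbb{R}^d)$); $H_A(f,\alpha)=(f,h_{A,\alpha})_{L^2}$. $\lesssim$ means $\le$ up to a positive multiplicative constant independent of $x,\xi$ (possibly depending on $\lambda$).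 Pointwise bounds are understood almost everywhere. *)

(* Defs.v *)
From HB Require Import structures.
From mathcomp Require Import all_boot all_order all_algebra.
From mathcomp Require Import all_classical all_reals all_analysis.
From mathcomp Require Import complex.

Set Implicit Arguments.
Unset Strict Implicit.
Unset Printing Implicit Defensive.
Import Order.TTheory GRing.Theory Num.Theory.
Import numFieldNormedType.Exports.

Local Open Scope classical_set_scope.
Local Open Scope ring_scope.

(** * Lebesgue measure on [R^n], realised as the type ['cV[R]_n] *)

Definition cV_display : measure_display -> measure_display.
Proof. exact. Qed.

(* The sigma-algebra generated by the coordinates, i.e. the Borel sets of R^n. *)
Section cV_measurable.
Context (R : realType) (n : nat).

Let coord : 'I_n -> 'cV[R]_n -> R := fun i x => x i 0.

Let cV_set0 : g_sigma_preimage coord set0.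
Proof. exact: sigma_algebra0. Qed.

Let cV_setC A : g_sigma_preimage coord A -> g_sigma_preimage coord (~` A).
Proof. exact: sigma_algebraC. Qed.

Let cV_bigcup (F : (set 'cV[R]_n)^nat) :
  (forall i, g_sigma_preimage coord (F i)) ->
  g_sigma_preimage coord (\bigcup_i (F i)).
Proof. exact: sigma_algebra_bigcup. Qed.

HB.instance Definition _ := @isMeasurable.Build (cV_display default_measure_display)
  'cV[R]_n (g_sigma_preimage coord) cV_set0 cV_setC cV_bigcup.

End cV_measurable.

Section cV_cons.
Context (R : realType) (n : nat).

Definition consc (p : R * 'cV[R]_n) : 'cV[R]_n.+1 := col_mx p.1%:M p.2.

Lemma consc0 p : consc p 0 0 = p.1.
Proof.
by rewrite /consc mxE; case: splitP => // j _; rewrite ord1 mxE eqxx mulr1n.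
Qed.

Lemma conscS p (i : 'I_n) : consc p (lift ord0 i) 0 = p.2 i 0.
Proof.
rewrite /consc mxE; case: splitP => [j|j] /=; first by rewrite ord1.
by rewrite /bump /= !add1n => -[/val_inj ->].
Qed.

Lemma measurable_coord (i : 'I_n) :
  measurable_fun [set: 'cV[R]_n] (fun x : 'cV[R]_n => x i 0).
Proof.
move=> _ Y mY; rewrite setTI; apply: sub_sigma_algebra => /=.
rewrite -bigcup_seq/=; exists i => /=; first by rewrite mem_index_enum.
by exists Y => //; rewrite setTI.
Qed.

End cV_cons.

Lemma measurable_to_cV (R : realType) (n : nat) d (T : measurableType d)
    (f : T -> 'cV[R]_n) :
  (forall i, measurable_fun [set: T] (fun t => f t i 0)) ->
  measurable_fun [set: T] f.
Proof.
move=> mf _ B mB; rewrite setTI.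
have : preimage_set_system setT f
    (g_sigma_preimage (fun (i : 'I_n) (x : 'cV[R]_n) => x i 0))
    (f @^-1` B) by exists B => //; rewrite setTI.
rewrite -g_sigma_preimage_comp.
apply: smallest_sub; first exact: sigma_algebra_measurable.
by move=> A; rewrite -bigcup_seq/= => -[i _ [Y mY <-]]; exact: mf.
Qed.

Lemma measurable_consc (R : realType) (n : nat) :
  measurable_fun [set: R * 'cV[R]_n] (@consc R n).
Proof.
apply: measurable_to_cV => i; case: (unliftP ord0 i) => [j|] ->.
  rewrite [X in measurable_fun _ X](_ : _ =
    (fun x : 'cV[R]_n => x j 0) \o snd); last first.
    by apply/funext => p /=; rewrite conscS.
  exact: measurableT_comp (@measurable_coord R n j) measurable_snd.
rewrite [X in measurable_fun _ X](_ : _ = fst); first exact: measurable_fst.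
by apply/funext => p /=; rewrite consc0.
Qed.

Definition unconsc (R : realType) (n : nat) (x : 'cV[R]_n.+1) : R * 'cV[R]_n :=
  (x 0 0, \col_i x (lift ord0 i) 0).

Lemma conscK (R : realType) (n : nat) : cancel (@consc R n) (@unconsc R n).
Proof.
move=> [a x]; rewrite /unconsc consc0; congr pair.
by apply/colP => i; rewrite mxE conscS.
Qed.

Lemma measurable_unconsc (R : realType) (n : nat) :
  measurable_fun [set: 'cV[R]_n.+1] (@unconsc R n).
Proof.
apply: measurable_fun_pair; first exact: measurable_coord.
apply: measurable_to_cV => i.
under eq_fun do rewrite mxE.
exact: measurable_coord.
Qed.

(* Under [R^(n+1) = R * R^n], the product of the Lebesgue measure of the line
   with a given measure on R^n. *)
Section lebesgue_step.
Context (R : realType) (n : nat).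
Variable mu : {sigma_finite_measure set 'cV[R]_n -> \bar R}.
Local Open Scope ereal_scope.

Definition lebesgue_step : set 'cV[R]_n.+1 -> \bar R :=
  pushforward (@lebesgue_measure R \x mu) (@consc R n).

Let mconsc := @measurable_consc R n.

Let step0 : lebesgue_step set0 = 0.
Proof. by rewrite /lebesgue_step /pushforward preimage_set0 measure0. Qed.

Let step_ge0 A : 0 <= lebesgue_step A.
Proof. exact: measure_ge0. Qed.

Let step_sigma_additive : semi_sigma_additive lebesgue_step.
Proof.
move=> F mF tF mUF; rewrite /lebesgue_step /pushforward preimage_bigcup.
apply: measure_semi_sigma_additive.
- by move=> k; rewrite -[X in measurable X]setTI; exact: mconsc.
- apply/trivIsetP => /= i j _ _ ij; rewrite -preimage_setI.
  by move/trivIsetP : tF => /(_ _ _ _ _ ij) ->//; rewrite preimage_set0.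
- by rewrite -preimage_bigcup -[X in measurable X]setTI; exact: mconsc.
Qed.

HB.instance Definition _ := isMeasure.Build _ _ _ lebesgue_step
  step0 step_ge0 step_sigma_additive.

Let step_sigma_finite : sigma_finite setT lebesgue_step.
Proof.
have /sigma_finiteP[F [FT ndF Foo]] := sigma_finiteT (@lebesgue_measure R).
have /sigma_finiteP[G [GT ndG Goo]] := sigma_finiteT mu.
exists (fun k => @unconsc R n @^-1` (F k `*` G k)).
  rewrite -preimage_bigcup (_ : \bigcup_k _ = setT) ?preimage_setT//.
  rewrite -setXTT FT GT predeqE => -[x y]; split.
    by move=> [k _ []/= ? ?]; split; exists k.
  move=> [/= [k _ Fkx] [l _ Gly]]; exists (maxn k l) => //; split.
  - by move: x Fkx; exact/subsetPset/ndF/leq_maxl.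
  - by move: y Gly; exact/subsetPset/ndG/leq_maxr.
move=> k; have [mF Fk] := Foo k; have [mG Gk] := Goo k; split.
  rewrite -[X in measurable X]setTI; apply: measurable_unconsc => //.
  exact: measurableX.
rewrite /lebesgue_step /pushforward -comp_preimage.
rewrite (_ : _ \o _ = id); last by apply/funext => p /=; rewrite conscK.
by rewrite preimage_id product_measure1E// lte_mul_pinfty// ge0_fin_numE.
Qed.

HB.instance Definition _ := Measure_isSigmaFinite.Build _ _ _ lebesgue_step
  step_sigma_finite.

End lebesgue_step.

Fixpoint lebesgue_cV (R : realType) (n : nat) :
    {sigma_finite_measure set 'cV[R]_n -> \bar R} :=
  match n with
  | 0 => \d_(0 : 'cV[R]_0)
  | n'.+1 => lebesgue_step (lebesgue_cV R n')
  end.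

Lemma lebesgue_cV_box (R : realType) (n : nat) (B : 'I_n -> set R) :
  (forall i, measurable (B i)) ->
  lebesgue_cV R n [set x | forall i, B i (x i 0)] =
  (\prod_i lebesgue_measure (B i))%E.
Proof.
elim: n B => [|n IHn] B mB.
  rewrite big_ord0 /= diracE mem_set//; by case.
have mbox : measurable [set x : 'cV[R]_n | forall i, B (lift ord0 i) (x i 0)].
  rewrite (_ : mkset _ = \bigcap_(i in [set: 'I_n])
      (fun x : 'cV[R]_n => x i 0) @^-1` B (lift ord0 i)); last first.
    by apply/seteqP; split=> x /= h i => [_|]; exact: h.
  apply: fin_bigcap_measurable => // i _.
  by rewrite -[X in measurable X]setTI; exact: measurable_coord.
rewrite big_ord_recl -IHn//= -product_measure1E//; last exact: mB.
rewrite /lebesgue_step /pushforward; congr (_ _).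
apply/seteqP; split=> -[a x] /=.
  move=> h; split=> [|i]; first by have := h ord0; rewrite consc0.
  by have := h (lift ord0 i); rewrite conscS.
move=> [ha hx] i; case: (unliftP ord0 i) => [j|] ->.
  by rewrite conscS; exact: hx.
by rewrite consc0.
Qed.

(** * Complex-valued functions on [R^d] *)

Local Notation normc := ComplexField.Normc.normc.

Section Lp_and_Fourier.
Context (R : realType) (d : nat).
Local Notation mu := (lebesgue_cV R d).
Implicit Types f g : 'cV[R]_d -> R[i].

Definition dotv (x y : 'cV[R]_d) : R := \sum_i x i 0 * y i 0.

Definition measurable_cfun f :=
  measurable_fun [set: 'cV[R]_d] (fun x => complex.Re (f x)) /\
  measurable_fun [set: 'cV[R]_d] (fun x => complex.Im (f x)).

Definition cLnorm (p : \bar R) f : \bar R :=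
  'N[mu]_p[EFin \o (fun x => normc (f x))]%E.

Definition memLp (p : \bar R) f := measurable_cfun f /\ (cLnorm p f < +oo)%E.

Definition cintegral f : R[i] :=
  ((\int[mu]_x complex.Re (f x)) +i* (\int[mu]_x complex.Im (f x)))%C.

Definition inner_L2 f g : R[i] := cintegral (fun x => f x * (g x)^*%C).

Definition expi (t : R) : R[i] := (cos t +i* sin t)%C.

Definition fourier f (xi : 'cV[R]_d) : R[i] :=
  ((2 * pi) `^ (- (d%:R / 2)))%:C%C *
  cintegral (fun x => f x * expi (- dotv x xi)).

(* [g] is the Fourier transform of [f] in L^2: the integral formula extended by
   L^2-continuity from the dense subspace of integrable square-integrable
   functions. By Plancherel, such a [g] exists and is unique almost everywhere
   for every [f] in L^2, and it is [fourier f] if [f] is moreover integrable. *)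
Definition is_fourier_L2 f g :=
  memLp 2%:E g /\
  exists F : ('cV[R]_d -> R[i])^nat,
    [/\ forall n, memLp 1 (F n) /\ memLp 2%:E (F n),
        cLnorm 2%:E (fun x => F n x - f x) @[n --> \oo] --> 0%E &
        cLnorm 2%:E (fun xi => fourier (F n) xi - g xi) @[n --> \oo] --> 0%E].

End Lp_and_Fourier.

(** * Hermite functions *)

Section Hermite.
Context (R : realType) (d : nat).

Definition multi_index := 'I_d -> nat.

Definition mi_abs (a : multi_index) : nat := \sum_i a i.

Definition mi_fact (a : multi_index) : nat := \prod_i (a i)`!.

Definition basis_vec (j : 'I_d) : 'cV[R]_d := delta_mx j 0.

Definition iter_partial (a : multi_index) (f : 'cV[R]_d -> R) : 'cV[R]_d -> R :=
  foldr (fun j g => iter (a j) (fun h x => 'D_(basis_vec j) h x) g) f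
    (enum 'I_d).

Definition hermite (a : multi_index) (x : 'cV[R]_d) : R :=
  (-1) ^+ mi_abs a * pi `^ (- (d%:R / 4)) *
  ((2 ^ mi_abs a * mi_fact a)%N%:R) `^ (- 2^-1) *
  expR (2^-1 * dotv x x) *
  iter_partial a (fun y => expR (- dotv y y)) x.

Definition spd (A : 'M[R]_d) :=
  A^T = A /\ forall x : 'cV[R]_d, x != 0 -> 0 < dotv (A *m x) x.

(* [A^(1/2)], the unique positive definite square root of a positive definite
   matrix; [0] if there is none. *)
Definition sqrtmx (A : 'M[R]_d) : 'M[R]_d :=
  xget 0 [set B | spd B /\ B *m B = A].

Definition hermite_mx (A : 'M[R]_d) (a : multi_index) (x : 'cV[R]_d) : R :=
  (\det A) `^ 4^-1 * hermite a (sqrtmx A *m x).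

Definition hermite_coef (A : 'M[R]_d) (f : 'cV[R]_d -> R[i]) (a : multi_index)
    : R[i] :=
  inner_L2 f (fun x => (hermite_mx A a x)%:C%C).

End Hermite.

(** * Weight functions

A weight function on [[0, +oo[] is encoded by a function [R -> R], of which only
the values on nonnegative arguments are ever used. *)

Section Weights.
Context (R : realType).
Implicit Types omega : R -> R.

Definition weight_function omega :=
  [/\ forall t : R, 0 <= t -> 0 <= omega t,
      forall s t : R, 0 <= s -> s <= t -> omega s <= omega t &
      forall M : R, exists2 t : R, 0 <= t & M < omega t].

Definition weight_alpha omega :=
  exists2 L : R, 1 <= L & forall t s : R, 0 <= t -> 0 <= s ->
    omega (t + s) <= L * (omega t + omega s + 1).

Definition phi omega (u : R) : R := omega (expR u).

Definition weight_delta omega :=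
  convex_function (E := R^o) [set` `[0%R, +oo[] (phi omega).

(* A real-valued supremum: it is finite as soon as [ln t = o(omega t)], which
   holds whenever the weight function [omega] satisfies [weight_delta] but not
   [quadratic_interpolation]: otherwise [omega t] would lie between two positive
   multiples of [ln t] for large [t], and one could take [sigma = d]. *)
Definition young omega (v : R) : R :=
  sup [set u * v - phi omega u | u in [set u | 0 <= u]].

Definition quadratic_interpolation (d : nat) omega :=
  exists2 L : R, 0 < L & exists2 C : R, 0 < C & forall t : R, 0 <= t ->
    exists2 sigma : R, 1 <= sigma <= d%:R &
      t `^ (2 * ((d%:R - sigma) / (d%:R - 1))) + omega (t `^ sigma)
        <= L * omega t + C.

End Weights.

Section Conditions.
Context (R : realType) (d : nat).
Local Notation mu := (lebesgue_cV R d).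
Variables (A : 'M[R]_d) (omega : R -> R).

Definition vvec (j : 'I_d) : 'cV[R]_d := invmx (sqrtmx A) *m basis_vec R j.

Definition wvec (j : 'I_d) : 'cV[R]_d := sqrtmx A *m basis_vec R j.

Definition gauss_weight (lambda s : R) : R :=
  expR (- 2^-1 * `|s| ^+ 2 + lambda * omega `|s|).

Definition ae_dominated (f : 'cV[R]_d -> R[i]) (b : 'cV[R]_d -> R) :=
  exists2 C : R, 0 < C & {ae mu, forall x, normc (f x) <= C * b x}.

Definition time_freq_decay (lambda : R) (f : 'cV[R]_d -> R[i]) :=
  exists2 fhat, is_fourier_L2 f fhat & forall j,
    ae_dominated f (fun x => gauss_weight lambda (dotv (A *m x) (vvec j))) /\
    ae_dominated fhat
      (fun xi => gauss_weight lambda (dotv (invmx A *m xi) (wvec j))).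

Definition unbounded_hermite_ratio (eps : R) (f : 'cV[R]_d -> R[i]) :=
  ereal_sup [set (normc (hermite_coef A f a) /
      (Num.sqrt (mi_fact a)%:R *
       expR (- eps^-1 * young omega (eps * (mi_abs a)%:R))))%:E
    | a in [set: multi_index d]] = +oo%E.

(* limsup as |a| -> oo *)
Definition hermite_limsup (r : R) (f : 'cV[R]_d -> R[i]) : \bar R :=
  ereal_inf [set ereal_sup [set (normc (hermite_coef A f a) /
      ((mi_fact a)%:R `^ (2 * d%:R)^-1 *
       expR (- r^-1 * young omega (r * (mi_abs a)%:R / d%:R))))%:E
    | a in [set a : multi_index d | (N <= mi_abs a)%N]] | N in [set: nat]].

End Conditions.

(* Main.v *)
From HB Require Import structures.
Require Import Defs.
From mathcomp Require Import all_boot all_order all_algebra.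
From mathcomp Require Import all_classical all_reals all_analysis.
From mathcomp Require Import measurable_realfun lebesgue_integral_under.
From mathcomp Require Import complex spectral sesquilinear.
From mathcomp Require Import ring lra zify.

Set Implicit Arguments.
Unset Strict Implicit.
Unset Printing Implicit Defensive.
Import Order.TTheory GRing.Theory Num.Theory.
Import numFieldNormedType.Exports.

Local Open Scope classical_set_scope.
Local Open Scope ring_scope.

(** Put [B = A^(1/2)] and let [h_n] be the [n]-th Hermite function on the line.
Both parts are witnessed by a diagonal Hermite series
[[ f(x) = \sum_n c_n h_n((B x)_1) ... h_n((B x)_d), ]]
whose only nonzero coefficients sit at the constant multi-indices [(n, ..., n)].

The idea is that the decay conditions look at one coordinate at a time, while
the growth condition on the coefficients feels all of them. One factor
[h_n(y_j)] is at most [(sqrt 2 |y_j| + sqrt n)^n / sqrt n! * exp(- y_j^2 / 2)]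
([hermf_le]) and each of the [d - 1] others is at most [K^n] ([hermf_le_gauss]).
Therefore [c_n = sqrt n! exp(- young(r n) / r)] ([young_coef]) is small enough
for the bound with [lambda] of order [1 / r] ([young_term_le]): estimate the
conjugate from below at the point [ln tau], where [tau] is a large multiple of
[|y_j| + sqrt n + 1], so that the powers of [tau] beat those in the bound of
[h_n], and condition (alpha) together with [omega(t) = o(t^2)] gives
[omega(tau) / r <= lambda omega(|y_j|) + n ln 2 + C]. As [h_n] is an eigenfunction
of the Fourier transform ([hermf_fourier]), the transform of [f] is a series of
the same kind in [B^-1 xi], with coefficients of the same size. On the other hand
the size of the multi-index [(n, ..., n)] is [d n] and its factorial is [n!^d], so
the coefficients have to be compared with
[sqrt n!^d exp(- young(eps d n) / eps)] ([young_bound]).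

It remains to see that the ratio of [young_coef] to [young_bound] is unbounded
for all [r] and [eps] unless quadratic interpolation holds
([young_ratio_unbounded]). Suppose that it is bounded and let [t = e^u] be large.
The slope of [phi] at [sigma u] grows with [sigma], and
[x = t^(2 (d - sigma) / (d - 1))] decreases from [t^2] to [1] as [sigma] runs
through [[1, d]]. The slope is at most [r t^2] at [sigma = 1], since [phi(u)] is
[omega(t) = o(t^2)], and at least [r] at [sigma = d], since [phi] grows faster
than linearly, so it equals [r x] for some [sigma] ([exists_balanced_sigma]). For
the integer part [n] of [x] the supremum that defines [young(r n) / r] is then
almost attained at [sigma u]: it is at most [n sigma u - phi(sigma u) / (2 r)] up
to a constant ([legendre_near_balance]). The logarithm of the supposed bound,
with [young(eps d n) / eps >= d n u - phi(u) / eps] and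
[ln n!^((d-1)/2) <= (d - 1) / 2 n ln n <= n (d - sigma) u], becomes
[phi(sigma u) <= C phi(u) + C]: all the terms in [n u] cancel. As condition
(alpha) bounds the slope, and hence [x], by a multiple of [phi(sigma u) + 1], this
is quadratic interpolation with exponent [sigma].

For part (i) take [c_n] as above for one [r], of order [1 / lambda]: the quotient
in the limes superior is constant along the constant multi-indices. For part (ii)
let [r] tend to infinity along a sparse set of indices, on which the ratio is
large ([sparse_sequence]), and put the other coefficients equal to zero. *)

(** * Linear changes of variables and tensor products for the Lebesgue measure *)

Lemma lebesgue_measure_affine (R : realType) (b c : R) (A : set (measurableTypeR R)) : (0 < b)%R ->
  measurable A ->
  (lebesgue_measure ((fun a : R => b * a + c)%R @^-1` A) = (b^-1)%:E * lebesgue_measure A)%E.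
Proof.
move=> b0 mA.
pose phi : measurableTypeR R -> measurableTypeR R := (fun a : R => b * a + c)%R.
have mphi : measurable_fun [set: measurableTypeR R] phi.
  by apply: measurable_funD => //; apply: measurable_funM.
pose bn := NngNum (ltW b0).
rewrite [in RHS](@lebesgue_measure_unique R (mscale bn (pushforward lebesgue_measure phi)) _ _ mA).
  by rewrite /mscale/= muleA -EFinM mulVf ?gt_eqF// mul1e.
move=> _ [[x y] _ <-].
rewrite -[RHS]/((b%:E * lebesgue_measure (phi @^-1` `]x, y]))%E).
have -> : phi @^-1` `]x, y] = `](x - c) / b, (y - c) / b]%classic.
  by apply/seteqP; split=> a /=; rewrite !in_itv/= ltr_pdivrMr// ler_pdivlMr//
    ltrBlDr lerBrDr mulrC.
rewrite !lebesgue_measure_itv/= !lte_fin ltr_pM2r ?invr_gt0// ltrD2r.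
case: ifPn => // _; last by rewrite mule0.
by rewrite -!EFinD -EFinM; congr EFin; field; rewrite gt_eqF.
Qed.

Lemma ge0_integral_affine (R : realType) (b c : R) (f : measurableTypeR R -> \bar R) : (0 < b)%R ->
  measurable_fun [set: measurableTypeR R] f -> (forall a, 0 <= f a)%E ->
  (\int[@lebesgue_measure R]_a f (b * a + c)%R = (b^-1)%:E * \int[@lebesgue_measure R]_a f a)%E.
Proof.
move=> b0 mf f0.
pose phi : measurableTypeR R -> measurableTypeR R := (fun a : R => b * a + c)%R.
have mphi : measurable_fun [set: measurableTypeR R] phi.
  by apply: measurable_funD => //; apply: measurable_funM.
have bV0 : 0 <= b^-1 by rewrite invr_ge0 ltW.
pose bn := NngNum bV0.
rewrite -[LHS]/(\int[@lebesgue_measure R]_(a in phi @^-1` setT) (f \o phi) a)%E.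
rewrite -ge0_integral_pushforward//.
transitivity (\int[mscale bn (@lebesgue_measure R)]_a f a)%E.
  by apply: eq_measure_integral => A mA _; exact: lebesgue_measure_affine.
by rewrite (@ge0_integral_mscale _ _ _ _ _ measurableT).
Qed.

Lemma ge0_integral_cVS (R : realType) n (F : 'cV[R]_n.+1 -> \bar R) :
  measurable_fun [set: 'cV[R]_n.+1] F -> (forall x, 0 <= F x)%E ->
  (\int[lebesgue_cV R n.+1]_x F x =
  \int[@lebesgue_measure R]_a \int[lebesgue_cV R n]_x F (consc (a, x)))%E.
Proof.
move=> mF F0.
rewrite /= /lebesgue_step ge0_integral_pushforward//=; last exact: measurable_consc.
rewrite preimage_setT fubini_tonelli1//=.
  apply: measurableT_comp => //; exact: measurable_consc.
Qed.

Lemma measurable_affine_cV (R : realType) m n (B : 'M[R]_(m, n)) (c : 'cV[R]_m) :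
  measurable_fun [set: 'cV[R]_n] (fun x : 'cV[R]_n => B *m x + c).
Proof.
apply: measurable_to_cV => i.
under eq_fun do rewrite !mxE.
apply: measurable_funD => //; apply: measurable_sum => j.
by apply: measurable_funM => //; exact: measurable_coord.
Qed.

Lemma dotv_consc (R : realType) n (x y : 'cV[R]_n) (a b : R) :
  dotv (consc (a, x)) (consc (b, y)) = a * b + dotv x y.
Proof.
rewrite /dotv big_ord_recl !consc0; congr (_ + _).
by apply: eq_bigr => i _; rewrite !conscS.
Qed.

(** Block form of a symmetric matrix acting on [R^(n+1) = R * R^n]. *)
Lemma mul_consc (R : realType) n (B : 'M[R]_n.+1) (a : R) (x : 'cV[R]_n) :
  B^T = B ->
  B *m consc (a, x) =
  consc (B 0 0 * a + dotv (row' 0 (col 0 B)) x,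
         a *: row' 0 (col 0 B) + row' 0 (col' 0 B) *m x).
Proof.
move=> symB.
apply/colP => i; rewrite [LHS]mxE big_ord_recl consc0.
under eq_bigr do rewrite conscS.
case: (unliftP ord0 i) => [j|] ->; rewrite ?conscS ?consc0 /=.
  rewrite !mxE mulrC; congr (_ + _).
  by apply: eq_bigr => k _; rewrite !mxE.
rewrite /dotv; congr (_ + _); apply: eq_bigr => k _; rewrite !mxE.
by rewrite -[in LHS]symB mxE.
Qed.

Lemma unconscK (R : realType) n (x : 'cV[R]_n.+1) : consc (unconsc x) = x.
Proof.
apply/colP => i; case: (unliftP ord0 i) => [j|] ->; rewrite ?conscS ?consc0 //=.
by rewrite mxE.
Qed.

Definition schur (R : realType) n (B : 'M[R]_n.+1) : 'M[R]_n :=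
  row' 0 (col' 0 B) - (B 0 0)^-1 *: (row' 0 (col 0 B) *m (row' 0 (col 0 B))^T).

Lemma dotvZl (R : realType) n a (x y : 'cV[R]_n) : dotv (a *: x) y = a * dotv x y.
Proof.
by rewrite /dotv mulr_sumr; apply: eq_bigr => i _; rewrite mxE mulrA.
Qed.

Lemma dotvC (R : realType) n (x y : 'cV[R]_n) : dotv x y = dotv y x.
Proof. by apply: eq_bigr => i _; rewrite mulrC. Qed.

Lemma dotv_mulmx (R : realType) m n (B : 'M[R]_(m, n)) (x : 'cV[R]_n) (y : 'cV[R]_m) :
  dotv (B *m x) y = dotv x (B^T *m y).
Proof.
rewrite /dotv.
under eq_bigr do rewrite mxE mulr_suml.
rewrite exchange_big /=; apply: eq_bigr => j _.
rewrite mxE mulr_sumr; apply: eq_bigr => i _; rewrite !mxE; ring.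
Qed.

Lemma mulmx_dotv (R : realType) n (u x : 'cV[R]_n) :
  u *m u^T *m x = dotv u x *: u.
Proof.
apply/colP => i; rewrite -mulmxA !mxE big_ord1 !mxE /dotv mulrC; congr (_ * _).
by apply: eq_bigr => j _; rewrite !mxE.
Qed.

Lemma dotv0 (R : realType) n (x : 'cV[R]_n) : dotv x 0 = 0.
Proof. by rewrite /dotv big1// => i _; rewrite mxE mulr0. Qed.

Lemma spd_00_gt0 (R : realType) n (B : 'M[R]_n.+1) : spd B -> 0 < B 0 0.
Proof.
move=> [symB posB].
have e0 : (consc (1, 0 : 'cV[R]_n)) != 0.
  apply/eqP => /(congr1 (fun x : 'cV[R]_n.+1 => x 0 0)); rewrite consc0 mxE.
  by move/eqP; rewrite oner_eq0.
have := posB _ e0; rewrite mul_consc// mulmx0 addr0 dotv_consc.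
by rewrite !dotv0 !addr0 !mulr1.
Qed.

(** Completing the square in the first coordinate: the quadratic form of [B] at the
    minimiser over the first coordinate is the form of the Schur complement. *)
Lemma spd_schur (R : realType) n (B : 'M[R]_n.+1) : spd B -> spd (schur B).
Proof.
move=> sB; have b0 := spd_00_gt0 sB; case: sB => symB posB.
rewrite /schur; set u := row' 0 (col 0 B); set B' := row' 0 (col' 0 B).
split.
  have symBE i j : B i j = B j i by rewrite -{1}symB mxE.
  apply/matrixP => i j; rewrite !mxE !big_ord1 !mxE [B (lift 0 j) (lift 0 i)]symBE.
  by congr (_ - _ * _); rewrite mulrC.
move=> x x0.
(* Given the other coordinates [x], the first one minimises the form of [B]. *)
pose z := consc (- (B 0 0)^-1 * dotv u x, x).
have z0 : z != 0.
  apply: contra x0 => /eqP z0; apply/eqP/colP => i.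
  by rewrite -(conscS (- (B 0 0)^-1 * dotv u x, x)) -/z z0 !mxE.
have := posB _ z0; rewrite /z mul_consc// -/u -/B' dotv_consc.
have -> : B 0 0 * (- (B 0 0)^-1 * dotv u x) + dotv u x = 0.
  by field; rewrite gt_eqF.
rewrite mul0r add0r.
rewrite mulmxBl -scalemxAl mulmx_dotv scalerA.
by rewrite addrC mulNr scaleNr.
Qed.

(** By induction on the dimension. Integrating first over the first coordinate, an
    affine substitution on the line replaces the first coordinate of [B x + c] by
    a free variable [a]; what is left of [B] acting on the other coordinates is its
    Schur complement, up to a translation that depends on [a]. This is why the
    statement has to allow for the translation [c]. *)
Lemma ge0_integral_spd (R : realType) n (B : 'M[R]_n) : spd B ->
  exists2 k : R, 0 < k & forall (c : 'cV[R]_n) (F : 'cV[R]_n -> \bar R),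
    measurable_fun setT F -> (forall x, 0 <= F x)%E ->
    (\int[lebesgue_cV R n]_x F (B *m x + c)%R =
     k%:E * \int[lebesgue_cV R n]_x F x)%E.
Proof.
elim: n B => [|n IHn] B sB.
  exists 1 => // c F mF F0; rewrite mul1e; apply: eq_integral => x _.
  by congr F; apply/colP; case.
have [k k0 kS] := IHn _ (spd_schur sB).
have b0 := spd_00_gt0 sB.
exists ((B 0 0)^-1 * k); first by rewrite mulr_gt0// invr_gt0.
move=> c F mF F0.
have mFc (d : measure_display) (T : measurableType d) (f : T -> 'cV[R]_n.+1) :
    measurable_fun setT f -> measurable_fun setT (F \o f).
  by move=> mf; exact: measurableT_comp.
have symB := sB.1.
set u := row' 0 (col 0 B); set B' := row' 0 (col' 0 B).
pose c0 := (unconsc c).1; pose c' := (unconsc c).2.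
have BE (a : R) (x : 'cV[R]_n) : B *m consc (a, x) + c =
    consc (B 0 0 * a + (dotv u x + c0), a *: u + B' *m x + c').
  rewrite mul_consc// -[c in LHS]unconscK -/u -/B'.
  apply/colP => i; rewrite mxE.
  case: (unliftP ord0 i) => [j|] ->; rewrite ?conscS ?consc0/=.
    by rewrite !mxE.
  by rewrite addrA.
rewrite (ge0_integral_cVS (F := fun x => F (B *m x + c)))//; last exact: (mFc _ _ _ (measurable_affine_cV B c)).
pose G p := F (B *m consc p + c).
have mG : measurable_fun [set: R * 'cV[R]_n] G.
  apply: mFc; apply: (measurableT_comp (measurable_affine_cV B c)).
  exact: measurable_consc.
rewrite -[LHS]/(\int[lebesgue_measure]_a \int[lebesgue_cV R n]_x G (a, x))%E.
rewrite fubini_tonelli//; last by move=> p; exact: F0.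
(* The integrand after the first coordinate of [B x + c] has become the variable [p.2]. *)
pose Phi p : \bar R := F (consc (p.2, ((p.2 - (dotv u p.1 + c0)) / B 0 0) *: u + B' *m p.1 + c')).
have mPhi : measurable_fun [set: 'cV[R]_n * R] Phi.
  apply: mFc; apply: (measurableT_comp (@measurable_consc R n)).
  apply: measurable_fun_pair; first exact: measurable_snd.
  apply: measurable_to_cV => i; under eq_fun do rewrite !mxE.
  have mx1 j : measurable_fun [set: 'cV[R]_n * R] (fun p => p.1 j 0).
    exact: (measurableT_comp (@measurable_coord R n j) measurable_fst).
  apply: measurable_funD => //; apply: measurable_funD.
    apply: measurable_funM => //; apply: measurable_funM => //.
    apply: measurable_funB; first exact: measurable_snd.
    apply: measurable_funD => //; rewrite /dotv; apply: measurable_sum => j.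
    by apply: measurable_funM => //; exact: mx1.
  apply: measurable_sum => j; apply: measurable_funM => //; exact: mx1.
transitivity (\int[lebesgue_cV R n]_x ((B 0 0)^-1%:E * \int[@lebesgue_measure R]_a Phi (x, a)))%E.
  apply: eq_integral => x _.
  rewrite -(@ge0_integral_affine _ (B 0 0) (dotv u x + c0)) //.
  - apply: eq_integral => a _; rewrite /Phi /G BE; congr (F (consc (_, _ + _ + _))).
    by congr (_ *: _); rewrite /= addrK mulrC mulKf ?gt_eqF.
  - exact: (measurableT_comp mPhi (measurable_pair1 x)).
  - by move=> a; exact: F0.
rewrite ge0_integralZl//; last 3 first.
- exact: (@measurable_fun_fubini_tonelli_F _ _ _ _ R lebesgue_measure Phi mPhi (fun p => F0 _)).
- by move=> x _; apply: integral_ge0 => a _; exact: F0.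
- by rewrite lee_fin invr_ge0 ltW.
rewrite (@fubini_tonelli _ _ _ _ R (lebesgue_cV R n) lebesgue_measure _ mPhi (fun p => F0 _)).
rewrite EFinM -muleA; congr (_ * _)%E.
rewrite ge0_integral_cVS//.
rewrite -ge0_integralZl//=; last 3 first.
- exact: (@measurable_fun_fubini_tonelli_F _ _ _ _ R (lebesgue_cV R n) _ (mFc _ _ _ (@measurable_consc R n)) (fun p => F0 _)).
- by move=> a _; apply: integral_ge0 => x _; exact: F0.
- by rewrite lee_fin ltW.
apply: eq_integral => a _.
rewrite -(kS (((a - c0) / B 0 0) *: u + c') (fun x => F (consc (a, x))))//; last first.
  exact: mFc (measurableT_comp (@measurable_consc R n) (measurable_pair1 a)).
apply: eq_integral => x _; rewrite /Phi/=; congr (F (consc (_, _))).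
rewrite /schur -/u -/B' mulmxBl -scalemxAl mulmx_dotv scalerA.
rewrite opprD addrA (addrAC a) mulrBl scalerBl mulrC -[in X in _ = X]addrA.
apply/colP => i; rewrite !mxE; ring.
Qed.

Lemma integrable_tensor (R : realType) n (f : R -> R) (g : 'cV[R]_n -> R) :
  (@lebesgue_measure R).-integrable setT (EFin \o f) ->
  (lebesgue_cV R n).-integrable setT (EFin \o g) ->
  (lebesgue_measure \x lebesgue_cV R n)%E.-integrable setT
    (EFin \o (fun p => f p.1 * g p.2)).
Proof.
move=> intf intg.
have mf : measurable_fun setT f by apply/measurable_EFinP; case/integrableP: intf.
have mg : measurable_fun setT g by apply/measurable_EFinP; case/integrableP: intg.
have mfg : measurable_fun setT (fun p : R * 'cV[R]_n => f p.1 * g p.2).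
  apply: measurable_funM.
    exact: measurableT_comp mf measurable_fst.
  exact: measurableT_comp mg measurable_snd.
apply/integrable12ltyP => /=; first exact/measurable_EFinP.
under eq_integral => a _.
  under eq_integral => x _ do rewrite normrM EFinM.
  rewrite ge0_integralZl//=; last first.
    by apply/measurable_EFinP; exact: measurableT_comp.
  over.
rewrite ge0_integralZr//=; last 2 first.
- by apply/measurable_EFinP; exact: measurableT_comp.
- by apply: integral_ge0 => x _; rewrite lee_fin.
have If : (\int[@lebesgue_measure R]_x `|f x|%:E < +oo)%E by case/integrableP: intf.
have Ig : (\int[lebesgue_cV R n]_x `|g x|%:E < +oo)%E by case/integrableP: intg.
apply: lte_mul_pinfty => //; first exact: integral_ge0.
by rewrite ge0_fin_numE//; exact: integral_ge0.
Qed.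

Lemma integrable_cVS (R : realType) n (f : R -> R) (g : 'cV[R]_n -> R) :
  (@lebesgue_measure R).-integrable setT (EFin \o f) ->
  (lebesgue_cV R n).-integrable setT (EFin \o g) ->
  (lebesgue_cV R n.+1).-integrable setT
    (EFin \o (fun x => f (unconsc x).1 * g (unconsc x).2)) /\
  \int[lebesgue_cV R n.+1]_x (f (unconsc x).1 * g (unconsc x).2) =
  (\int[@lebesgue_measure R]_x f x) * (\int[lebesgue_cV R n]_x g x).
Proof.
move=> intf intg.
have intfg := integrable_tensor intf intg.
set h := (fun x => _).
have mf : measurable_fun setT f by apply/measurable_EFinP; case/integrableP: intf.
have mg : measurable_fun setT g by apply/measurable_EFinP; case/integrableP: intg.
have mh : measurable_fun setT (EFin \o h).
  apply/measurable_EFinP; apply: measurable_funM.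
    exact: (measurableT_comp mf (measurableT_comp measurable_fst (@measurable_unconsc R n))).
  exact: (measurableT_comp mg (measurableT_comp measurable_snd (@measurable_unconsc R n))).
have hE : (EFin \o h) \o @consc R n = EFin \o (fun p => f p.1 * g p.2).
  by apply/funext => p; rewrite /comp /h !conscK.
have mc : measurable_fun [set: measurableTypeR R * 'cV[R]_n] (@consc R n).
  exact: measurable_consc.
pose M : {measure set (measurableTypeR R * 'cV[R]_n)%type -> \bar R} :=
  (@lebesgue_measure R \x lebesgue_cV R n)%E.
have int' : M.-integrable (@consc R n @^-1` setT)
    ((EFin \o h) \o @consc R n) by rewrite hE preimage_setT.
have cVSE (k : 'cV[R]_n.+1 -> \bar R) : (\int[lebesgue_cV R n.+1]_x k x =
    \int[pushforward M (@consc R n)]_x k x)%E.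
  by apply: eq_measure_integral => A mA _.
split.
  have /integrableP[_ fin] :=
    @integrable_pushforward _ _ _ _ R _ mc M _ _ mh int' measurableT.
  by apply/integrableP; split => //; rewrite cVSE.
rewrite /Rintegral cVSE (@integral_pushforward _ _ _ _ R _ mc M _ _ mh int' measurableT).
rewrite hE preimage_setT /M -integral12_prod_meas1// /fubini_F/=.
have gfin : (\int[lebesgue_cV R n]_x (g x)%:E)%E \is a fin_num by exact: integrable_fin_num.
have ffin : (\int[@lebesgue_measure R]_x (f x)%:E)%E \is a fin_num by exact: integrable_fin_num.
under eq_integral => a _.
  under eq_integral => x _ do rewrite EFinM.
  rewrite integralZl//.
  rewrite -(fineK gfin). over.
rewrite /= integralZr//.
by rewrite fineK// fineM.
Qed.

Definition cintegrable (R : realType) d (T : measurableType d)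
    (mu : {measure set T -> \bar R}) (f : T -> R[i]) :=
  mu.-integrable setT (EFin \o (fun x => complex.Re (f x))) /\
  mu.-integrable setT (EFin \o (fun x => complex.Im (f x))).

(** Fubini, one coordinate at a time. The complex form is needed for the Fourier
    transform, whose kernel is a product over the coordinates. *)
Lemma cintegral_tensor (R : realType) n (g : 'I_n -> R -> R[i]) :
  (forall j, cintegrable (@lebesgue_measure R) (g j)) ->
  let G (x : 'cV[R]_n) := \prod_j g j (x j 0) in
  cintegrable (lebesgue_cV R n) G /\
  cintegral G = \prod_j ((\int[@lebesgue_measure R]_t complex.Re (g j t)) +i*
                        (\int[@lebesgue_measure R]_t complex.Im (g j t)))%C.
Proof.
elim: n g => [|n IHn] g intg /=.
  under [X in cintegrable _ X]eq_fun do rewrite big_ord0.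
  rewrite [X in cintegral X](_ : _ = cst 1); last by apply/funext => x; rewrite big_ord0.
  rewrite big_ord0; split.
    split; [apply: (@eq_integrable _ _ _ _ _ measurableT (cst 1%:E)) => //|
            apply: (@eq_integrable _ _ _ _ _ measurableT (cst 0%:E)) => //].
      by apply: finite_measure_integrable_cst.
    by apply: integrable0.
  rewrite /cintegral /=.
  by rewrite /Rintegral !integral_dirac//= indicE mem_set// mul1r mulr0.
have [[iRe iIm] E] := IHn (fun j => g (lift ord0 j)) (fun j => intg (lift ord0 j)).
set G := fun x : 'cV[R]_n => _ in iRe iIm E.
have [fRe fIm] := intg ord0.
have GE : (fun x : 'cV[R]_n.+1 => \prod_j g j (x j 0)) =
    (fun x => g ord0 (unconsc x).1 * G (unconsc x).2).
  apply/funext => x; rewrite big_ord_recl; congr (_ * _).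
  by apply: eq_bigr => j _; rewrite /= mxE.
have ReM (z w : R[i]) : complex.Re (z * w) =
  complex.Re z * complex.Re w - complex.Im z * complex.Im w by case: z w => ? ? [].
have ImM (z w : R[i]) : complex.Im (z * w) =
  complex.Re z * complex.Im w + complex.Im z * complex.Re w by case: z w => ? ? [].
have [rr rrE] := integrable_cVS fRe iRe.
have [ii iiE] := integrable_cVS fIm iIm.
have [ri riE] := integrable_cVS fRe iIm.
have [ir irE] := integrable_cVS fIm iRe.
rewrite GE; split.
  split; rewrite /comp.
    by under eq_fun do rewrite ReM EFinB; exact: integrableB.
  by under eq_fun do rewrite ImM EFinD; exact: integrableD.
rewrite /cintegral.
under eq_Rintegral do rewrite ReM.
under [X in (_ +i* X)%C]eq_Rintegral do rewrite ImM.
rewrite RintegralB// RintegralD// rrE iiE riE irE.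
rewrite big_ord_recl -E /cintegral.
by rewrite [RHS]/GRing.mul.
Qed.

Lemma Rintegral_tensor (R : realType) n (g : 'I_n -> R -> R) :
  (forall j, (@lebesgue_measure R).-integrable setT (EFin \o g j)) ->
  (lebesgue_cV R n).-integrable setT
    (EFin \o (fun x : 'cV[R]_n => \prod_j g j (x j 0))) /\
  \int[lebesgue_cV R n]_x (\prod_j g j (x j 0)) =
  \prod_j \int[@lebesgue_measure R]_t g j t.
Proof.
move=> ig; have [|[iRe _] E] := @cintegral_tensor R n (fun j t => (g j t)%:C%C).
  by move=> j; split => //=; exact: integrable0.
have PE (x : 'cV[R]_n) : \prod_j (g j (x j 0))%:C%C = (\prod_j g j (x j 0))%:C%C.
  by rewrite rmorph_prod.
split.
  apply: eq_integrable iRe => // x _.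
  by rewrite /comp PE.
have := congr1 (@complex.Re R) E; rewrite /cintegral/=.
under eq_Rintegral do rewrite PE.
move=> ->.
rewrite [X in complex.Re X](_ : _ = (\prod_j \int[@lebesgue_measure R]_t g j t)%:C%C)//.
rewrite rmorph_prod; apply: eq_bigr => j _.
by rewrite Rintegral_cst// mul0r.
Qed.

(** The change of variables [x -> M x], with [k = 1 / |det M|]. Leaving [k] abstract
    keeps determinants out of the induction in [ge0_integral_spd]. *)
Definition scales_lebesgue (R : realType) n (M : 'M[R]_n) (k : R) :=
  forall F : 'cV[R]_n -> \bar R, measurable_fun setT F -> (forall x, 0 <= F x)%E ->
    (\int[lebesgue_cV R n]_x F (M *m x)%R = k%:E * \int[lebesgue_cV R n]_x F x)%E.

Lemma measurable_mulmx (R : realType) m n (M : 'M[R]_(m, n)) :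
  measurable_fun [set: 'cV[R]_n] (mulmx M : 'cV[R]_n -> 'cV[R]_m).
Proof.
have := measurable_affine_cV M 0.
by under eq_fun do rewrite addr0.
Qed.

Lemma spd_scales (R : realType) n (B : 'M[R]_n) : spd B ->
  exists2 k, 0 < k & scales_lebesgue B k.
Proof.
move=> /ge0_integral_spd[k k0 kB]; exists k => // F mF F0.
by rewrite -(kB 0)//; apply: eq_integral => x _; rewrite addr0.
Qed.

Lemma scales_invmx (R : realType) n (B : 'M[R]_n) k : B \in unitmx -> 0 < k ->
  scales_lebesgue B k -> scales_lebesgue (invmx B) k^-1.
Proof.
move=> uB k0 sB F mF F0.
have mF' : measurable_fun setT (fun x => F (invmx B *m x)).
  exact: measurableT_comp mF (measurable_mulmx _).
have := sB _ mF' (fun x => F0 _).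
under eq_integral => x _ do rewrite mulmxA mulVmx// mul1mx.
by move=> ->; rewrite muleA -EFinM mulVf ?gt_eqF// mul1e.
Qed.

Lemma scales_integral (R : realType) n (B : 'M[R]_n) k (F : 'cV[R]_n -> R) :
  0 < k -> scales_lebesgue B k ->
  (lebesgue_cV R n).-integrable setT (EFin \o F) ->
  (lebesgue_cV R n).-integrable setT (EFin \o (fun x => F (B *m x))) /\
  \int[lebesgue_cV R n]_x F (B *m x) = k * \int[lebesgue_cV R n]_x F x.
Proof.
move=> k0 sB intF.
have [mF Ffin] := integrableP _ _ _ intF.
have mFB : measurable_fun setT (EFin \o (fun x => F (B *m x))).
  exact: measurableT_comp mF (measurable_mulmx _).
split.
  apply/integrableP; split => //.
  rewrite (sB (fun x => `|(F x)%:E|)%E)//; last exact: measurableT_comp.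
  by apply: lte_mul_pinfty => //; rewrite ?lee_fin ?ltW.
rewrite /Rintegral.
rewrite (_ : k = fine k%:E)// -fineM//; last exact: integrable_fin_num.
congr fine.
rewrite integralE [in RHS]integralE muleBr//; last first.
  by apply: fin_num_adde_defr; apply: integrable_fin_num => //; exact: integrable_funepos.
rewrite -(sB (EFin \o F)^\+%E)//; last exact: measurable_funepos.
rewrite -(sB (EFin \o F)^\-%E)//; last exact: measurable_funeneg.
by congr (_ - _)%E; apply: eq_integral => x _; rewrite ?funeposE ?funenegE.
Qed.

Lemma scales_cintegral (R : realType) n (B : 'M[R]_n) k (F : 'cV[R]_n -> R[i]) :
  0 < k -> scales_lebesgue B k -> cintegrable (lebesgue_cV R n) F ->
  cintegrable (lebesgue_cV R n) (fun x => F (B *m x)) /\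
  cintegral (fun x => F (B *m x)) = k%:C%C * cintegral F.
Proof.
move=> k0 sB [iRe iIm].
have [iRe' ReE] := scales_integral k0 sB iRe.
have [iIm' ImE] := scales_integral k0 sB iIm.
split; first by split.
rewrite /cintegral (ReE : _ = _) (ImE : _ = _).
by rewrite [RHS]/GRing.mul/= !mul0r subr0 addr0.
Qed.

(** * Square roots of positive definite matrices *)

Lemma spd_unitmx (R : realType) n (A : 'M[R]_n) : spd A -> A \in unitmx.
Proof.
move=> [symA posA]; rewrite -row_free_unit -kermx_eq0; apply/eqP.
apply/row_matrixP => i; rewrite row0.
apply/eqP; apply: contraT => r0.
have kA : (row i (kermx A)) *m A = 0.
  by apply/sub_kermxP; exact: row_sub.
have /posA : (row i (kermx A))^T != 0 by rewrite -trmx0 (inj_eq trmx_inj).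
rewrite -{1}symA -trmx_mul kA trmx0 /dotv big1 ?ltxx// => j _.
by rewrite mxE mul0r.
Qed.

(** Lagrange interpolation, in Newton's incremental form. *)
Lemma interpolation (R : fieldType) (s : seq R) (g : R -> R) :
  exists p : {poly R}, forall x, x \in s -> p.[x] = g x.
Proof.
elim: s => [|a s [p ps]]; first by exists 0.
have [as_|as_] := boolP (a \in s).
  by exists p => x; rewrite inE => /predU1P[->|]; exact: ps.
(* A multiple of [q] corrects the value at [a] and keeps those on [s]. *)
pose q := \prod_(b <- s) ('X - b%:P).
have qa : q.[a] != 0.
  by rewrite -[_ != 0]/(~~ root q a) root_prod_XsubC.
exists (p + ((g a - p.[a]) / q.[a]) *: q) => x.
rewrite hornerD hornerZ inE => /predU1P[->|xs].
  by rewrite divfK// addrC subrK.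
have /eqP -> : root q x by rewrite root_prod_XsubC.
by rewrite mulr0 addr0 ps.
Qed.

Lemma horner_mx_tr (R : comNzRingType) n (A : 'M[R]_n.+1) (p : {poly R}) :
  A^T = A -> (horner_mx A p)^T = horner_mx A p.
Proof.
move=> symA; elim/poly_ind: p => [|p c IH].
  by rewrite rmorph0 trmx0.
rewrite rmorphD rmorphM/= horner_mx_X horner_mx_C linearD/= tr_scalar_mx.
rewrite -mulmxE trmx_mul IH symA mulmxE; congr (_ + _).
by have := congr1 (horner_mx A) (mulrC 'X p); rewrite !rmorphM/= horner_mx_X.
Qed.

Lemma spd_eigenvalue_gt0 (R : realType) n (A : 'M[R]_n) (l : R) : spd A ->
  A - l%:M \notin unitmx -> 0 < l.
Proof.
move=> [symA posA]; rewrite -row_free_unit -kermx_eq0 => k0.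
have [i ri0] : exists i, row i (kermx (A - l%:M)) != 0.
  apply/existsP; apply: contraNT k0; rewrite negb_exists => /forallP h.
  by apply/eqP/row_matrixP => i; rewrite row0; apply/eqP; rewrite -[_ == _]negbK.
set v := row i _ in ri0.
have vA : v *m A = l *: v.
  have : v *m (A - l%:M) = 0 by apply/sub_kermxP; exact: row_sub.
  by rewrite mulmxBr mul_mx_scalar => /eqP; rewrite subr_eq0 => /eqP.
have v0 : v^T != 0 by rewrite -trmx0 (inj_eq trmx_inj).
have := posA _ v0; rewrite -{1}symA -trmx_mul vA linearZ/= dotvZl.
have vv : 0 <= dotv v^T v^T by apply: sumr_ge0 => j _; rewrite -expr2 sqr_ge0.
by move=> h; rewrite ltNge; apply/negP => l0; move: h; rewrite ltNge mulr_le0_ge0.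
Qed.

(** By the spectral theorem over the complex numbers, [A] is unitarily similar to a
    diagonal matrix with positive real entries [l i]. So a real polynomial in [A] is
    determined by its values at the [l i], and the square root can be found among
    these polynomials without leaving the real numbers. *)
Lemma spd_spectrum (R : realType) n (A : 'M[R]_n.+1) : spd A ->
  exists2 l : 'I_n.+1 -> R, forall i, 0 < l i &
    forall p q : {poly R}, (forall i, p.[l i] = q.[l i]) -> horner_mx A p = horner_mx A q.
Proof.
move=> sA; have [symA posA] := sA.
pose AC := map_mx (real_complex R) A.
have realA : AC \is a realmx.
  by apply/mxOverP => i j; rewrite mxE; apply/complex_realP; exists (A i j).
have hermA : AC \is hermsymmx.
  apply: realsym_hermsym => //; apply/is_hermitianmxP.
  by rewrite expr0 scale1r map_mx_id_in// /AC map_trmx symA.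
have /orthomx_spectralP := hermitian_normalmx hermA.
set P := spectralmx AC; set D := spectral_diag AC => AE.
have uP : P \in unitmx by exact: spectral_unit.
pose l i := complex.Re (D 0 i).
have Dl i : D 0 i = (l i)%:C%C.
  rewrite /l RRe_real//; have /mxOverP := hermitian_spectral_diag_real hermA; exact.
exists l => [i|p q pq].
  apply: (spd_eigenvalue_gt0 sA).
  rewrite unitmxE unitfE negbK -(fmorph_eq0 (real_complex R)) -det_map_mx.
  rewrite map_mxB/= map_scalar_mx/= -/AC AE -Dl.
  have -> : (D 0 i)%:M = invmx P *m (D 0 i)%:M *m P.
    by rewrite mul_mx_scalar -scalemxAl mulVmx// scalemx1.
  rewrite -mulmxBl -mulmxBr !det_mulmx.
  have -> : \det (diag_mx D - (D 0 i)%:M) = 0.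
    rewrite -diag_const_mx -linearB det_diag (bigD1 i)//= !mxE subrr mul0r //.
  by rewrite mulr0 mul0r.
apply: (map_mx_inj (f := real_complex R)).
have hE (r : {poly R}) : map_mx (real_complex R) (horner_mx A r) =
    invmx P *m diag_mx (map_mx (horner (map_poly (real_complex R) r)) D) *m P.
  rewrite map_horner_mx -/AC {1}AE.
  rewrite -horner_mx_diag.
  exact: (horner_mx_uconjC _ _ uP).
rewrite (hE p) (hE q).
suff -> : map_mx (horner (map_poly (real_complex R) p)) D =
  map_mx (horner (map_poly (real_complex R) q)) D by [].
by apply/rowP => i; rewrite [LHS]mxE [RHS]mxE Dl !horner_map pq.
Qed.

(** Take [B = C^2] with [C = q(A)] and [q] interpolating the fourth root on the
    spectrum: [C] is symmetric, so the form of [B] at [x] is [|C x|^2]. *)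
Lemma spd_sqrt_ex (R : realType) n (A : 'M[R]_n) : spd A ->
  exists B, spd B /\ B *m B = A.
Proof.
case: n A => [|n] A sA; first by exists A; split => //; apply/matrixP => -[].
have [l l0 lP] := spd_spectrum sA; have [symA posA] := sA.
have [q qP] := interpolation (codom l) (fun x => Num.sqrt (Num.sqrt x)).
have ql i : q.[l i] ^+ 4 = l i.
  by rewrite qP ?codom_f// (exprM _ 2 2) !sqr_sqrtr ?sqrtr_ge0 ?ltW.
pose C := horner_mx A q.
have C4 : C *m C *m (C *m C) = A.
  have := lP (q ^+ 4) 'X; rewrite horner_mx_X => <-; last first.
    by move=> i; rewrite horner_exp hornerX.
  by rewrite !mulmxE -!rmorphM -!expr2 -exprM.
have symC : C^T = C by exact: horner_mx_tr.
exists (C *m C); split => //; split; first by rewrite trmx_mul symC.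
move=> x x0; rewrite -mulmxA dotv_mulmx symC.
have Cx0 : C *m x != 0.
  apply: contraTneq (posA _ x0) => Cx; rewrite -C4 -!mulmxA Cx !mulmx0.
  by rewrite dotvC dotv0 ltxx.
rewrite lt_neqAle; apply/andP; split; last first.
  by apply: sumr_ge0 => j _; rewrite -expr2 sqr_ge0.
apply: contraNneq Cx0 => /esym/psumr_eq0P h; apply/eqP/colP => j; rewrite [RHS]mxE.
apply/eqP; rewrite -sqrf_eq0 expr2.
by apply/eqP/h => // i _; rewrite -expr2 sqr_ge0.
Qed.

Lemma sqrtmxP (R : realType) n (A : 'M[R]_n) : spd A ->
  spd (sqrtmx A) /\ sqrtmx A *m sqrtmx A = A.
Proof.
by move=> sA; rewrite /sqrtmx; have [B sB] := spd_sqrt_ex sA; by case: xgetP => [C _ []|/(_ B)/(_ sB)].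
Qed.

(** * Polynomials times Gaussians on the line *)

Lemma horner_le_gauss (R : realType) (P : {poly R}) (s : R) : 0 < s ->
  exists2 C, 0 < C & forall x, `|P.[x]| <= C * expR (s * x ^+ 2).
Proof.
elim/poly_ind: P s => [|P c IH] s s0.
  by exists 1 => // x; rewrite horner0 normr0 mul1r expR_ge0.
have s20 : 0 < s / 2 by rewrite divr_gt0.
have [C C0 HC] := IH _ s20.
have hx (x : R) : `|x| <= (1 + (s / 2)^-1) * expR (s / 2 * x ^+ 2).
  apply: (@le_trans _ _ ((1 + (s / 2)^-1) * (1 + s / 2 * x ^+ 2))); last first.
    by rewrite ler_pM2l ?expR_ge1Dx// ltr_wpDr// invr_ge0 ltW.
  move: s20; set t := s / 2 => t0.
  have -> : (1 + t^-1) * (1 + t * x ^+ 2) = 1 + t * x ^+ 2 + t^-1 + x ^+ 2.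
    by field; rewrite gt_eqF.
  have h1 : `|x| <= 1 + x ^+ 2.
    rewrite -(real_normK (num_real x)); have := sqr_ge0 (`|x| - 2^-1).
    by rewrite sqrrB; lra.
  have h2 : 0 <= t^-1 by rewrite invr_ge0 ltW.
  have h3 : 0 <= t * x ^+ 2 by rewrite mulr_ge0 ?sqr_ge0// ltW.
  lra.
(* Each factor [X] is paid for with half of the exponent. *)
exists (C * (1 + (s / 2)^-1) + `|c| + 1).
  by rewrite ltr_wpDl// addr_ge0// mulr_ge0 ?ltW// ltr_wpDr ?invr_ge0 ?ltW.
move=> x; rewrite hornerMXaddC.
apply: (le_trans (ler_normD _ _)); rewrite normrM !mulrDl.
have e1 : 1 <= expR (s * x ^+ 2) by rewrite -expR0 ler_expR mulr_ge0 ?sqr_ge0// ltW.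
have -> : C * (1 + (s / 2)^-1) * expR (s * x ^+ 2) =
    (C * expR (s / 2 * x ^+ 2)) * ((1 + (s / 2)^-1) * expR (s / 2 * x ^+ 2)).
  rewrite [in LHS](_ : s * x ^+ 2 = s / 2 * x ^+ 2 + s / 2 * x ^+ 2); last by field.
  by rewrite expRD; ring.
rewrite -addrA; apply: lerD; first exact: ler_pM.
by apply: ler_wpDr; [rewrite mul1r expR_ge0|rewrite ler_peMr].
Qed.

Lemma integral_gauss (R : realType) (s : R) : 0 < s ->
  (\int[@lebesgue_measure R]_x (expR (- s * x ^+ 2))%:E =
   ((Num.sqrt s)^-1 * Num.sqrt pi)%:E)%E.
Proof.
move=> s0.
have s20 : 0 < Num.sqrt s by rewrite sqrtr_gt0.
rewrite [LHS](_ : _ = \int[@lebesgue_measure R]_x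
    (EFin \o @gauss_fun R) (Num.sqrt s * x + 0)%R)%E; last first.
  apply: eq_integral => x _; rewrite /= /gauss_fun addr0 exprMn sqr_sqrtr ?ltW//.
  by rewrite mulNr.
rewrite (@ge0_integral_affine R _ _ (EFin \o @gauss_fun R))//.
- by rewrite integralT_gauss.
- by apply/measurable_EFinP; exact: measurable_gauss_fun.
- by move=> a; rewrite lee_fin gauss_fun_ge0.
Qed.

Lemma integrable_gauss (R : realType) (s : R) : 0 < s ->
  (@lebesgue_measure R).-integrable setT (EFin \o (fun x => expR (- s * x ^+ 2))).
Proof.
move=> s0.
have ms : measurable_fun [set: R] (fun x : R => expR (- s * x ^+ 2)).
  by apply: measurableT_comp => //; apply: measurable_funM => //; exact: measurable_funX.
apply/integrableP; split; first exact/measurable_EFinP.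
under eq_integral => x _ do rewrite /= ger0_norm ?expR_ge0//.
by rewrite integral_gauss// ltry.
Qed.

Lemma Rintegral_gauss (R : realType) (s : R) : 0 < s ->
  \int[@lebesgue_measure R]_x expR (- s * x ^+ 2) = (Num.sqrt s)^-1 * Num.sqrt pi.
Proof. by move=> s0; rewrite /Rintegral integral_gauss. Qed.

Lemma Rintegral_gauss_gt0 (R : realType) (s : R) : 0 < s ->
  0 < \int[@lebesgue_measure R]_x expR (- s * x ^+ 2).
Proof.
by move=> s0; rewrite Rintegral_gauss// mulr_gt0// ?invr_gt0 sqrtr_gt0// pi_gt0.
Qed.

Lemma integrable_le_gauss (R : realType) (f : R -> R) (C s : R) : 0 < s ->
  measurable_fun setT f -> (forall x, `|f x| <= C * expR (- s * x ^+ 2)) ->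
  (@lebesgue_measure R).-integrable setT (EFin \o f).
Proof.
move=> s0 mf le_f.
pose g : measurableTypeR R -> \bar R := fun x => (C%:E * (expR (- s * x ^+ 2))%:E)%E.
apply: (le_integrable measurableT (g := g)).
- exact/measurable_EFinP.
- by move=> x _; rewrite lee_fin (le_trans (le_f x))// ler_norm.
- by apply: integrableZl => //; exact: integrable_gauss.
Qed.

(** The fundamental theorem of calculus on growing intervals, with dominated
    convergence; the boundary terms vanish because of the Gaussian bound. *)
Lemma integral_eq0_of_derivative (R : realType) (F f : R -> R) (C s : R) : 0 < s ->
  (forall x : R, is_derive x 1 F (f x)) -> continuous f ->
  (@lebesgue_measure R).-integrable setT (EFin \o f) ->
  (forall x, `|F x| <= C * expR (- s * x ^+ 2)) ->
  \int[@lebesgue_measure R]_x f x = 0.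
Proof.
move=> s0 dF cf intf F_le.
pose I n := `[- (n.+1%:R : R), n.+1%:R]%classic.
have intfn n : \int[@lebesgue_measure R]_(x in I n) f x = F n.+1%:R - F (- n.+1%:R).
  rewrite /Rintegral (@continuous_FTC2 R f F).
  - by [].
  - by rewrite (@lt_trans _ _ 0)// oppr_lt0.
  - exact: continuous_subspaceT.
  - split.
    + by move=> x _; exact: ex_derive.
    + by apply: cvg_at_right_filter; apply: differentiable_continuous; apply/derivable1_diffP; exact: ex_derive.
    + by apply: cvg_at_left_filter; apply: differentiable_continuous; apply/derivable1_diffP; exact: ex_derive.
  - by move=> x _; rewrite derive1E derive_val.
have cvgI : \int[@lebesgue_measure R]_(x in I n) f x @[n --> \oo] --> \int[@lebesgue_measure R]_x f x.
  have [] := @dominated_convergence _ (measurableTypeR R) R lebesgue_measure setT measurableT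
    (fun n => (EFin \o f) \_ (I n)) (EFin \o f) (fun x => `|(f x)%:E|%E).
  - move=> n; apply/(measurable_restrictT _ _).1 => //; first exact: measurable_itv.
    by apply: measurable_funTS; case/integrableP: intf.
  - by case/integrableP: intf.
  - apply/aeW => x _; apply: cvg_near_cst; near=> n.
    have xn : `|x| <= n%:R by near: n; exact: nbhs_infty_ger.
    have xI : I n x by rewrite /I/= in_itv/= -ler_norml (le_trans xn)// ler_nat.
    by rewrite patchE mem_set.
  - by apply: integrable_abse.
  - apply/aeW => x n _; rewrite patchE; case: ifPn => // _ /=.
    by rewrite normr0 lee_fin.
  move=> _ _; rewrite -[X in _ --> X](fineK (integrable_fin_num _ intf))//.
  move=> /fine_cvg; rewrite /Rintegral; move=> h; apply: cvg_trans h.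
  rewrite (_ : (fun n => _) = fine \o [sequence (\int[lebesgue_measure]_x ((EFin \o f) \_ (I n)) x)%E]_n)//.
  by apply/funext => n /=; rewrite integral_mkcond.
have cvg0 : (F n.+1%:R - F (- n.+1%:R)) @[n --> \oo] --> 0.
  have cvgF (u : nat -> R) : (forall n, u n ^+ 2 = n.+1%:R ^+ 2) -> F (u n) @[n --> \oo] --> 0.
    move=> uE; apply: norm_cvg0.
    apply: (@squeeze_cvgr _ _ _ _ (cst 0) (fun n => (`|C| / s) * n.+1%:R^-1)).
    - near=> n; rewrite normr_ge0/=; apply: (le_trans (F_le _)).
      rewrite uE; have n0 : 0 < s * n.+1%:R ^+ 2 :> R by rewrite mulr_gt0// exprn_gt0.
      apply: (@le_trans _ _ (`|C| * expR (- s * n.+1%:R ^+ 2))).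
        by rewrite ler_wpM2r ?expR_ge0// ler_norm.
      rewrite -mulrA ler_wpM2l// mulNr expRN -invfM lef_pV2 ?posrE ?expR_gt0//; last first.
        by rewrite mulr_gt0.
      apply: (@le_trans _ _ (s * n.+1%:R ^+ 2)).
        by rewrite ler_pM2l// expr2 ler_peMl// ler1n.
      by apply: le_trans (expR_ge1Dx _); rewrite lerDr.
    - exact: cvg_cst.
    - rewrite -[X in _ --> X](mulr0 (`|C| / s)); apply: cvgMr; exact: cvg_harmonic.
  rewrite -[X in _ --> X](subr0 0); apply: cvgB; apply: cvgF => n //.
  by rewrite sqrrN.
rewrite (funext intfn) in cvgI.
exact: (cvg_unique _ cvgI cvg0).
Unshelve. all: by end_near. Qed.

Lemma continuous_mul (R : realType) (f g : R -> R) :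
  continuous f -> continuous g -> continuous (fun x => f x * g x).
Proof. by move=> cf cg x; exact: (cvgM (cf x) (cg x)). Qed.

Lemma continuous_gauss (R : realType) (s : R) : continuous (fun x : R => expR (- s * x ^+ 2)).
Proof.
move=> x; apply: (@continuous_comp _ _ _ (fun x : R => - s * x ^+ 2) expR); last exact: continuous_expR.
by apply: cvgM; [exact: cvg_cst|exact: exprn_continuous].
Qed.

Lemma continuous_horner (R : realType) (P : {poly R}) : continuous (horner P).
Proof.
by move=> x; apply: differentiable_continuous; apply/derivable1_diffP; exact: derivable_horner.
Qed.

Lemma horner_gauss_le (R : realType) (P : {poly R}) (s : R) : 0 < s ->
  exists2 C, 0 < C & forall x, `|P.[x] * expR (- s * x ^+ 2)| <= C * expR (- (s / 2) * x ^+ 2).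
Proof.
move=> s0; have [C C0 HC] := horner_le_gauss P (divr_gt0 s0 (ltr0n R 2)).
exists C => // x; rewrite normrM (ger0_norm (expR_ge0 _)).
have -> : - s * x ^+ 2 = - (s / 2) * x ^+ 2 - (s / 2) * x ^+ 2 by field.
rewrite (mulNr (s / 2)) expRD mulrA ler_pM2r ?expR_gt0//.
apply: le_trans (ler_wpM2r (expR_ge0 _) (HC x)) _.
by rewrite -mulrA -expRD subrr expR0 mulr1.
Qed.

Lemma integrable_horner_gauss (R : realType) (P : {poly R}) (s K : R) (b : R -> R) :
  0 < s -> continuous b -> (forall x, `|b x| <= K) ->
  (@lebesgue_measure R).-integrable setT
    (EFin \o (fun x => P.[x] * expR (- s * x ^+ 2) * b x)).
Proof.
move=> s0 cb bK; have [C C0 HC] := horner_gauss_le P s0.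
apply: (@integrable_le_gauss _ _ (C * K) (s / 2)); first by rewrite divr_gt0.
  apply: continuous_measurable_fun; apply: continuous_mul => //.
  by apply: continuous_mul; [exact: continuous_horner|exact: continuous_gauss].
by move=> x; rewrite normrM mulrAC; exact: ler_pM.
Qed.

(** The left-hand integrand plus the right-hand one is the derivative of
    [P.[x] * exp(- s x^2) * b x]. *)
Lemma ibp_horner_gauss (R : realType) (P : {poly R}) (s K : R) (b db : R -> R) :
  0 < s -> (forall x : R, is_derive x 1 b (db x)) -> continuous db ->
  (forall x, `|b x| <= K) -> (forall x, `|db x| <= K) ->
  \int[@lebesgue_measure R]_x ((P^`() - (2 * s) *: ('X * P)).[x] * expR (- s * x ^+ 2) * b x) =
  - \int[@lebesgue_measure R]_x (P.[x] * expR (- s * x ^+ 2) * db x).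
Proof.
move=> s0 dfb cdb bK dbK.
have cb : continuous b.
  move=> x; apply: differentiable_continuous; apply/derivable1_diffP; exact: ex_derive.
set Q := P^`() - _.
have iQ := integrable_horner_gauss Q s0 cb bK.
have iP := integrable_horner_gauss P s0 cdb dbK.
apply/eqP; rewrite -addr_eq0 -RintegralD//; apply/eqP.
have [C C0 HC] := horner_gauss_le P s0.
apply: (@integral_eq0_of_derivative _ (fun x => P.[x] * expR (- s * x ^+ 2) * b x)
  _ (C * K) (s / 2)); first by rewrite divr_gt0.
- move=> x; apply: is_derive_eq.
  rewrite /Q !hornerE /GRing.scale /=; ring.
- have cg (T : {poly R}) (t : R -> R) : continuous t ->
      continuous (fun x => T.[x] * expR (- s * x ^+ 2) * t x).
    move=> ct; apply: continuous_mul => //.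
    by apply: continuous_mul; [exact: continuous_horner|exact: continuous_gauss].
  by move=> x; exact: (cvgD (cg Q b cb x) (cg P db cdb x)).
- by rewrite /comp; under eq_fun do rewrite EFinD; exact: integrableD.
- by move=> x; rewrite normrM mulrAC; exact: ler_pM.
Qed.

(** Let [T] be the cosine or the sine. As a function of [xi], the integral
    satisfies [g' = - xi g]: differentiate under the integral sign and integrate
    by parts. So [exp(xi^2 / 2) g(xi)] is constant. Only [T'' = - T] and the bounds
    matter, which is why both functions are treated at once. *)
Lemma gauss_fourier (R : realType) (T dT : R -> R) :
  (forall x : R, is_derive x 1 T (dT x)) -> (forall x : R, is_derive x 1 dT (- T x)) ->
  (forall x, `|T x| <= 1) -> (forall x, `|dT x| <= 1) ->
  forall xi : R, \int[@lebesgue_measure R]_x (expR (- (2^-1) * x ^+ 2) * T (xi * x)) =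
    expR (- (2^-1) * xi ^+ 2) * \int[@lebesgue_measure R]_x (expR (- (2^-1) * x ^+ 2) * T 0).
Proof.
move=> dfT dfdT T1 dT1 xi.
pose g xi := \int[@lebesgue_measure R]_x (expR (- (2^-1) * x ^+ 2) * T (xi * x)).
have s0 : 0 < 2^-1 :> R by rewrite invr_gt0.
have cT : continuous T.
  by move=> x; apply: differentiable_continuous; apply/derivable1_diffP; exact: ex_derive.
have cdT : continuous dT.
  by move=> x; apply: differentiable_continuous; apply/derivable1_diffP; exact: ex_derive.
have cscale (f : R -> R) (t : R) : continuous f -> continuous (fun x => f (t * x)).
  move=> cf x; apply: (@continuous_comp _ _ _ (fun x : R => t * x) f); last exact: cf.
  exact: mulrl_continuous.
have intg (t : R) : (@lebesgue_measure R).-integrable setT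
    (EFin \o (fun x => expR (- (2^-1) * x ^+ 2) * T (t * x))).
  have := @integrable_horner_gauss R 1 _ 1 (fun x => T (t * x)) s0 (cscale _ _ cT) (fun x => T1 _).
  by under [X in _.-integrable _ X -> _]eq_fun do rewrite /= hornerC mul1r.
have df (y t : R) : is_derive t 1 (fun t => expR (- (2^-1) * y ^+ 2) * T (t * y))
    ('X.[y] * expR (- (2^-1) * y ^+ 2) * dT (t * y)).
  have h : is_derive t 1 (T \o (fun t => t * y)) (dT (t * y) * y).
    apply: is_derive1_comp; apply: is_derive_eq; rewrite /GRing.scale /=; ring.
  have -> : 'X.[y] * expR (- (2^-1) * y ^+ 2) * dT (t * y) =
    expR (- (2^-1) * y ^+ 2) *: (dT (t * y) * y) by rewrite hornerX /GRing.scale/=; ring.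
  exact: is_deriveZ.
have part (t y : R) : partial1of2 (fun t y => expR (- (2^-1) * y ^+ 2) * T (t * y)) t y =
    'X.[y] * expR (- (2^-1) * y ^+ 2) * dT (t * y).
  by rewrite partial1of2E; have -> := @derive_val _ _ _ _ _ _ _ (df y t).
have intG : (@lebesgue_measure R).-integrable setT
    (EFin \o (fun x => `|'X.[x] * expR (- (2^-1) * x ^+ 2)|)).
  have h1 (x : R) : `|cst (1 : R) x| <= 1 by rewrite normr1.
  have := @integrable_horner_gauss R 'X _ 1 (cst 1) s0 (@cst_continuous _ _ _) h1.
  move=> /integrable_abse; apply: eq_integrable => // x _ /=.
  by rewrite mulr1.
have dg (t : R) : is_derive t 1 g (- t * g t).
  have tI : `]t - 1, t + 1[%classic t by rewrite /= in_itv/= ltrBlDr ltrDl ltr01.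
  have G_ub (x y : R) : `]t - 1, t + 1[%classic x -> [set: measurableTypeR R] y ->
      `|partial1of2 (fun t y => expR (- (2^-1) * y ^+ 2) * T (t * y)) x y| <=
      `|'X.[y] * expR (- (2^-1) * y ^+ 2)|.
    by move=> _ _; rewrite part normrM ler_piMr.
  apply: DeriveDef.
    apply: (derivable_under_integral measurableT tI _ _ _ intG G_ub) => //.
  rewrite -derive1E (differentiation_under_integral measurableT tI _ _ _ intG G_ub)//.
  under eq_Rintegral do rewrite part.
  have db (x : R) : is_derive x 1 (fun x => dT (t * x)) (- T (t * x) * t).
    have : is_derive x 1 (dT \o (fun x => t * x)) (- T (t * x) * t).
      by apply: is_derive1_comp; apply: is_derive_eq; rewrite /GRing.scale /=; ring.
    by [].
  have cdb : continuous (fun x => - T (t * x) * t).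
    move=> x; exact: (cvgM (cvgN (cscale _ t cT x)) (cvg_cst t)).
  have bK (x : R) : `|dT (t * x)| <= 1 + `|t| by rewrite ler_wpDr.
  have dbK (x : R) : `|- T (t * x) * t| <= 1 + `|t|.
    by rewrite normrM normrN ler_wpDl// ler_piMl.
  have := @ibp_horner_gauss R 1 _ _ _ _ s0 db cdb bK dbK.
  rewrite divff// scale1r derivC mulr1 sub0r.
  have intX := @integrable_horner_gauss R 'X _ _ _ s0 (cscale _ t cdT) bK.
  have QE (x : R) : (- 'X).[x] * expR (- 2^-1 * x ^+ 2) * dT (t * x) =
      -1 * ('X.[x] * expR (- 2^-1 * x ^+ 2) * dT (t * x)) by rewrite hornerN; ring.
  under eq_Rintegral do rewrite QE.
  rewrite RintegralZl// mulN1r => /oppr_inj ->.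
  rewrite -RintegralZl//; apply: eq_Rintegral => x _; rewrite hornerC; ring.
have gE t : expR (2^-1 * t ^+ 2) * g t = g 0.
  have dh (x : R) : is_derive x 1 (fun t => expR (2^-1 * t ^+ 2) * g t) 0.
    have de : is_derive x 1 (expR \o (fun t => 2^-1 * t ^+ 2)) (expR (2^-1 * x ^+ 2) * x).
      by apply: is_derive1_comp; apply: is_derive_eq; rewrite /GRing.scale /=; field.
    have := is_deriveM de (dg x).
    by rewrite (_ : _ *: _ + _ = 0)// /GRing.scale /=; ring.
  have := is_derive_0_is_cst t 0 dh.
  by rewrite expr0n mulr0 expR0 mul1r.
rewrite -/(g xi) -[X in _ = _ * X](_ : g 0 = _); last first.
  by apply: eq_Rintegral => x _; rewrite mul0r.
by rewrite -(gE xi) mulrA -expRD mulNr addNr expR0 mul1r.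
Qed.

(** * One-dimensional Hermite functions *)

Section hermite_polynomials.
Context (R : realType).

(** The recursion comes from [(P exp(- x^2))^`() = - (2 X P - P^`()) exp(- x^2)]. *)
Fixpoint hermp n : {poly R} :=
  if n is m.+1 then 2 *: ('X * hermp m) - (hermp m)^`() else 1.

Lemma deriv_hermp n : (hermp n)^`() = (2 * n%:R) *: hermp n.-1.
Proof.
elim: n => [|n IH]; first by rewrite derivC mulr0 scale0r.
rewrite [hermp n.+1]/= derivB derivZ derivM derivX mul1r IH derivZ.
case: n IH => [|n] IH.
  by rewrite mulr0 !scale0r subr0 mulr0 addr0 mulr1.
rewrite [hermp n.+1.-1]/= [hermp n.+2.-1]/= in IH *.
rewrite -scalerAr; apply/polyP => i; rewrite !(coefB, coefD, coefZ); ring.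
Qed.

Lemma hermpS n : hermp n.+1 = 2 *: ('X * hermp n) - (2 * n%:R) *: hermp n.-1.
Proof. by rewrite [LHS]/= deriv_hermp. Qed.

(** By induction on the degree, through the three-term recurrence: the hypothesis
    on [M] says that [2 |x| M + 2 n <= M^2]. *)
Lemma hermp_le_exp n (x M : R) : 2 * `|x| <= M -> 2 * n%:R <= M * (M - 2 * `|x|) ->
  `|(hermp n).[x]| <= M ^+ n.
Proof.
move=> xM nM; have M0 : 0 <= M by rewrite (le_trans _ xM)// mulr_ge0.
suff: forall k, (k < n)%N ->
    `|(hermp k).[x]| <= M ^+ k /\ `|(hermp k.+1).[x]| <= M ^+ k.+1.
  case: n nM => [|n] nM H; first by rewrite hornerC normr1 expr0.
  by have [] := H n (ltnSn _).
elim=> [|k IH] kn.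
  split; first by rewrite hornerC normr1 expr0.
  by rewrite hermpS /= mulr0 scale0r subr0 mulr1 hornerZ hornerX normrM expr1 ger0_norm.
have [Hk HSk] := IH (ltnW kn); split => //.
rewrite hermpS hornerD hornerN !hornerZ hornerM hornerX [k.+1.-1]/=.
apply: (le_trans (ler_normB _ _)); rewrite !normrM.
rewrite (ger0_norm (_ : 0 <= 2))// (ger0_norm (_ : 0 <= k.+1%:R))//.
have h1 : 2 * (`|x| * `|(hermp k.+1).[x]|) <= 2 * `|x| * M ^+ k.+1.
  by rewrite mulrA ler_wpM2l// mulr_ge0.
have h2 : 2 * k.+1%:R * `|(hermp k).[x]| <= M * (M - 2 * `|x|) * M ^+ k.
  apply: ler_pM => //.
  by apply: le_trans nM; rewrite ler_pM2l// ler_nat ltnW.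
apply: (le_trans (lerD h1 h2)); rewrite !exprS.
by rewrite le_eqVlt; apply/orP; left; apply/eqP; ring.
Qed.

(** For this choice of [M] in [hermp_le_exp], [M - 2 |x| = sqrt (2 n)]. *)
Lemma hermp_le n (x : R) :
  `|(hermp n).[x]| <= Num.sqrt 2 ^+ n * (Num.sqrt 2 * `|x| + Num.sqrt n%:R) ^+ n.
Proof.
rewrite -exprMn; apply: hermp_le_exp.
  by rewrite mulrDr mulrA -expr2 sqr_sqrtr// lerDl mulr_ge0// sqrtr_ge0.
have s2 : Num.sqrt 2 ^+ 2 = 2 :> R by rewrite sqr_sqrtr.
have sn : Num.sqrt n%:R ^+ 2 = n%:R :> R by rewrite sqr_sqrtr.
move: s2 sn (sqrtr_ge0 (2 : R)) (sqrtr_ge0 (n%:R : R)).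
move: (Num.sqrt 2) (Num.sqrt n%:R) => a b s2 <- a0 b0; rewrite -s2.
have -> : a * (a * `|x| + b) - a ^+ 2 * `|x| = a * b by ring.
have -> : a * (a * `|x| + b) * (a * b) = a ^+ 2 * (a * `|x| * b) + a ^+ 2 * b ^+ 2 by ring.
by rewrite lerDr mulr_ge0 ?exprn_ge0// ?mulr_ge0.
Qed.

Definition hermc n : R := (Num.sqrt (2 ^ n * n`!)%:R)^-1.

(** The Hermite functions of one variable without the factor [pi^(-1/4)]: the square
    of their norm is [sqrt pi]. *)
Definition hermf n (x : R) : R := hermc n * ((hermp n).[x] * expR (- 2^-1 * x ^+ 2)).

Lemma hermc_gt0 n : 0 < hermc n.
Proof. by rewrite invr_gt0 sqrtr_gt0 ltr0n muln_gt0 expn_gt0 fact_gt0. Qed.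

Lemma hermf_le n (x : R) : `|hermf n x| <=
  (Num.sqrt 2 * `|x| + Num.sqrt n%:R) ^+ n / Num.sqrt n`!%:R * expR (- 2^-1 * x ^+ 2).
Proof.
rewrite /hermf !normrM (ger0_norm (expR_ge0 _)) (gtr0_norm (hermc_gt0 n)) mulrA.
rewrite ler_wpM2r ?expR_ge0// /hermc natrM natrX sqrtrM ?exprn_ge0// invfM.
apply: (le_trans (ler_wpM2l _ (hermp_le n x))).
  by rewrite mulr_ge0// invr_ge0 sqrtr_ge0.
have -> : Num.sqrt (2 ^+ n) = Num.sqrt 2 ^+ n :> R.
  elim: n => [|n IH]; first by rewrite !expr0 sqrtr1.
  by rewrite !exprS sqrtrM// IH.
rewrite [X in X <= _](_ : _ = (Num.sqrt 2 * `|x| + Num.sqrt n%:R) ^+ n / Num.sqrt n`!%:R)//.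
rewrite mulrACA mulVf; first by rewrite mul1r mulrC.
by rewrite expf_neq0// gt_eqF// sqrtr_gt0.
Qed.

Lemma exp_fact_le n (y : R) : 0 <= y -> y ^+ n / n`!%:R <= expR y.
Proof.
move=> y0; case: n => [|n].
  by rewrite expr0 fact0 divr1 -expR0 ler_expR.
apply: le_trans (expR_ge1Dxn n y0); rewrite lerDr//.
Qed.

Definition hermK : R := 4 * expR 1.

Lemma hermK_ge1 : 1 <= hermK.
Proof.
have := expR_ge1Dx (1 : R); rewrite /hermK; lra.
Qed.

Lemma ler_sqrr (u v : R) : 0 <= v -> u ^+ 2 <= v ^+ 2 -> u <= v.
Proof.
move=> v0; have [u0|u0] := leP 0 u; first by rewrite ler_pXn2r.
by move=> _; rewrite (le_trans (ltW u0)).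
Qed.

(** The two summands of [sqrt 2 |x| + sqrt n] are compared: the base is at most twice
    the larger one. Then [y^n / n! <= e^y], with [y = x^2 / 2] if [sqrt 2 |x|] is
    the larger one and with [y = n] otherwise. *)
Lemma hermite_growth n (x : R) :
  (Num.sqrt 2 * `|x| + Num.sqrt n%:R) ^+ n / Num.sqrt n`!%:R <=
  hermK ^+ n * expR (4^-1 * x ^+ 2).
Proof.
have f0 : 0 < Num.sqrt n`!%:R :> R by rewrite sqrtr_gt0 ltr0n fact_gt0.
have e1 : 1 <= expR (1 : R) by rewrite -expR0 ler_expR.
have eg : 1 <= expR (4^-1 * x ^+ 2) by rewrite -expR0 ler_expR mulr_ge0 ?sqr_ge0// invr_ge0.
set a := Num.sqrt 2 * `|x|; set b := Num.sqrt n%:R.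
have a0 : 0 <= a by rewrite mulr_ge0 ?sqrtr_ge0.
have b0 : 0 <= b by rewrite sqrtr_ge0.
have ha : a ^+ n / Num.sqrt n`!%:R <= 2 ^+ n * expR (4^-1 * x ^+ 2).
  apply: ler_sqrr; first by rewrite mulr_ge0 ?exprn_ge0// expR_ge0.
  rewrite [leLHS]exprMn [leRHS]exprMn exprVn sqr_sqrtr// -!exprM mulnC !exprM.
  have -> : a ^+ 2 = 2 ^+ 2 * (2^-1 * x ^+ 2).
    by rewrite /a exprMn sqr_sqrtr// real_normK ?num_real//; field.
  rewrite exprMn -mulrA ler_wpM2l ?exprn_ge0//.
  have -> : expR (4^-1 * x ^+ 2) ^+ 2 = expR (2^-1 * x ^+ 2).
    by rewrite expr2 -expRD; congr expR; field.
  by apply: exp_fact_le; rewrite mulr_ge0 ?sqr_ge0// invr_ge0.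
have hb : b ^+ n / Num.sqrt n`!%:R <= expR 1 ^+ n.
  apply: ler_sqrr; first by rewrite exprn_ge0// expR_ge0.
  rewrite !exprMn exprVn sqr_sqrtr// -!exprM mulnC exprM.
  rewrite /b sqr_sqrtr//; apply: (le_trans (exp_fact_le n (ler0n _ n))).
  rewrite -[X in expR X]mulr1 expRM_natl exprM expr2.
  by rewrite lerXn2r ?nnegrE ?mulr_ge0 ?expR_ge0// ler_peMl ?expR_ge0.
have [ab|ba] := leP a b.
  apply: (@le_trans _ _ ((2 * b) ^+ n / Num.sqrt n`!%:R)).
    rewrite ler_pM2r ?invr_gt0// lerXn2r ?nnegrE ?addr_ge0 ?mulr_ge0//.
    by rewrite mulr_natl mulr2n lerD2r.
  rewrite exprMn -mulrA (le_trans (ler_wpM2l (exprn_ge0 n (ler0n R 2)) hb))//.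
  apply: (@le_trans _ _ (hermK ^+ n)).
    rewrite -exprMn lerXn2r ?nnegrE ?mulr_ge0 ?expR_ge0// /hermK; lra.
  by rewrite ler_peMr// exprn_ge0// (le_trans _ hermK_ge1).
apply: (@le_trans _ _ ((2 * a) ^+ n / Num.sqrt n`!%:R)).
  rewrite ler_pM2r ?invr_gt0// lerXn2r ?nnegrE ?addr_ge0 ?mulr_ge0//.
  by rewrite mulr_natl mulr2n lerD2l ltW.
rewrite exprMn -mulrA (le_trans (ler_wpM2l (exprn_ge0 n (ler0n R 2)) ha))//.
rewrite mulrA -exprMn ler_pM2r ?expR_gt0// lerXn2r ?nnegrE// /hermK ?mulr_ge0 ?expR_ge0//.
lra.
Qed.

(** A bound that is uniform in [n] up to a geometric factor. Half of the Gaussian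
    decay is given up for it. *)
Lemma hermf_le_gauss n (x : R) : `|hermf n x| <= hermK ^+ n * expR (- 4^-1 * x ^+ 2).
Proof.
apply: (le_trans (hermf_le n x)).
apply: (le_trans (ler_wpM2r (expR_ge0 _) (hermite_growth n x))).
rewrite -mulrA -expRD ler_wpM2l ?exprn_ge0 ?(le_trans _ hermK_ge1)//.
by rewrite ler_expR le_eqVlt; apply/orP; left; apply/eqP; field.
Qed.

(** Integration by parts against the constant function [1], since
    [H_(m+1) exp(- x^2)] is minus the derivative of [H_m exp(- x^2)]: the derivative
    falls on [H_n]. *)
Lemma hermp_orthoS n m :
  \int[@lebesgue_measure R]_x ((hermp n * hermp m.+1).[x] * expR (- 1 * x ^+ 2)) =
  2 * n%:R * \int[@lebesgue_measure R]_x ((hermp n.-1 * hermp m).[x] * expR (- 1 * x ^+ 2)).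
Proof.
have int1 (P : {poly R}) : (@lebesgue_measure R).-integrable setT
    (EFin \o (fun x => P.[x] * expR (- 1 * x ^+ 2))).
  have h1 (x : R) : `|cst (1 : R) x| <= 1 by rewrite normr1.
  have := @integrable_horner_gauss R P _ 1 (cst 1) ltr01 (@cst_continuous _ _ _) h1.
  by under [X in _.-integrable _ X -> _]eq_fun do rewrite /= mulr1.
have h1 (x : R) : `|cst (1 : R) x| <= 1 by rewrite normr1.
have h0 (x : R) : `|cst (0 : R) x| <= 1 by rewrite normr0.
have d1 (x : R) : is_derive x 1 (cst (1 : R)) (cst 0 x) by exact: is_derive_cst.
have := @ibp_horner_gauss R (hermp n * hermp m) 1 _ _ _ ltr01 d1 (@cst_continuous _ _ _) h1 h0.
under [in X in _ = - X]eq_Rintegral do rewrite mulr0.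
rewrite Rintegral_cst// mul0r oppr0.
have PE (x : R) : ((hermp n * hermp m)^`() - (2 * 1) *: ('X * (hermp n * hermp m))).[x] *
     expR (- 1 * x ^+ 2) * cst 1 x =
   2 * n%:R * ((hermp n.-1 * hermp m).[x] * expR (- 1 * x ^+ 2)) -
   (hermp n * hermp m.+1).[x] * expR (- 1 * x ^+ 2).
  by rewrite /= derivM (deriv_hermp n) !hornerE/=; ring.
under eq_Rintegral do rewrite PE.
rewrite RintegralB//; last first.
  by rewrite /comp; under eq_fun do rewrite EFinM; apply: integrableZl => //; exact: int1.
by rewrite RintegralZl// => /eqP; rewrite subr_eq0 => /eqP ->.
Qed.

Lemma hermp_ortho n m :
  \int[@lebesgue_measure R]_x ((hermp n * hermp m).[x] * expR (- 1 * x ^+ 2)) =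
  (n == m)%:R * (2 ^ n * n`!)%:R * \int[@lebesgue_measure R]_x expR (- 1 * x ^+ 2).
Proof.
elim: m n => [|m IH] n.
  case: n => [|n].
    rewrite eqxx fact0 !mul1r; apply: eq_Rintegral => x _.
    by rewrite hornerC !mul1r.
  by rewrite mulrC hermp_orthoS mulr0 !mul0r.
rewrite hermp_orthoS IH; case: n => [|n]; first by rewrite mulr0 !mul0r.
by rewrite eqSS /= factS expnS !natrM; ring.
Qed.

Lemma hermf_ortho n m :
  \int[@lebesgue_measure R]_x (hermf n x * hermf m x) =
  (n == m)%:R * \int[@lebesgue_measure R]_x expR (- 1 * x ^+ 2).
Proof.
transitivity (hermc n * hermc m *
  \int[@lebesgue_measure R]_x ((hermp n * hermp m).[x] * expR (- 1 * x ^+ 2))).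
  rewrite -RintegralZl//; last first.
    have h1 (x : R) : `|cst (1 : R) x| <= 1 by rewrite normr1.
    have := @integrable_horner_gauss R (hermp n * hermp m) _ 1 (cst 1) ltr01 (@cst_continuous _ _ _) h1.
    by under [X in _.-integrable _ X -> _]eq_fun do rewrite /= mulr1.
  apply: eq_Rintegral => x _; rewrite /hermf hornerM.
  rewrite [in RHS](_ : - 1 * x ^+ 2 = - 2^-1 * x ^+ 2 + - 2^-1 * x ^+ 2); last by field.
  by rewrite expRD; ring.
rewrite hermp_ortho; have [<-|nm] := eqVneq n m; last by rewrite !mul0r mulr0.
rewrite !mul1r mulrA [X in X * _](_ : _ = 1) ?mul1r// /hermc -invfM -expr2 sqr_sqrtr//.
by rewrite mulVf// pnatr_eq0 -lt0n muln_gt0 expn_gt0 fact_gt0.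
Qed.

Lemma hermp_integralS n (K : R) (b db : R -> R) :
  (forall x : R, is_derive x 1 b (db x)) -> continuous db ->
  (forall x, `|b x| <= K) -> (forall x, `|db x| <= K) ->
  \int[@lebesgue_measure R]_x ((hermp n.+1).[x] * expR (- 2^-1 * x ^+ 2) * b x) =
  2 * \int[@lebesgue_measure R]_x ((hermp n).[x] * expR (- 2^-1 * x ^+ 2) * db x) +
  2 * n%:R * \int[@lebesgue_measure R]_x ((hermp n.-1).[x] * expR (- 2^-1 * x ^+ 2) * b x).
Proof.
move=> dfb cdb bK dbK.
have s0 : 0 < 2^-1 :> R by rewrite invr_gt0.
have cb : continuous b.
  move=> x; apply: differentiable_continuous; apply/derivable1_diffP; exact: ex_derive.
have intb P := integrable_horner_gauss P s0 cb bK.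
have := ibp_horner_gauss (hermp n) s0 dfb cdb bK dbK.
rewrite divff// scale1r => /(congr1 (fun z => -2 * z)).
rewrite mulrNN => <-.
rewrite -RintegralZl// -RintegralZl// -RintegralD//; last 2 first.
- by rewrite /comp; under eq_fun do rewrite EFinM; apply: integrableZl => //; exact: intb.
- by rewrite /comp; under eq_fun do rewrite EFinM; apply: integrableZl => //; exact: intb.
apply: eq_Rintegral => x _.
by rewrite hermpS deriv_hermp !(hornerD, hornerN, hornerZ, hornerM, hornerX); ring.
Qed.

Lemma is_derive_cosM (xi x : R) : is_derive x 1 (fun x => cos (xi * x)) (- xi * sin (xi * x)).
Proof.
have : is_derive x 1 (@cos R \o (fun x => xi * x)) (- sin (xi * x) * xi).
  by apply: is_derive1_comp; apply: is_derive_eq; rewrite /GRing.scale /=; ring.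
by rewrite mulNr -mulrN mulrC.
Qed.

Lemma is_derive_sinM (xi x : R) : is_derive x 1 (fun x => sin (xi * x)) (xi * cos (xi * x)).
Proof.
have : is_derive x 1 (@sin R \o (fun x => xi * x)) (cos (xi * x) * xi).
  by apply: is_derive1_comp; apply: is_derive_eq; rewrite /GRing.scale /=; ring.
by rewrite mulrC.
Qed.

Lemma continuous_cosM (xi : R) : continuous (fun x => cos (xi * x)).
Proof.
move=> x; apply: differentiable_continuous; apply/derivable1_diffP.
by have [] := is_derive_cosM xi x.
Qed.

Lemma continuous_sinM (xi : R) : continuous (fun x => sin (xi * x)).
Proof.
move=> x; apply: differentiable_continuous; apply/derivable1_diffP.
by have [] := is_derive_sinM xi x.
Qed.

Definition hermp_cos n xi :=
  \int[@lebesgue_measure R]_x ((hermp n).[x] * expR (- 2^-1 * x ^+ 2) * cos (xi * x)).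

Definition hermp_sin n xi :=
  \int[@lebesgue_measure R]_x ((hermp n).[x] * expR (- 2^-1 * x ^+ 2) * sin (xi * x)).

Lemma hermp_cosS n xi :
  hermp_cos n.+1 xi = - (2 * xi) * hermp_sin n xi + 2 * n%:R * hermp_cos n.-1 xi.
Proof.
have s0 : 0 < 2^-1 :> R by rewrite invr_gt0.
have cdb : continuous (fun x => - xi * sin (xi * x)).
  by apply: continuous_mul; [exact: cst_continuous|exact: continuous_sinM].
have bK (x : R) : `|cos (xi * x)| <= 1 + `|xi| by rewrite ler_wpDr// cos_max.
have dbK (x : R) : `|- xi * sin (xi * x)| <= 1 + `|xi|.
  by rewrite normrM normrN ler_wpDl// ler_piMr// sin_max.
rewrite /hermp_cos (hermp_integralS n (is_derive_cosM xi) cdb bK dbK); congr (_ + _).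
have intS := integrable_horner_gauss (hermp n) s0 (@continuous_sinM xi) (fun x => sin_max (xi * x)).
rewrite [X in 2 * X = _](_ : _ = - xi * hermp_sin n xi); first by ring.
by rewrite /hermp_sin -RintegralZl//; apply: eq_Rintegral => x _; ring.
Qed.

Lemma hermp_sinS n xi :
  hermp_sin n.+1 xi = (2 * xi) * hermp_cos n xi + 2 * n%:R * hermp_sin n.-1 xi.
Proof.
have s0 : 0 < 2^-1 :> R by rewrite invr_gt0.
have cdb : continuous (fun x => xi * cos (xi * x)).
  by apply: continuous_mul; [exact: cst_continuous|exact: continuous_cosM].
have bK (x : R) : `|sin (xi * x)| <= 1 + `|xi| by rewrite ler_wpDr// sin_max.
have dbK (x : R) : `|xi * cos (xi * x)| <= 1 + `|xi|.
  by rewrite normrM ler_wpDl// ler_piMr// cos_max.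
rewrite /hermp_sin (hermp_integralS n (is_derive_sinM xi) cdb bK dbK); congr (_ + _).
have intS := integrable_horner_gauss (hermp n) s0 (@continuous_cosM xi) (fun x => cos_max (xi * x)).
rewrite [X in 2 * X = _](_ : _ = xi * hermp_cos n xi); first by ring.
by rewrite /hermp_cos -RintegralZl//; apply: eq_Rintegral => x _; ring.
Qed.

(** Both sides satisfy the recurrence
    [E_(m+1) = - 2 i xi E_m + 2 m E_(m-1)], on the left by integration by parts and
    on the right by the recurrence of the Hermite polynomials. *)
Lemma hermp_fourier n (xi : R) :
  (hermp_cos n xi +i* - hermp_sin n xi)%C =
  ((\int[@lebesgue_measure R]_x expR (- 2^-1 * x ^+ 2)) *
     ((hermp n).[xi] * expR (- 2^-1 * xi ^+ 2)))%:C%C * (0 +i* -1)%C ^+ n.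
Proof.
set w := (0 +i* -1)%C; set g := \int[_]_x _.
pose E n := (hermp_cos n xi +i* - hermp_sin n xi)%C.
pose G n := (g * ((hermp n).[xi] * expR (- 2^-1 * xi ^+ 2)))%:C%C * w ^+ n.
have w2 : w ^+ 2 = -1 by rewrite expr2 /w; apply/eqP; rewrite eq_complex/=; apply/andP; split; apply/eqP; ring.
have ES m : E m.+1 = (2 * xi)%:C%C * w * E m + (2 * m%:R)%:C%C * E m.-1.
  rewrite /E hermp_cosS hermp_sinS /w; apply/eqP; rewrite eq_complex/=.
  by apply/andP; split; apply/eqP; ring.
have GS m : G m.+1 = (2 * xi)%:C%C * w * G m + (2 * m%:R)%:C%C * G m.-1.
  have hS : (hermp m.+1).[xi] = 2 * xi * (hermp m).[xi] - 2 * m%:R * (hermp m.-1).[xi].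
    by rewrite hermpS !(hornerD, hornerN, hornerZ, hornerM, hornerX) mulrA.
  rewrite /G hS; move: (expR _) (hermp m).[xi] (hermp m.-1).[xi] => e u v.
  case: m hS => [|m] _.
    rewrite !mulr0 mul0r subr0 rmorph0 mul0r addr0 expr1 expr0 mulr1.
    rewrite !rmorphM/=; ring.
  rewrite [m.+1.-1]/= !exprS (_ : w * (w * w ^+ m) = - w ^+ m); last first.
    by rewrite mulrA -expr2 w2 mulN1r.
  have -> : (2 * xi)%:C%C * w * ((g * (u * e))%:C%C * (w * w ^+ m)) =
      (2 * xi)%:C%C * (g * (u * e))%:C%C * (w ^+ 2) * w ^+ m by ring.
  rewrite w2 !(rmorphM, rmorphB)/=; ring.
suff: E n = G n /\ E n.+1 = G n.+1 by case.
elim: n => [|n [IH IHS]]; last by split => //; rewrite ES GS IH IHS.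
have E0 : E 0%N = G 0%N.
  rewrite /E /G expr0 mulr1 hornerC mul1r /hermp_cos /hermp_sin.
  have h (T : R -> R) : \int[@lebesgue_measure R]_x ((hermp 0).[x] * expR (- 2^-1 * x ^+ 2) * T (xi * x)) =
      \int[@lebesgue_measure R]_x (expR (- 2^-1 * x ^+ 2) * T (xi * x)).
    by apply: eq_Rintegral => x _; rewrite hornerC mul1r.
  rewrite !h.
  have dms (x : R) : is_derive x 1 (fun x : R => - sin x) (- cos x) by exact: is_deriveN.
  have ms1 (x : R) : `|- sin x| <= 1 by rewrite normrN sin_max.
  rewrite (@gauss_fourier R (@cos R) _ (@is_derive_cos R) dms (@cos_max R) ms1).
  rewrite (@gauss_fourier R (@sin R) _ (@is_derive_sin R) (@is_derive_cos R) (@sin_max R) (@cos_max R)).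
  rewrite cos0 sin0.
  under eq_Rintegral do rewrite mulr1.
  under [X in (_ +i* - (_ * X))%C]eq_Rintegral do rewrite mulr0.
  by rewrite Rintegral_cst// mul0r mulr0 oppr0 mulrC.
by split => //; rewrite ES GS E0 mulr0 !mul0r.
Qed.

Lemma hermf_fourier n (xi : R) :
  ((\int[@lebesgue_measure R]_x complex.Re ((hermf n x)%:C%C * expi (- (x * xi)))) +i*
   (\int[@lebesgue_measure R]_x complex.Im ((hermf n x)%:C%C * expi (- (x * xi)))))%C =
  (\int[@lebesgue_measure R]_x expR (- 2^-1 * x ^+ 2))%:C%C *
    (0 +i* -1)%C ^+ n * (hermf n xi)%:C%C.
Proof.
have s0 : 0 < 2^-1 :> R by rewrite invr_gt0.
rewrite [RHS](_ : _ = (hermc n)%:C%C * (hermp_cos n xi +i* - hermp_sin n xi)%C); last first.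
  by rewrite hermp_fourier /hermf !rmorphM/=; ring.
apply/eqP; rewrite eq_complex/= !mul0r subr0 addr0; apply/andP; split; apply/eqP.
  rewrite /hermp_cos -RintegralZl//; last first.
    exact: (integrable_horner_gauss _ s0 (@continuous_cosM xi) (fun x => cos_max (xi * x))).
  by apply: eq_Rintegral => x _; rewrite mul0r subr0 cosN mulrC (mulrC x) /hermf; ring.
rewrite mulrN -mulNr /hermp_sin -RintegralZl//; last first.
  exact: (integrable_horner_gauss _ s0 (@continuous_sinM xi) (fun x => sin_max (xi * x))).
by apply: eq_Rintegral => x _; rewrite mul0r addr0 sinN (mulrC x) /hermf; ring.
Qed.

End hermite_polynomials.

(** * Multi-dimensional Hermite functions as products *)

(** A partial derivative is the derivative of a function of one variable that agrees
    with [g] along the line through [x]. This keeps the differentiability of [g] as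
    a function of several variables out of the way. *)
Lemma derive_basis_vec (R : realType) d (j : 'I_d) (g : 'cV[R]_d -> R) (x : 'cV[R]_d) (p : R -> R) (dp : R) :
  (forall h, g (h *: basis_vec R j + x) = p (h + x j 0)) ->
  is_derive (x j 0) 1 p dp -> 'D_(basis_vec R j) g x = dp.
Proof.
move=> gp [_ <-]; rewrite /derive.
suff -> : (fun h => h^-1 *: ((g \o shift x) (h *: basis_vec R j) - g x)) =
  (fun h => h^-1 *: ((p \o shift (x j 0)) (h *: 1) - p (x j 0))) by [].
apply/funext => h /=; rewrite gp; congr (_ *: (p _ - _)).
  by rewrite [h%:A]mulr1.
by have := gp 0; rewrite scale0r !add0r.
Qed.

Lemma basis_vecE (R : realType) d (j i : 'I_d) : basis_vec R j i 0 = (i == j)%:R.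
Proof. by rewrite mxE eqxx andbT. Qed.

Lemma derive_hermite_step (R : realType) d (j : 'I_d) (c : 'cV[R]_d -> R) (P : {poly R}) :
  (forall x h, c (h *: basis_vec R j + x) = c x) ->
  (fun x => 'D_(basis_vec R j) (fun x => c x * P.[x j 0] * expR (- dotv x x)) x) =
  (fun x => c x * (P^`() - 2 *: ('X * P)).[x j 0] * expR (- dotv x x)).
Proof.
move=> cj; apply/funext => x.
pose r := \sum_(i | i != j) x i 0 * x i 0.
have dotE h : dotv (h *: basis_vec R j + x) (h *: basis_vec R j + x) = (h + x j 0) ^+ 2 + r.
  rewrite /dotv (bigD1 j)//= !mxE eqxx mulr1 -expr2; congr (_ + _).
  by apply: eq_bigr => i ij; rewrite !mxE (negbTE ij) mulr0 add0r.
have dotE0 : dotv x x = x j 0 ^+ 2 + r by have := dotE 0; rewrite scale0r !add0r.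
apply: (derive_basis_vec (p := fun t => c x * P.[t] * expR (- (t ^+ 2 + r)))).
  move=> h; rewrite cj dotE; congr (_ * _.[_] * _).
  by rewrite !mxE !eqxx/= mulr1.
have de (t : R) : is_derive t 1 (fun t => expR (- (t ^+ 2 + r))) (- (2 * t) * expR (- (t ^+ 2 + r))).
  have : is_derive t 1 (expR \o (fun t => - (t ^+ 2 + r))) (expR (- (t ^+ 2 + r)) * (- (2 * t))).
    by apply: is_derive1_comp; apply: is_derive_eq; rewrite /GRing.scale /=; ring.
  by rewrite mulrC.
apply: is_derive_eq; rewrite dotE0 !(hornerD, hornerN, hornerZ, hornerM, hornerX) /GRing.scale/=; ring.
Qed.

(** Rodrigues' formula in one of the coordinates. The factor [c] carries the part
    that comes from the other coordinates. *)
Lemma iter_derive_gauss (R : realType) d (j : 'I_d) (c : 'cV[R]_d -> R) n :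
  (forall x h, c (h *: basis_vec R j + x) = c x) ->
  iter n (fun h x => 'D_(basis_vec R j) h x) (fun x => c x * expR (- dotv x x)) =
  (fun x => ((-1) ^+ n * (hermp R n).[x j 0] * c x) * expR (- dotv x x)).
Proof.
move=> cj.
transitivity (fun x => c x * ((-1) ^+ n *: hermp R n).[x j 0] * expR (- dotv x x)); last first.
  by apply/funext => x; rewrite hornerZ; congr (_ * _); rewrite mulrC.
elim: n => [|n IH].
  by apply/funext => x; rewrite /= scale1r hornerC mulr1.
rewrite iterS IH derive_hermite_step//; apply/funext => x.
congr (_ * _.[_] * _); rewrite [hermp R n.+1]/= derivZ exprS mulN1r.
by rewrite -scalerAr; apply/polyP => i; rewrite !(coefB, coefZ); ring.
Qed.

Lemma iter_partial_gauss (R : realType) d (a : multi_index d) (s : seq 'I_d) : uniq s ->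
  foldr (fun j g => iter (a j) (fun h x => 'D_(basis_vec R j) h x) g)
    (fun y => expR (- dotv y y)) s =
  (fun x => (\prod_(j <- s) ((-1) ^+ a j * (hermp R (a j)).[x j 0])) * expR (- dotv x x)).
Proof.
elim: s => [|j s IH] /=; first by move=> _; apply/funext => x; rewrite big_nil mul1r.
move=> /andP[js us]; rewrite IH// iter_derive_gauss//.
  by apply/funext => x; rewrite big_cons.
move=> x h; apply: eq_big_seq => i i_s; rewrite !mxE.
have ij : i != j by apply: contraNneq js => <-.
by rewrite (negbTE ij) mulr0 add0r.
Qed.

Lemma sqrtr_prod (R : realType) (I : Type) (s : seq I) (F : I -> R) :
  (forall i, 0 <= F i) ->
  Num.sqrt (\prod_(i <- s) F i) = \prod_(i <- s) Num.sqrt (F i).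
Proof.
move=> F0; elim: s => [|i s IH]; first by rewrite !big_nil sqrtr1.
by rewrite !big_cons sqrtrM// IH.
Qed.

(** The multi-dimensional Hermite functions are products of one-dimensional ones, up
    to the normalisation of the latter. *)
Lemma hermite_prod (R : realType) d (a : multi_index d) (x : 'cV[R]_d) :
  hermite a x = pi `^ (- (d%:R / 4)) * \prod_j hermf (a j) (x j 0).
Proof.
rewrite /hermite /iter_partial iter_partial_gauss ?enum_uniq// big_enum/=.
rewrite /hermf !big_split/=.
have -> : \prod_(i < d) (-1 : R) ^+ a i = (-1) ^+ mi_abs a.
  by rewrite /mi_abs (big_morph _ (exprD (-1 : R)) (expr0 _)).
have -> : \prod_(i < d) expR (- 2^-1 * x i 0 ^+ 2) = expR (2^-1 * dotv x x) * expR (- dotv x x).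
  rewrite -expRD -(big_morph _ (@expRD R) (@expR0 R)); congr expR.
  rewrite -mulr_sumr /dotv; under eq_bigr do rewrite expr2.
  by field.
have -> : \prod_(i < d) hermc R (a i) = (2 ^ mi_abs a * mi_fact a)%N%:R `^ (- 2^-1).
  rewrite powRN powR12_sqrt// /hermc prodfV; congr (_^-1).
  rewrite /mi_abs /mi_fact (big_morph _ (expnD 2) (expn0 _)) -big_split/= natr_prod.
  by rewrite sqrtr_prod.
have s1 : (-1) ^+ mi_abs a * (-1) ^+ mi_abs a = 1 :> R by rewrite -exprD addnn -mul2n exprM sqrrN !expr1n.
rewrite [\prod_(i in 'I_d) _](eq_bigl xpredT)//.
by move: s1; move: ((-1) ^+ mi_abs a) => E s1; rewrite -[RHS]mul1r -s1; ring.
Qed.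

(** * Convex functions on the half-line *)

Section convex_half_line.
Context (R : realType) (p : R -> R).
Hypothesis p_convex : convex_function (E := R^o) [set` `[0%R, +oo[] p.

Definition slope (f : R -> R) (a b : R) := (f b - f a) / (b - a).

Lemma convex_chord a b c : 0 <= a -> a < b -> b < c ->
  p b * (c - a) <= p a * (c - b) + p c * (b - a).
Proof.
move=> a0 ab bc; have ac := lt_trans ab bc.
have ca0 : 0 < c - a by rewrite subr_gt0.
have t0 : 0 <= (c - b) / (c - a) by rewrite divr_ge0 ?subr_ge0 ?ltW.
have t1 : (c - b) / (c - a) <= 1 by rewrite ler_pdivrMr// mul1r lerD2l lerN2 ltW.
have := @p_convex (Itv01 t0 t1) a c.
rewrite !inE/= !in_itv/= !andbT => /(_ a0 (le_trans a0 (ltW ac))).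
have -> : @conv _ (convex_lmodType R^o) (Itv01 t0 t1) a c = b.
  by apply: (etrans (convRE _ _ _)); rewrite /= /unstable.onem; field; rewrite gt_eqF.
rewrite !convRE/= /unstable.onem.
have -> : (c - b) / (c - a) * p a + (1 - (c - b) / (c - a)) * p c =
    (p a * (c - b) + p c * (b - a)) / (c - a) by field; rewrite gt_eqF.
by rewrite ler_pdivlMr.
Qed.

Lemma slope_le_l a b c : 0 <= a -> a < b -> b < c -> slope p a b <= slope p b c.
Proof.
move=> a0 ab bc; have := convex_chord a0 ab bc.
rewrite /slope ler_pdivrMr ?subr_gt0// mulrAC ler_pdivlMr ?subr_gt0//.
rewrite (_ : c - a = (c - b) + (b - a)); last by ring.
by rewrite mulrDr !mulrBl; lra.
Qed.

Lemma slope_le a b c e : 0 <= a -> a < b -> b <= c -> c < e -> slope p a b <= slope p c e.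
Proof.
move=> a0 ab; rewrite le_eqVlt => /predU1P[<-|bc] ce; first exact: slope_le_l.
apply: le_trans (slope_le_l a0 ab bc) (slope_le_l _ bc ce).
by rewrite (le_trans a0)// ltW.
Qed.

Lemma convex_ge_right a b v : 0 <= a -> a < b -> b <= v ->
  p a + slope p a b * (v - a) <= p v.
Proof.
move=> a0 ab; rewrite le_eqVlt => /predU1P[<-|bv].
  by rewrite /slope divfK ?gt_eqF ?subr_gt0// addrC subrK.
have := slope_le_l a0 ab bv.
rewrite {2}/slope ler_pdivlMr ?subr_gt0// => h.
have -> : slope p a b * (v - a) = slope p a b * (v - b) + slope p a b * (b - a) by ring.
have -> : slope p a b * (b - a) = p b - p a by rewrite /slope divfK ?gt_eqF ?subr_gt0.
lra.
Qed.

Lemma convex_ge_left a b v : 0 <= v -> v <= a -> a < b ->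
  p a - slope p a b * (a - v) <= p v.
Proof.
move=> v0; rewrite le_eqVlt => /predU1P[->|va] ab; first by rewrite subrr mulr0 subr0.
have := slope_le_l v0 va ab.
rewrite {1}/slope ler_pdivrMr ?subr_gt0//; lra.
Qed.

Lemma slope_le_len a h k : 0 <= a -> 0 < h -> h <= k -> slope p a (a + h) <= slope p a (a + k).
Proof.
move=> a0 h0 hk; have k0 := lt_le_trans h0 hk.
have ha : a < a + h by rewrite ltrDl.
have ahk : a + h <= a + k by rewrite lerD2l.
have ak : a + k - a = k by rewrite addrC addKr.
have := convex_ge_right a0 ha ahk; rewrite ak => le_pk.
by rewrite [leRHS]/slope ak ler_pdivlMr// lerBrDl.
Qed.

Hypothesis p_mono : forall a b, 0 <= a -> a <= b -> p a <= p b.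

(** The slope beyond [b] dominates all slopes in the interval from [0] to [b]. *)
Lemma convex_lipschitz b x y : 0 <= x -> x <= b -> 0 <= y -> y <= b ->
  `|p x - p y| <= slope p b (b + 1) * `|x - y|.
Proof.
wlog xy : x y / x <= y.
  move=> h x0 xb y0 yb; have [xy|/ltW yx] := leP x y; first exact: h.
  by rewrite distrC (distrC x); exact: h.
move=> x0 xb y0 yb; rewrite !(distrC _ y, distrC _ (p y)).
rewrite !ger0_norm ?subr_ge0// ?p_mono//.
move: xy; rewrite le_eqVlt => /predU1P[->|xy]; first by rewrite !subrr mulr0.
by rewrite -ler_pdivrMr ?subr_gt0//; apply: slope_le => //; rewrite ltrDl.
Qed.

Lemma convex_continuous x : 0 < x -> {for x, continuous p}.
Proof.
move=> x0; apply/cvgrPdist_lt => /= e e0.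
pose S := slope p (x + 1) (x + 1 + 1).
have S0 : 0 <= S.
  rewrite /slope divr_ge0 ?subr_ge0 ?lerDl//; apply: p_mono; last by rewrite lerDl.
  by rewrite addr_ge0 ?ltW.
near=> y.
have xy1 : `|x - y| < 1 by near: y; apply: cvgr_dist_lt.
have xyx : `|x - y| < x by near: y; apply: cvgr_dist_lt.
have y0 : 0 <= y by move: xyx; rewrite ltr_norml => /andP[_]; lra.
have y1 : y <= x + 1 by move: xy1; rewrite ltr_norml => /andP[]; lra.
apply: le_lt_trans (@convex_lipschitz (x + 1) x y _ _ y0 y1) _; rewrite ?lerDl ?ltW//.
apply: (@le_lt_trans _ _ ((S + 1) * `|x - y|)).
  by rewrite ler_wpM2r// lerDl.
rewrite mulrC -ltr_pdivlMr ?ltr_wpDl//.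
near: y; apply: cvgr_dist_lt => //; rewrite divr_gt0// ltr_wpDl//.
Unshelve. all: by end_near. Qed.

End convex_half_line.

(** * Weight functions *)

Lemma fact_le_expn n : (n`! <= n ^ n)%N.
Proof.
rewrite fact_prod -[X in (_ <= X ^ _)%N]/n.
rewrite -[X in (_ <= _ ^ X)%N](subn1 n.+1) -prod_nat_const_nat big_nat [leqRHS]big_nat.
by apply: leq_prod => i /andP[_]; rewrite ltnS.
Qed.

Section weights.
Context (R : realType) (omega : R -> R).
Hypothesis omega_weight : weight_function omega.
Hypothesis omega_alpha : weight_alpha omega.
Hypothesis omega_delta : weight_delta omega.
Hypothesis omega_littleo : omega t / t ^+ 2 @[t --> +oo] --> 0.

Let omega_ge0 t : 0 <= t -> 0 <= omega t. Proof. by case: omega_weight => + _ _; exact. Qed.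

Let omega_mono s t : 0 <= s -> s <= t -> omega s <= omega t.
Proof. by case: omega_weight => _ + _; exact. Qed.

Let phi_ge0 u : 0 <= phi omega u. Proof. exact/omega_ge0/expR_ge0. Qed.

Let phi_mono a b : 0 <= a -> a <= b -> phi omega a <= phi omega b.
Proof. by move=> _ ab; rewrite /phi omega_mono ?expR_ge0// ler_expR. Qed.

(** Iterating (alpha) with equal arguments gives the powers of [2]. *)
Lemma omega_dilation c : 0 <= c -> exists2 L, 1 <= L &
  forall t, 0 <= t -> omega (c * t) <= L * (omega t + 1).
Proof.
move=> c0; have [L L1 HL] := omega_alpha.
have L0 : 0 <= L := le_trans ler01 L1.
have pow2 k t : 0 <= t -> omega (2 ^+ k * t) + 1 <= (2 * L) ^+ k * (omega t + 1).
  move=> t0; elim: k => [|k IH]; first by rewrite !expr0 !mul1r.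
  have x0 : 0 <= 2 ^+ k * t by rewrite mulr_ge0// exprn_ge0.
  have := HL _ _ x0 x0; rewrite -[X in omega X](_ : 2 ^+ k.+1 * t = _); last by rewrite exprS; ring.
  move=> h; rewrite [in leRHS]exprS -mulrA; apply: (@le_trans _ _ (2 * L * (omega (2 ^+ k * t) + 1))).
    by have := omega_ge0 x0; nra.
  by rewrite ler_wpM2l// mulr_ge0.
pose k := Num.bound c.
have ck : c <= 2 ^+ k :> R.
  apply: le_trans (ltW (archi_boundP c0)) _.
  by rewrite -natrX ler_nat ltnW// ltn_expl.
exists ((2 * L) ^+ k); first by rewrite exprn_ege1//; lra.
move=> t t0; apply: le_trans (pow2 k t t0).
apply: (@le_trans _ _ (omega (2 ^+ k * t))); last by rewrite lerDl.
by apply: omega_mono; [rewrite mulr_ge0|rewrite ler_wpM2r].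
Qed.

Lemma omega_le_sqr (e : R) : 0 < e ->
  exists2 C, 0 <= C & forall t, 0 <= t -> omega t <= e * t ^+ 2 + C.
Proof.
move=> e0; have /cvgrPdist_lt /(_ _ e0) [M [Mr HM]] := omega_littleo.
pose N := Num.max M 1; have N1 : 1 <= N by rewrite le_max lexx orbT.
exists (omega N); first by rewrite omega_ge0// (le_trans ler01).
move=> t t0; have [tN|Nt] := leP t N.
  by rewrite ler_wpDl ?omega_mono// mulr_ge0 ?sqr_ge0// ltW.
have tp : 0 < t by rewrite (lt_trans _ Nt)// (lt_le_trans ltr01).
have := HM t; rewrite (le_lt_trans _ Nt) ?le_max ?lexx// => /(_ isT).
rewrite sub0r normrN ger0_norm ?divr_ge0 ?omega_ge0 ?sqr_ge0// ltr_pdivrMr ?exprn_gt0// => h.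
by rewrite ler_wpDr ?omega_ge0 ?(le_trans ler01)// ltW.
Qed.

(** Condition (alpha) for the argument that occurs in [young_term_le]. *)
Lemma omega_spread (K : R) : 1 <= K -> exists2 L, 1 <= L &
  forall y s, 0 <= y -> 0 <= s ->
    omega (4 * K * (Num.sqrt 2 * y + s + 1)) <= L * (omega y + omega s + 1).
Proof.
move=> K1; have [L L1 HL] := omega_alpha.
have [L' L'1 HL'] := @omega_dilation (4 * K * 2) ltac:(lra).
have w1 := omega_ge0 ler01.
have h6 : 1 <= L * (omega 1 + 1) by rewrite mulr_ege1//; lra.
exists (L' * (L * (L * (omega 1 + 1) + 1) + 1)).
  rewrite mulr_ege1// lerDr mulr_ge0//; lra.
move=> y s y0 s0; have wy := omega_ge0 y0; have ws := omega_ge0 s0.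
have s2 : Num.sqrt 2 <= 2 :> R.
  have := sqr_sqrtr (ler0n R 2); have := sqrtr_ge0 (2 : R); nra.
have h0 : 0 <= Num.sqrt 2 * y by rewrite mulr_ge0 ?sqrtr_ge0.
apply: (@le_trans _ _ (omega (4 * K * 2 * (y + (s + 1))))).
  apply: omega_mono; first by rewrite mulr_ge0; lra.
  have h : Num.sqrt 2 * y + s + 1 <= 2 * (y + (s + 1)) by nra.
  by rewrite -[leRHS]mulrA ler_wpM2l//; lra.
apply: le_trans (HL' _ _) _; first lra.
have h1 := HL _ _ y0 (addr_ge0 s0 ler01).
have h2 := HL _ _ s0 ler01.
have h3 : omega (y + (s + 1)) + 1 <= (L * (L * (omega 1 + 1) + 1) + 1) * (omega y + omega s + 1).
  set W := omega 1 in w1 h2 h6 *.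
  have h4 : omega (s + 1) <= L * (W + 1) * (omega s + 1).
    have := mulr_ge0 (mulr_ge0 (le_trans ler01 L1) w1) ws; lra.
  have h5 : omega (y + (s + 1)) <= L * (omega y + L * (W + 1) * (omega s + 1) + 1).
    by apply: le_trans h1 _; rewrite ler_wpM2l//; lra.
  move: h5 h6; set G := L * (W + 1) => h5 h6.
  have h7 : omega y + G * (omega s + 1) + 1 <= (G + 1) * (omega y + omega s + 1).
    have := mulr_ge0 (le_trans ler01 h6) wy; lra.
  have h8 : L * (omega y + G * (omega s + 1) + 1) <= L * ((G + 1) * (omega y + omega s + 1)).
    by rewrite ler_wpM2l//; lra.
  have h9 : 1 <= omega y + omega s + 1 by lra.
  lra.
rewrite -mulrA ler_wpM2l//; lra.
Qed.

(** Otherwise the slopes of the convex function [phi] are bounded, so [phi] lies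
    between two affine functions of positive slope, and [sigma = d] would give
    quadratic interpolation. Superlinear growth makes [young] finite. *)
Lemma not_qi_superlinear d : (2 <= d)%N -> ~ quadratic_interpolation d omega ->
  forall K, exists C, forall u, 0 <= u -> K * u <= phi omega u + C.
Proof.
move=> d2 nqi K; apply: contrapT => nK; apply: nqi.
have [K0|K0] := leP K 0.
  exfalso; apply: nK; exists 0 => u u0; rewrite addr0.
  by apply: le_trans (phi_ge0 u); rewrite mulr_le0_ge0.
(* A single slope above [K] would give the growth rate [K] by convexity. *)
have up v : 0 <= v -> phi omega v <= phi omega 0 + K * v.
  rewrite le_eqVlt => /predU1P[<-|v0]; first by rewrite mulr0 addr0.
  rewrite leNgt; apply/negP => hv; apply: nK; exists (K * v) => u u0.
  have [uv|vu] := leP u v.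
    by rewrite ler_wpDl ?phi_ge0// ler_wpM2l// ltW.
  have := convex_ge_right omega_delta (lexx 0) v0 (ltW vu); rewrite subr0.
  have : K <= slope (phi omega) 0 v.
    by rewrite /slope subr0 ler_pdivlMr// lerBrDl ltW.
  have := phi_ge0 0; have := mulr_ge0 (ltW K0) (ltW v0); nra.
have [w w0 phiw] : exists2 w, 0 < w & phi omega 0 < phi omega w.
  have [_ _ /(_ (phi omega 0))[t t0 ht]] := omega_weight.
  have t1 : 1 < t.
    by rewrite ltNge; apply/negP => t1; move: ht; rewrite ltNge /phi expR0 omega_mono.
  by exists (ln t); [rewrite ln_gt0|rewrite [ltRHS]/phi lnK// posrE (lt_trans ltr01)].
pose m := slope (phi omega) 0 w.
have m0 : 0 < m by rewrite /m /slope subr0 divr_gt0// subr_gt0.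
have low u : 0 <= u -> m * u <= phi omega u + m * w.
  move=> u0; have [uw|wu] := leP u w.
    by rewrite ler_wpDl ?phi_ge0// ler_wpM2l// ltW.
  have := convex_ge_right omega_delta (lexx 0) w0 (ltW wu); rewrite subr0 -/m.
  have := phi_ge0 0; have := mulr_ge0 (ltW m0) (ltW w0); lra.
have dR : 0 < d%:R :> R by rewrite ltr0n (leq_trans _ d2).
have d1 : 0 < d%:R - 1 :> R by rewrite subr_gt0 ltr1n.
have cm : 0 <= K * d%:R / m := divr_ge0 (mulr_ge0 (ltW K0) (ltW dR)) (ltW m0).
have cw : 0 <= K * d%:R * w := mulr_ge0 (mulr_ge0 (ltW K0) (ltW dR)) (ltW w0).
exists (K * d%:R / m); first by rewrite divr_gt0// mulr_gt0.
exists (1 + phi omega 0 + K * d%:R * w).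
  by have := phi_ge0 0; lra.
move=> t t0; exists d%:R; first by rewrite lexx andbT ler1n (leq_trans _ d2).
rewrite subrr mul0r mulr0 powRr0.
have [t1|t1] := leP t 1.
  have h1 : omega (t `^ d%:R) <= phi omega 0.
    rewrite /phi expR0; apply: omega_mono; first exact: powR_ge0.
    by rewrite powR_mulrn// exprn_ile1.
  have := mulr_ge0 cm (omega_ge0 t0); lra.
have tp : 0 < t := lt_trans ltr01 t1.
have u0 : 0 <= ln t by rewrite ln_ge0// ltW.
have -> : omega t = phi omega (ln t) by rewrite /phi lnK.
have -> : omega (t `^ d%:R) = phi omega (d%:R * ln t) by rewrite /phi /powR gt_eqF.
have := up _ (mulr_ge0 (ltW dR) u0).
have : K * d%:R / m * (m * ln t) <= K * d%:R / m * (phi omega (ln t) + m * w).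
  by rewrite ler_wpM2l// low.
have -> : K * d%:R / m * (m * ln t) = K * (d%:R * ln t) by field; rewrite gt_eqF.
have -> : K * d%:R / m * (phi omega (ln t) + m * w) = K * d%:R / m * phi omega (ln t) + K * d%:R * w.
  by field; rewrite gt_eqF.
lra.
Qed.

Section superlinear.
Hypothesis phi_superlinear : forall K, exists C, forall u, 0 <= u -> K * u <= phi omega u + C.

Lemma young_ge u v : 0 <= u -> u * v - phi omega u <= young omega v.
Proof.
move=> u0; apply: ub_le_sup; last by exists u.
have [C HC] := phi_superlinear v.
by exists C => _ [w /= w0 <-]; have := HC _ w0; lra.
Qed.

Lemma young_le v B : (forall u, 0 <= u -> u * v - phi omega u <= B) -> young omega v <= B.
Proof.
move=> HB; apply: ge_sup; last by move=> _ [u /= u0 <-]; exact: HB.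
by exists (0 * v - phi omega 0); exists 0 => /=.
Qed.

(** The function [young(r n) / r] is the supremum of the
    [u n - phi(u) / r], which increase with [r] because [phi >= 0]. *)
Lemma young_div_mono (r s n : R) : 0 < r -> r <= s ->
  young omega (r * n) / r <= young omega (s * n) / s.
Proof.
move=> r0 rs; have s0 := lt_le_trans r0 rs.
rewrite ler_pdivrMr//; apply: young_le => u u0.
have h : s * (u * n) - phi omega u <= young omega (s * n).
  by have := young_ge (s * n) u0; rewrite mulrCA.
have p0 := phi_ge0 u.
have -> : u * (r * n) - phi omega u = r / s * (s * (u * n) - phi omega u) - (1 - r / s) * phi omega u.
  by field; rewrite gt_eqF.
have rs1 : r / s <= 1 by rewrite ler_pdivrMr// mul1r.
have rs0 : 0 <= r / s by rewrite divr_ge0 ?ltW.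
have -> : young omega (s * n) / s * r = r / s * young omega (s * n) by field; rewrite gt_eqF.
by have := ler_wpM2l rs0 h; nra.
Qed.

(** The supremum in [young] is at least the value at [ln tau]. *)
Lemma expR_young_le (r n tau : R) : 0 < r -> 1 <= tau ->
  expR (- r^-1 * young omega (r * n)) <= expR (- (n * ln tau) + omega tau / r).
Proof.
move=> r0 tau1; rewrite ler_expR.
have := young_ge (r * n) (ln_ge0 tau1); rewrite /phi lnK ?posrE ?(lt_le_trans ltr01)// => h.
rewrite mulNr lerNl opprD opprK -ler_pdivrMl ?invr_gt0// invrK.
apply: le_trans h; rewrite mulrDr mulrN (mulrC r (_ / r)) divfK ?gt_eqF//; lra.
Qed.

(** The estimate behind all decay statements, with
    [tau = 4 K (sqrt 2 y + sqrt n + 1)] in [expR_young_le]. The factor [4] leaves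
    [4^-n], of which [2^-n] pays for [exp(L / r omega(sqrt n)) <= C 2^n]. *)
Lemma young_term_le (K : R) : 1 <= K -> exists2 La, 0 < La &
  forall lambda r : R, 0 < lambda -> La <= r * lambda -> 0 < r ->
    exists2 C, 0 < C & forall (n : nat) (y : R), 0 <= y ->
      (K * (Num.sqrt 2 * y + Num.sqrt n%:R)) ^+ n * expR (- r^-1 * young omega (r * n%:R)) <=
      C * 2^-1 ^+ n * expR (lambda * omega y).
Proof.
move=> K1; have [L L1 HL] := omega_spread K1; have L0 : 0 < L := lt_le_trans ltr01 L1.
exists L => // lambda r lambda0 Lrl r0.
have Lr0 : 0 < L / r by rewrite divr_gt0.
have ln2 : 0 < ln 2 :> R by rewrite ln_gt0// ltr1n.
have [C C0 HC] := omega_le_sqr (divr_gt0 ln2 Lr0).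
exists (expR (L / r * (C + 1))); first exact: expR_gt0.
move=> n y y0; set s := Num.sqrt n%:R.
have s0 : 0 <= s by exact: sqrtr_ge0.
have s2 : s ^+ 2 = n%:R by rewrite sqr_sqrtr.
pose z := Num.sqrt 2 * y + s; have z0 : 0 <= z by rewrite addr_ge0// mulr_ge0 ?sqrtr_ge0.
pose tau := 4 * K * (z + 1).
have tau1 : 1 <= tau by rewrite /tau; nra.
have tau0 := lt_le_trans ltr01 tau1.
apply: le_trans (ler_wpM2l _ (expR_young_le n%:R r0 tau1)) _.
  by rewrite exprn_ge0// mulr_ge0//; lra.
have -> : expR (- (n%:R * ln tau) + omega tau / r) = tau^-1 ^+ n * expR (omega tau / r).
  by rewrite expRD expRN expRM_natl lnK// exprVn.
have K0 : 0 <= K by lra.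
have Kz0 : 0 <= K * z / tau := divr_ge0 (mulr_ge0 K0 z0) (ltW tau0).
have h1 : (K * z) ^+ n * tau^-1 ^+ n <= 4^-1 ^+ n.
  rewrite -exprMn; apply: lerXn2r; rewrite ?nnegrE ?invr_ge0//.
  rewrite ler_pdivrMr// /tau; nra.
have h2 : omega tau / r <= lambda * omega y + n%:R * ln 2 + L / r * (C + 1).
  have := HL _ _ y0 s0; rewrite -/z -/tau => h.
  have h' := HC _ s0; rewrite s2 in h'.
  apply: (@le_trans _ _ (L / r * (omega y + omega s + 1))).
    by rewrite mulrAC ler_pM2r ?invr_gt0.
  have -> : L / r * (omega y + omega s + 1) = L / r * omega y + L / r * omega s + L / r by ring.
  have h3 : L / r * omega s <= n%:R * ln 2 + L / r * C.
    have := ler_wpM2l (ltW Lr0) h'; rewrite mulrDr.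
    by have -> : L / r * (ln 2 / (L / r) * n%:R) = n%:R * ln 2 by field; rewrite !gt_eqF.
  have h4 : L / r * omega y <= lambda * omega y.
    by rewrite ler_wpM2r ?omega_ge0// ler_pdivrMr// mulrC.
  lra.
rewrite mulrA; apply: le_trans (ler_pM _ (expR_ge0 _) h1 (_ : _ <= expR (lambda * omega y + n%:R * ln 2 + L / r * (C + 1)))) _.
- by rewrite -exprMn exprn_ge0.
- by rewrite ler_expR.
rewrite !expRD expRM_natl lnK ?posrE//.
rewrite le_eqVlt; apply/orP; left; apply/eqP.
have -> : 2^-1 ^+ n = 4^-1 ^+ n * 2 ^+ n :> R.
  by rewrite -exprMn; congr (_ ^+ n); field.
ring.
Qed.

(** The logarithm of a bound on the ratio of coefficients. In the dimension [d.+1],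
    one of the factors [sqrt n!] cancels; the other [d] are estimated by
    [n! <= n^n]. *)
Lemma young_ratio_log (d n : nat) (r eps M B u : R) : (0 < n)%N -> 0 < r -> 0 < eps -> 1 <= M -> 0 <= u ->
  Num.sqrt n`!%:R * expR (- r^-1 * young omega (r * n%:R)) <=
    M * (Num.sqrt n`!%:R ^+ d.+1 * expR (- eps^-1 * young omega (eps * (d.+1 * n)%:R))) ->
  (forall v, 0 <= v -> n%:R * v - phi omega v / r <= B) ->
  d.+1%:R * n%:R * u - phi omega u / eps <= ln M + d%:R / 2 * (n%:R * ln n%:R) + B.
Proof.
move=> n0 r0 e0 M1 u0 H HB.
have nR : 0 < n%:R :> R by rewrite ltr0n.
have M0 : 0 < M := lt_le_trans ltr01 M1.
pose F : R := Num.sqrt n`!%:R.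
have F0 : 0 < F by rewrite sqrtr_gt0 ltr0n fact_gt0.
have F_le : F <= expR (n%:R * ln n%:R / 2).
  rewrite -(@ler_pXn2r _ 2)// ?nnegrE ?expR_ge0 ?(ltW F0)// sqr_sqrtr//.
  by rewrite expr2 -expRD -splitr expRM_natl lnK// -natrX ler_nat fact_le_expn.
have YB : r^-1 * young omega (r * n%:R) <= B.
  rewrite ler_pdivrMl//; apply: young_le => v v0.
  by have := ler_wpM2l (ltW r0) (HB v v0); rewrite mulrBr (mulrC _ (_ / r)) divfK ?gt_eqF//; lra.
have YE : d.+1%:R * n%:R * u - phi omega u / eps <= eps^-1 * young omega (eps * (d.+1 * n)%:R).
  rewrite ler_pdivlMl//; apply: le_trans (young_ge _ u0).
  rewrite mulrBr (mulrC _ (_ / eps)) divfK ?gt_eqF// natrM; lra.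
have : expR (- r^-1 * young omega (r * n%:R)) <=
    expR (ln M + d%:R * (n%:R * ln n%:R / 2) + (- eps^-1 * young omega (eps * (d.+1 * n)%:R))).
  rewrite -(ler_pM2l F0); apply: (le_trans H).
  rewrite !expRD lnK// expRM_natl exprS -/F.
  rewrite [leRHS](_ : _ = M * (F * expR (n%:R * ln n%:R / 2) ^+ d *
    expR (- eps^-1 * young omega (eps * (d.+1 * n)%:R)))); last by ring.
  rewrite ler_pM2l// ler_pM2r ?expR_gt0// ler_pM2l// lerXn2r ?nnegrE ?expR_ge0//.
  exact: ltW.
rewrite ler_expR; lra.
Qed.

(** The hypotheses are the signs at [s = 1] and [s = d] for the intermediate value
    theorem. *)
Lemma exists_balanced_sigma (d u r h : R) : 0 < h -> 0 < u -> 1 < d ->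
  slope (phi omega) u (u + h) <= r * expR (2 * ((d - 1) / (d - 1)) * u) ->
  r <= slope (phi omega) (d * u) (d * u + h) ->
  exists2 s, 1 <= s <= d &
    slope (phi omega) (s * u) (s * u + h) = r * expR (2 * ((d - s) / (d - 1)) * u).
Proof.
move=> h0 u0 d1 g1 gd.
have sE v : slope (phi omega) v (v + h) = (phi omega (v + h) - phi omega v) / h.
  by rewrite /slope (addrC v h) addrK.
pose g s := slope (phi omega) (s * u) (s * u + h) - r * expR (2 * ((d - s) / (d - 1)) * u).
have cg : {within `[1, d], continuous g}.
  apply: continuous_in_subspaceT => s; rewrite inE/= in_itv/= => /andP[s1 _].
  have s0 : 0 < s := lt_le_trans ltr01 s1.
  have su : 0 < s * u by rewrite mulr_gt0.
  have cphi v : 0 < v -> {for v, continuous (phi omega)}.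
    by move=> v0; exact: (convex_continuous omega_delta phi_mono v0).
  have cl (f : R -> R) : {for s, continuous f} -> 0 < f s -> {for s, continuous (fun s : R => phi omega (f s))}.
    by move=> cf fs; apply: (@continuous_comp _ _ _ f (phi omega)) => //; exact: cphi.
  have c1 : {for s, continuous (fun s : R => s * u)} by exact: mulrr_continuous.
  have c2 : {for s, continuous (fun s : R => s * u + h)} by apply: cvgD => //; exact: cvg_cst.
  have c3 : {for s, continuous (fun s : R => expR (2 * ((d - s) / (d - 1)) * u))}.
    apply: (@continuous_comp _ _ _ (fun s : R => 2 * ((d - s) / (d - 1)) * u) expR); last exact: continuous_expR.
    apply: cvgM; last exact: cvg_cst.
    apply: cvgM; first exact: cvg_cst.
    apply: cvgM; last exact: cvg_cst.
    by apply: cvgB; [exact: cvg_cst|exact: cvg_id].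
  rewrite /g; under eq_fun do rewrite sE.
  apply: cvgB; last by apply: cvgM => //; exact: cvg_cst.
  apply: cvgM; last exact: cvg_cst.
  by apply: cvgB; [apply: (cl _ c2); rewrite addr_gt0|exact: (cl _ c1)].
have g1' : g 1 <= 0 by rewrite /g mul1r subr_le0.
have gd' : 0 <= g d by rewrite /g subrr mul0r mulr0 mul0r expR0 mulr1 subr_ge0.
have [|s sI gs] := IVT (ltW d1) cg (v := 0).
  by rewrite ge_min le_max g1' gd' orbT.
exists s; first by move: sI; rewrite in_itv.
by move: gs => /eqP; rewrite subr_eq0 => /eqP.
Qed.

(** The slope of [phi] at [v0] is [r x], with [n <= x <= 2 n]. Beyond [v0 + h] the
    function [n v - phi(v) / r] decreases because of [n <= x]. Below [v0], drop
    half of [phi(v)]: then [n v - phi(v) / (2 r)] increases because of [x <= 2 n].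
    Between [v0] and [v0 + h], [n v] gains at most [h x], which is at most half of
    [(phi(v0) + 1) / r] by the hypothesis on [h]. *)
Lemma legendre_near_balance (L1 h r x v0 v n : R) :
  0 < h -> 0 < r -> 0 <= v0 -> 0 <= v ->
  slope (phi omega) v0 (v0 + h) = r * x ->
  h * (r * x) <= (phi omega v0 + 1) / 2 ->
  0 <= n -> n <= x -> x <= 2 * n ->
  n * v - phi omega v / r <= n * v0 - phi omega v0 / (2 * r) + (2 * r)^-1.
Proof.
move=> h0 r0 v00 v_0 slE hx n0 nx xn.
have vh : v0 < v0 + h by rewrite ltrDl.
set P0 := phi omega v0 in hx *; set P := phi omega v.
have P00 : 0 <= P0 by exact: phi_ge0.
have PP : 0 <= P by exact: phi_ge0.
suff : r * (n * v) - P <= r * (n * v0) - P0 / 2 + 2^-1.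
  move=> H; rewrite -(ler_pM2l r0).
  rewrite [leLHS](_ : _ = r * (n * v) - P); last by field; rewrite gt_eqF.
  rewrite [leRHS](_ : _ = r * (n * v0) - P0 / 2 + 2^-1)//; by field; rewrite gt_eqF.
have rn0 : 0 <= r * n by rewrite mulr_ge0// ltW.
have rnx : r * n <= r * x by rewrite ler_pM2l.
have rxn : r * x <= 2 * (r * n) by rewrite mulrCA ler_pM2l.
rewrite !(mulrA r n); move: (r * n) (r * x) rn0 rnx rxn slE hx => N X N0 NX XN slE hx.
have [vv|vv] := leP v v0.
  have := convex_ge_left omega_delta v_0 vv vh; rewrite slE -/P0 -/P => h1.
  have h2 : 0 <= (2 * N - X) * (v0 - v) by rewrite mulr_ge0// subr_ge0.
  nra.
have [vv'|vv'] := leP (v0 + h) v.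
  have := convex_ge_right omega_delta v00 vh vv'; rewrite slE -/P0 -/P => h1.
  have h2 : 0 <= (X - N) * (v - v0) by rewrite mulr_ge0// subr_ge0// ltW.
  nra.
have h1 : P0 <= P by apply: phi_mono => //; exact: ltW.
have h2 : N * (v - v0) <= X * h.
  by apply: ler_pM => //; lra.
lra.
Qed.

(** The heart of the proof: boundedness of the ratio implies quadratic
    interpolation, by the choice of [sigma] explained at the top. *)
Lemma young_ratio_unbounded d (r eps M : R) : (2 <= d)%N -> ~ quadratic_interpolation d omega ->
  0 < r -> 0 < eps -> exists n : nat,
    M * (Num.sqrt n`!%:R ^+ d * expR (- eps^-1 * young omega (eps * (d * n)%:R))) <
    Num.sqrt n`!%:R * expR (- r^-1 * young omega (r * n%:R)).
Proof.
case: d => // d d2 nqi r0 e0; apply: contrapT => nex; apply: nqi.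
pose M' := Num.max M 1; have M'1 : 1 <= M' by rewrite le_max lexx orbT.
have Hn n : Num.sqrt n`!%:R * expR (- r^-1 * young omega (r * n%:R)) <=
    M' * (Num.sqrt n`!%:R ^+ d.+1 * expR (- eps^-1 * young omega (eps * (d.+1 * n)%:R))).
  apply: (@le_trans _ _ (M * (Num.sqrt n`!%:R ^+ d.+1 * expR (- eps^-1 * young omega (eps * (d.+1 * n)%:R))))).
    by rewrite leNgt; apply/negP => h; apply: nex; exists n.
  by rewrite ler_wpM2r ?le_max ?lexx// mulr_ge0 ?exprn_ge0 ?sqrtr_ge0 ?expR_ge0.
have d0 : 0 < d%:R :> R by rewrite ltr0n.
have dS : d.+1%:R - 1 = d%:R :> R by rewrite -natr1 addrK.
have d1 : 1 < d.+1%:R :> R by rewrite ltr1n.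
have [L1 L1_1 HL1] := omega_dilation (expR_ge0 (1 : R)).
have L10 : 0 < L1 := lt_le_trans ltr01 L1_1.
have phiS v : phi omega (v + 1) <= L1 * (phi omega v + 1).
  by rewrite /phi expRD mulrC; apply: HL1; exact: expR_ge0.
(* With this step, [h] times a slope is at most half of [phi + 1]. *)
pose h := (2 * L1)^-1.
have h0 : 0 < h by rewrite invr_gt0 mulr_gt0.
have h1 : h <= 1 by rewrite invf_le1 ?mulr_gt0//; lra.
have slope_up v : 0 <= v -> slope (phi omega) v (v + h) <= L1 * (phi omega v + 1).
  move=> v0; apply: le_trans (slope_le_len omega_delta v0 h0 h1) _.
  rewrite /slope (addrC v 1) addrK divr1 (addrC 1 v).
  by apply: le_trans (phiS v); rewrite lerBlDr lerDl phi_ge0.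
have [C1 C10 HC1] := omega_le_sqr (divr_gt0 r0 (mulr_gt0 (ltr0Sn R 1) L10)).
have [C2 HC2] := phi_superlinear (r + 1).
pose U := 1 + L1 * (C1 + 1) / r + Num.max 0 (C2 + phi omega 0).
have q0 : 0 <= L1 * (C1 + 1) / r := divr_ge0 (mulr_ge0 (ltW L10) (addr_ge0 C10 ler01)) (ltW r0).
have U1 : 1 <= U.
  have : 0 <= Num.max 0 (C2 + phi omega 0) by rewrite le_max lexx.
  rewrite /U; lra.
have U2 : L1 * (C1 + 1) / r <= U.
  have : 0 <= Num.max 0 (C2 + phi omega 0) by rewrite le_max lexx.
  rewrite /U; lra.
have U3 : C2 + phi omega 0 <= U.
  have : C2 + phi omega 0 <= Num.max 0 (C2 + phi omega 0) by rewrite le_max lexx orbT.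
  rewrite /U; lra.
(* From [phi (s u)] to [x + phi (s u)], where [x <= L1 / r (phi (s u) + 1)]. *)
pose q := 1 + L1 / r.
have q1 : 0 < q by rewrite /q ltr_wpDr// divr_ge0// ltW.
have lnM0 : 0 <= ln M' by rewrite ln_ge0.
have r2 : 0 < 2 * r by rewrite mulr_gt0.
have Q0 : 0 <= q * (2 * r * ln M' + 2).
  by apply: (mulr_ge0 (ltW q1)); have := mulr_ge0 (ltW r2) lnM0; lra.
exists (q * (2 * r / eps)); first by rewrite mulr_gt0// divr_gt0// mulr_gt0.
exists (q * (2 * r * ln M' + 2) + expR U ^+ 2 + omega (expR U)).
  rewrite ltr_wpDr ?omega_ge0 ?expR_ge0// ltr_wpDl//.
  by rewrite exprn_gt0// expR_gt0.
have E0 : 0 <= expR U ^+ 2 by rewrite exprn_ge0// expR_ge0.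
have W0 := omega_ge0 (expR_ge0 U).
have q20 : 0 <= q * (2 * r / eps) := mulr_ge0 (ltW q1) (divr_ge0 (ltW r2) (ltW e0)).
move=> t t0; have [tU|Ut] := leP t (expR U).
  exists 1; first by rewrite lexx ler1n.
  rewrite divff ?subr_eq0 ?gt_eqF// mulr1 powR_mulrn// powRr1//.
  have a1 : t ^+ 2 <= expR U ^+ 2 by rewrite lerXn2r ?nnegrE// expR_ge0.
  have a2 := omega_mono t0 tU.
  have := mulr_ge0 q20 (omega_ge0 t0); lra.
have tp : 0 < t by rewrite (lt_trans _ Ut)// expR_gt0.
pose u := ln t.
have uU : U <= u by rewrite -ler_expR /u lnK// ltW.
have u0 : 0 < u by rewrite (lt_le_trans ltr01)// (le_trans U1).
have tE : t = expR u by rewrite /u lnK.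
have g1 : slope (phi omega) u (u + h) <= r * expR (2 * ((d.+1%:R - 1) / (d.+1%:R - 1)) * u).
  apply: le_trans (slope_up _ (ltW u0)) _.
  rewrite divff ?subr_eq0 ?gt_eqF// mulr1.
  have a1 := HC1 _ (ltW tp); rewrite tE -/(phi omega u) -expRM_natl in a1.
  have a2 : 1 + 2 * u <= expR (2 * u) by exact: expR_ge1Dx.
  have a3 : L1 * (C1 + 1) <= r * u.
    by rewrite (mulrC r) -ler_pdivrMr//; exact: le_trans U2 uU.
  have a4 : L1 * (phi omega u + 1) <= L1 * (r / (2 * L1) * expR (2 * u) + C1 + 1).
    by rewrite ler_pM2l// lerD2r.
  have a5 : L1 * (r / (2 * L1) * expR (2 * u) + C1 + 1) = r / 2 * expR (2 * u) + L1 * (C1 + 1).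
    by field; rewrite gt_eqF.
  rewrite a5 in a4; apply: (le_trans a4).
  have : r * u <= r * (expR (2 * u) / 2) by rewrite ler_pM2l//; lra.
  lra.
have gd : r <= slope (phi omega) (d.+1%:R * u) (d.+1%:R * u + h).
  set v := d.+1%:R * u.
  have uv : u <= v by rewrite /v ler_peMl// ltW.
  have v0 : 0 < v := lt_le_trans u0 uv.
  apply: le_trans (slope_le omega_delta (lexx 0) v0 (lexx v) _); last by rewrite ltrDl.
  rewrite /slope subr0 ler_pdivlMr//.
  have := HC2 _ (ltW v0); have := le_trans U3 (le_trans uU uv); lra.
have [s /andP[s1 sd] slE] := exists_balanced_sigma h0 u0 d1 g1 gd.
pose x := expR (2 * ((d.+1%:R - s) / (d.+1%:R - 1)) * u).
rewrite -/x in slE.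
pose v0 := s * u; rewrite -/v0 in slE.
have v00 : 0 <= v0 := mulr_ge0 (le_trans ler01 s1) (ltW u0).
have x1 : 1 <= x.
  rewrite -expR0 ler_expR; apply: mulr_ge0 (ltW u0); apply: mulr_ge0 => //.
  by rewrite divr_ge0 ?subr_ge0// ltW.
have xL : x <= L1 / r * (phi omega v0 + 1).
  by rewrite mulrAC ler_pdivlMr// mulrC -slE slope_up.
have hx : h * (r * x) <= (phi omega v0 + 1) / 2.
  rewrite -slE; have := ler_wpM2l (ltW h0) (slope_up _ v00).
  by have -> : h * (L1 * (phi omega v0 + 1)) = (phi omega v0 + 1) / 2 by rewrite /h; field; rewrite gt_eqF.
have x0 : 0 <= x := le_trans ler01 x1.
have /andP[nx xn] := truncn_itv x0.
set n := Num.truncn x in nx xn.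
have n1 : (1 <= n)%N by rewrite truncn_ge_nat.
have nR1 : 1 <= n%:R :> R by rewrite ler1n.
have xn2 : x <= 2 * n%:R by move: xn; rewrite -natr1; lra.
have HB v : 0 <= v -> n%:R * v - phi omega v / r <=
    n%:R * v0 - phi omega v0 / (2 * r) + (2 * r)^-1.
  move=> v_0; exact: (legendre_near_balance L1 h0 r0 v00 v_0 slE hx (ler0n _ _) nx xn2).
have := young_ratio_log n1 r0 e0 M'1 (ltW u0) (Hn n) HB.
have lnn : ln n%:R <= 2 * ((d.+1%:R - s) / (d.+1%:R - 1)) * u.
  by rewrite -ler_expR lnK// posrE (lt_le_trans ltr01).
have lnn2 : d%:R / 2 * (n%:R * ln n%:R) <= n%:R * ((d.+1%:R - s) * u).
  rewrite dS in lnn; rewrite mulrCA ler_pM2l ?ltr0n//.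
  have := ler_wpM2l (ltW (divr_gt0 d0 (ltr0Sn R 1))) lnn.
  by have -> : d%:R / 2 * (2 * ((d.+1%:R - s) / d%:R) * u) = (d.+1%:R - s) * u by field; rewrite gt_eqF.
move=> H.
have H2 : phi omega v0 / (2 * r) <= phi omega u / eps + ln M' + (2 * r)^-1.
  by move: H; rewrite /v0; nra.
have H3 : phi omega v0 <= 2 * r / eps * phi omega u + 2 * r * ln M' + 1.
  move: H2; rewrite ler_pdivrMr//.
  by have -> : (phi omega u / eps + ln M' + (2 * r)^-1) * (2 * r) =
    2 * r / eps * phi omega u + 2 * r * ln M' + 1 by field; rewrite !gt_eqF.
exists s; first by rewrite s1 sd.
have -> : t `^ (2 * ((d.+1%:R - s) / (d.+1%:R - 1))) = x by rewrite /powR gt_eqF.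
have -> : omega (t `^ s) = phi omega v0 by rewrite /powR gt_eqF.
have -> : omega t = phi omega u by rewrite tE.
have : q * (phi omega v0 + 1) <= q * (2 * r / eps * phi omega u + 2 * r * ln M' + 2).
  by rewrite ler_pM2l//; lra.
rewrite /q mulrDl mul1r -/q; lra.
Qed.

End superlinear.

End weights.

(** * Geometrically dominated series *)

Local Notation normc := ComplexField.Normc.normc.

(** Blocks of the series are bounded by [2 C (2^-N - 2^-M)], in a form that goes
    through the induction on [M]. *)
Lemma dominated_series (R : realType) (u : R^nat) (C : R) :
  (forall n, `|u n| <= C * 2^-1 ^+ n) ->
  cvgn (series u) /\ forall N, `|limn (series u) - \sum_(n < N) u n| <= 2 * C * 2^-1 ^+ N.
Proof.
move=> uC.
have C0 : 0 <= C by have := uC 0%N; rewrite expr0 mulr1; exact: le_trans.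
have part N M : (N <= M)%N -> `|\sum_(N <= n < M) u n| <= 2 * C * 2^-1 ^+ N - 2 * C * 2^-1 ^+ M.
  elim: M => [|M IH] NM.
    by move: NM; rewrite leqn0 => /eqP ->; rewrite big_geq// normr0 subrr.
  move: NM; rewrite leq_eqVlt => /predU1P[->|NM]; first by rewrite big_geq// normr0 subrr.
  rewrite big_nat_recr//=; apply: (le_trans (ler_normD _ _)).
  have := IH NM; have := uC M; rewrite [2^-1 ^+ M.+1]exprS.
  have -> : 2 * C * (2^-1 * 2^-1 ^+ M) = C * 2^-1 ^+ M by field.
  lra.
have part' N M : (N <= M)%N -> `|\sum_(N <= n < M) u n| <= 2 * C * 2^-1 ^+ N.
  move=> NM; apply: le_trans (part _ _ NM) _; rewrite lerBlDr lerDl.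
  by rewrite !mulr_ge0// exprn_ge0// invr_ge0.
have cu : cvgn (series u).
  apply: normed_cvg; apply: (@series_le_cvg _ _ (fun n => C * 2^-1 ^+ n)) => //.
  - by move=> n /=.
  - by move=> n; rewrite mulr_ge0// exprn_ge0// invr_ge0.
  - by apply: is_cvg_geometric_series; rewrite ger0_norm ?invr_ge0// invf_lt1// ltr1n.
split => // N; apply/ler_addgt0Pr => e e0.
have /cvgrPdist_lt /(_ _ e0) [M0 _ HM] := cu.
pose M := maxn M0 N.
have h1 : `|limn (series u) - series u M| < e by apply: HM => /=; rewrite leq_maxl.
have h2 : `|series u M - \sum_(n < N) u n| <= 2 * C * 2^-1 ^+ N.
  rewrite /series /= -(big_mkord xpredT) (big_cat_nat _ (n := N))//=; last exact: leq_maxr.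
  by rewrite addrAC subrr add0r; apply: part'; exact: leq_maxr.
have -> : limn (series u) - \sum_(n < N) u n =
  (limn (series u) - series u M) + (series u M - \sum_(n < N) u n) by ring.
by apply: (le_trans (ler_normD _ _)); rewrite addrC lerD// ltW.
Qed.

Lemma le0_of_geometric (R : realType) (x D : R) n :
  (forall N, (n < N)%N -> x <= D * 2^-1 ^+ N) -> x <= 0.
Proof.
move=> xD; rewrite leNgt; apply/negP => x0.
have h1 : `|2^-1 : R| < 1 by rewrite ger0_norm ?invr_ge0// invf_lt1// ltr1n.
have D0 : 0 < `|D| + 1 by rewrite ltr_wpDl.
have /cvgr0Pnorm_lt /(_ (x / (`|D| + 1))) := cvg_expr h1.
rewrite divr_gt0// => /(_ isT) [M _ HM].
have := HM (maxn M n.+1) (leq_maxl _ _).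
rewrite ger0_norm ?exprn_ge0 ?invr_ge0// ltr_pdivlMr//.
have := xD (maxn M n.+1) (leq_maxr _ _).
have : 0 <= 2^-1 ^+ maxn M n.+1 :> R by rewrite exprn_ge0 ?invr_ge0.
have := ler_norm D.
move: (2^-1 ^+ _) `|D| => t nD; nra.
Qed.

(** * Gaussian weights and tensor Hermite functions *)

Section gaussd.
Context (R : realType) (d : nat).
Local Notation mu := (lebesgue_cV R d).

Definition gaussd (s : R) (y : 'cV[R]_d) : R := \prod_j expR (- s * y j 0 ^+ 2).

Lemma gaussd_ge0 s y : 0 <= gaussd s y.
Proof. by apply: prodr_ge0 => j _; exact: expR_ge0. Qed.

Lemma gaussd_gt0 s y : 0 < gaussd s y.
Proof. by apply: prodr_gt0 => j _; exact: expR_gt0. Qed.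

Lemma gaussd_le1 s y : 0 <= s -> gaussd s y <= 1.
Proof.
move=> s0; apply: prodr_ile1 => j _; rewrite expR_ge0 -[leRHS]expR0 ler_expR.
by rewrite mulNr oppr_le0 mulr_ge0// sqr_ge0.
Qed.

Lemma measurable_gaussd s : measurable_fun setT (gaussd s).
Proof.
apply: measurable_prod => j _.
apply: measurableT_comp => //; apply: measurable_funM => //.
by apply: measurable_funX; exact: measurable_coord.
Qed.

Lemma integrable_gaussd s : 0 < s -> mu.-integrable setT (EFin \o gaussd s).
Proof.
move=> s0; have [|] // := @Rintegral_tensor R d (fun=> fun t => expR (- s * t ^+ 2)).
by move=> j; exact: integrable_gauss.
Qed.

Lemma integrable_le_gaussd (f : 'cV[R]_d -> R) (C s : R) : 0 < s ->
  measurable_fun setT f -> (forall y, `|f y| <= C * gaussd s y) ->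
  mu.-integrable setT (EFin \o f).
Proof.
move=> s0 mf le_f.
pose g : 'cV[R]_d -> \bar R := fun x => (C%:E * (gaussd s x)%:E)%E.
apply: (le_integrable measurableT (g := g)).
- exact/measurable_EFinP.
- by move=> x _; rewrite lee_fin (le_trans (le_f x))// ler_norm.
- by apply: integrableZl => //; exact: integrable_gaussd.
Qed.

End gaussd.

Section hprod.
Context (R : realType) (d : nat).
Local Notation mu := (lebesgue_cV R d).

Definition hprod n (y : 'cV[R]_d) : R := \prod_j hermf n (y j 0).

Lemma measurable_hermf n : measurable_fun [set: R] (@hermf R n).
Proof.
apply: continuous_measurable_fun => x; rewrite /hermf.
apply: continuous_mul; first exact: cst_continuous.
by move=> {}x; apply: continuous_mul; [exact: continuous_horner|exact: continuous_gauss].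
Qed.

Lemma measurable_hprod n : measurable_fun setT (hprod n).
Proof.
apply: measurable_prod => j _.
by apply: measurableT_comp (measurable_hermf n) _; exact: measurable_coord.
Qed.

Lemma hprod_le n y : `|hprod n y| <= (hermK R ^+ d) ^+ n * gaussd 4^-1 y.
Proof.
rewrite /hprod normr_prod /gaussd -exprM mulnC exprM.
rewrite -[X in _ ^+ X]card_ord -prodr_const -big_split/=.
by apply: ler_prod => j _; rewrite normr_ge0 hermf_le_gauss.
Qed.

Lemma integrable_hermfM n m :
  (@lebesgue_measure R).-integrable setT (EFin \o (fun t => hermf n t * hermf m t)).
Proof.
apply: (@integrable_le_gauss _ _ (hermK R ^+ n * hermK R ^+ m) 4^-1) => //.
  by apply: measurable_funM; exact: measurable_hermf.
move=> t; rewrite normrM.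
apply: (@le_trans _ _ ((hermK R ^+ n * expR (- 4^-1 * t ^+ 2)) * hermK R ^+ m)).
  apply: ler_pM => //; first exact: hermf_le_gauss.
  apply: le_trans (hermf_le_gauss _ _) _.
  rewrite ler_piMr ?exprn_ge0 ?(le_trans ler01 (hermK_ge1 R))//.
  by rewrite -expR0 ler_expR mulNr oppr_le0 mulr_ge0 ?sqr_ge0.
by rewrite mulrAC.
Qed.

Definition gauss_mass : R := \int[@lebesgue_measure R]_x expR (- 1 * x ^+ 2).

Lemma hprod_ortho n m : (0 < d)%N ->
  \int[mu]_y (hprod n y * hprod m y) = (n == m)%:R * gauss_mass ^+ d.
Proof.
move=> d0; have [|_] := @Rintegral_tensor R d (fun=> fun t => hermf n t * hermf m t).
  by move=> j; exact: integrable_hermfM.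
under eq_Rintegral do rewrite big_split/=.
move=> ->; rewrite prodr_const card_ord hermf_ortho exprMn.
by case: (n == m); rewrite ?expr1n// expr0n gtn_eqF.
Qed.

End hprod.

(** * Norms of complex functions with Gaussian decay *)

Section gaussian_norms.
Context (R : realType) (d : nat).
Local Notation mu := (lebesgue_cV R d).
Implicit Types f g : 'cV[R]_d -> R[i].

Lemma normc_le (z : R[i]) : normc z <= `|complex.Re z| + `|complex.Im z|.
Proof.
case: z => a b /=; rewrite -(ger0_norm (sqrtr_ge0 _)); apply: ler_sqrr; first by rewrite addr_ge0.
rewrite -normrX sqr_sqrtr ?addr_ge0 ?sqr_ge0// ger0_norm ?addr_ge0 ?sqr_ge0//.
rewrite sqrrD !real_normK ?num_real// addrAC lerDl mulrn_wge0// mulr_ge0//.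
Qed.

Lemma normc_real (x : R) : normc x%:C%C = `|x|.
Proof. by rewrite /= expr0n addr0 sqrtr_sqr. Qed.

Lemma measurable_cfunM f g : measurable_cfun f -> measurable_cfun g ->
  measurable_cfun (fun x => f x * g x).
Proof.
move=> [fr fi] [gr gi]; split.
  apply: eq_measurable_fun (measurable_funB (measurable_funM fr gr) (measurable_funM fi gi)) => x _ /=.
  by case: (f x) (g x) => ? ? [].
apply: eq_measurable_fun (measurable_funD (measurable_funM fr gi) (measurable_funM fi gr)) => x _ /=.
by case: (f x) (g x) => ? ? [].
Qed.

Lemma measurable_cfun_cst (z : R[i]) : measurable_cfun (fun _ : 'cV[R]_d => z).
Proof. by split; exact: measurable_cst. Qed.

Lemma measurable_cfun_real (h : 'cV[R]_d -> R) : measurable_fun setT h ->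
  measurable_cfun (fun x => (h x)%:C%C).
Proof. by move=> mh; split => //=; exact: measurable_cst. Qed.

Lemma measurable_normc f : measurable_cfun f -> measurable_fun setT (fun x => normc (f x)).
Proof.
move=> [fr fi].
have -> : (fun x => normc (f x)) =
    (fun x => Num.sqrt (complex.Re (f x) ^+ 2 + complex.Im (f x) ^+ 2)).
  by apply/funext => x; case: (f x).
apply: measurableT_comp; first by apply: continuous_measurable_fun; exact: sqrt_continuous.
by apply: measurable_funD; exact: measurable_funX.
Qed.

(** A Gaussian is at most [1], so its powers [p >= 1] are at most itself, and [G^p]
    can be taken as its integral. *)
Lemma cLnorm_le (M : 'M[R]_d) (k p s : R) : 0 < s -> 1 <= p -> 0 < k -> scales_lebesgue M k ->
  exists2 G : R, 0 <= G & forall f (C : R), measurable_cfun f -> 0 <= C ->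
    (forall x, normc (f x) <= C * gaussd s (M *m x)) -> (cLnorm p%:E f <= (C * G)%:E)%E.
Proof.
move=> s0 p1 k0 sM.
have p0 : 0 < p := lt_le_trans ltr01 p1.
have [iM EM] := scales_integral k0 sM (integrable_gaussd d s0).
pose I := \int[mu]_x gaussd s (M *m x).
have I0 : 0 <= I by apply: Rintegral_ge0 => x _; exact: gaussd_ge0.
exists (I `^ p^-1); first exact: powR_ge0.
move=> f C mf C0 f_le.
have mn := measurable_normc mf.
have n0 x : 0 <= normc (f x) by case: (f x) => a b; exact: sqrtr_ge0.
have g0 x : 0 <= C * gaussd s (M *m x) by rewrite mulr_ge0// gaussd_ge0.
rewrite /cLnorm unlock; under eq_integral => x _ do rewrite /= ger0_norm//.
have -> : (C * I `^ p^-1)%:E = ((C `^ p * I)%:E `^ p^-1)%E.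
  rewrite poweR_EFin powRM ?powR_ge0// -powRrM mulfV ?gt_eqF// powRr1//.
apply: gt0_ler_poweR; first by rewrite invr_ge0 ltW.
- rewrite in_itv/= leey andbT.
  by apply: integral_ge0 => x _; rewrite lee_fin powR_ge0.
- by rewrite in_itv/= leey andbT lee_fin mulr_ge0// powR_ge0.
apply: (@le_trans _ _ (\int[mu]_x ((C `^ p)%:E * (gaussd s (M *m x))%:E))%E).
  apply: ge0_le_integral => //.
  - by move=> x _; rewrite lee_fin powR_ge0.
  - by apply/measurable_EFinP; exact: measurableT_comp (measurable_powR p) mn.
  - under eq_fun => x do rewrite -EFinM.
    apply/measurable_EFinP; apply: measurable_funM => //.
    by apply: measurableT_comp; [exact: measurable_gaussd|exact: measurable_mulmx].
  move=> x _; rewrite -EFinM lee_fin.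
  apply: (@le_trans _ _ ((C * gaussd s (M *m x)) `^ p)).
    by apply: ge0_ler_powR => //; rewrite ?nnegrE// ltW.
  rewrite powRM ?gaussd_ge0// ler_wpM2l ?powR_ge0//.
  by rewrite ge1r_powR// gaussd_gt0 gaussd_le1// ltW.
by rewrite integralZl// -[X in (_ * X)%E]fineK// integrable_fin_num.
Qed.

End gaussian_norms.

Section gaussian_norms_cvg.
Context (R : realType) (d : nat).
Local Notation mu := (lebesgue_cV R d).
Variables (M : 'M[R]_d) (k s p : R).
Hypotheses (s0 : 0 < s) (p1 : 1 <= p) (k0 : 0 < k) (sM : scales_lebesgue M k).

Lemma memLp_gaussian (f : 'cV[R]_d -> R[i]) (C : R) : measurable_cfun f -> 0 <= C ->
  (forall x, normc (f x) <= C * gaussd s (M *m x)) -> memLp p%:E f.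
Proof.
move=> mf C0 f_le; split => //.
have [G _ HG] := cLnorm_le s0 p1 k0 sM.
by apply: le_lt_trans (HG f C mf C0 f_le) _; rewrite ltry.
Qed.

Lemma cLnorm_cvg0 (F : ('cV[R]_d -> R[i])^nat) (C : R) :
  (forall N, measurable_cfun (F N)) -> 0 <= C ->
  (forall N x, normc (F N x) <= C * 2^-1 ^+ N * gaussd s (M *m x)) ->
  cLnorm p%:E (F N) @[N --> \oo] --> 0%E.
Proof.
move=> mF C0 F_le.
have [G G0 HG] := cLnorm_le s0 p1 k0 sM.
have geo0 : (C * 2^-1 ^+ N * G)%:E @[N --> \oo] --> 0%E.
  have -> : (fun N => (C * 2^-1 ^+ N * G)%:E) = EFin \o (fun N => C * G * 2^-1 ^+ N).
    by apply/funext => N /=; rewrite mulrAC.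
  apply: cvg_EFin; first exact: nearW.
  rewrite -(mulr0 (C * G)); apply: cvgMr; apply: cvg_expr.
  by rewrite ger0_norm ?invr_ge0// invf_lt1// ltr1n.
apply: (squeeze_cvge _ (cvg_cst 0%E) geo0).
apply: nearW => N; rewrite Lnorm_ge0/=; apply: HG => //.
by rewrite mulr_ge0// exprn_ge0// invr_ge0.
Qed.

End gaussian_norms_cvg.

(** * Fourier transform of tensor Hermite functions *)

Section cintegral_linear.
Context (R : realType) (d : nat).
Local Notation mu := (lebesgue_cV R d).

Lemma cintegral_scale_sum (b : R^nat) (f : nat -> 'cV[R]_d -> R[i]) N :
  (forall n, cintegrable mu (f n)) ->
  cintegrable mu (fun x => \sum_(n < N) (b n)%:C%C * f n x) /\
  cintegral (fun x => \sum_(n < N) (b n)%:C%C * f n x) =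
  \sum_(n < N) (b n)%:C%C * cintegral (f n).
Proof.
move=> intf; elim: N => [|N [[iRe iIm] E]].
  have -> : (fun x : 'cV[R]_d => \sum_(n < 0) (b n)%:C%C * f n x) = cst 0.
    by apply/funext => x; rewrite big_ord0.
  rewrite big_ord0; split; first by split; exact: integrable0.
  by rewrite /cintegral/= Rintegral_cst// mul0r.
have [fRe fIm] := intf N.
have bRe : mu.-integrable setT (EFin \o (fun x => b N * complex.Re (f N x))).
  by apply: eq_integrable (integrableZl measurableT (b N) fRe).
have bIm : mu.-integrable setT (EFin \o (fun x => b N * complex.Im (f N x))).
  by apply: eq_integrable (integrableZl measurableT (b N) fIm).
have ReE x : complex.Re (\sum_(n < N.+1) (b n)%:C%C * f n x) =
    complex.Re (\sum_(n < N) (b n)%:C%C * f n x) + b N * complex.Re (f N x).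
  rewrite big_ord_recr/=; case: (\sum_(_ < _) _) (f N x) => ? ? [? ?] /=.
  by rewrite mul0r subr0.
have ImE x : complex.Im (\sum_(n < N.+1) (b n)%:C%C * f n x) =
    complex.Im (\sum_(n < N) (b n)%:C%C * f n x) + b N * complex.Im (f N x).
  rewrite big_ord_recr/=; case: (\sum_(_ < _) _) (f N x) => ? ? [? ?] /=.
  by rewrite mul0r addr0.
split.
  split; rewrite /comp.
    by under eq_fun do rewrite ReE EFinD; exact: integrableD.
  by under eq_fun do rewrite ImE EFinD; exact: integrableD.
rewrite /cintegral.
under eq_Rintegral do rewrite ReE.
under [X in (_ +i* X)%C]eq_Rintegral do rewrite ImE.
rewrite !RintegralD// !RintegralZl// big_ord_recr/= -E /cintegral.
have lin (a1 a2 c e f0 : R) : ((a1 + c * e) +i* (a2 + c * f0))%C =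
    (a1 +i* a2)%C + c%:C%C * (e +i* f0)%C.
  by apply/eqP; rewrite eq_complex/= !mul0r subr0 addr0 !eqxx.
exact: lin.
Qed.

End cintegral_linear.

Section fourier_hprod.
Context (R : realType) (d : nat).
Local Notation mu := (lebesgue_cV R d).

Lemma expiD (a b : R) : expi (a + b) = expi a * expi b.
Proof.
by rewrite /expi cosD sinD [RHS]/GRing.mul/=; congr (_ +i* _)%C; ring.
Qed.

Lemma expi_dotv (y xi : 'cV[R]_d) : expi (- dotv y xi) = \prod_j expi (- (y j 0 * xi j 0)).
Proof.
rewrite /dotv -sumrN; apply: (big_morph (@expi R)); first exact: expiD.
by rewrite /expi cos0 sin0.
Qed.

Definition gauss_mass_half : R := \int[@lebesgue_measure R]_x expR (- 2^-1 * x ^+ 2).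

(** The kernel is a product over the coordinates, so this is [hermf_fourier] in each
    of them. *)
Lemma hprod_fourier n (xi : 'cV[R]_d) :
  let F (y : 'cV[R]_d) := (hprod n y)%:C%C * expi (- dotv y xi) in
  cintegrable mu F /\
  cintegral F = (gauss_mass_half ^+ d)%:C%C * (0 +i* -1)%C ^+ (n * d) * (hprod n xi)%:C%C.
Proof.
move=> F.
pose g j t : R[i] := (hermf n t)%:C%C * expi (- (t * xi j 0)).
have -> : F = (fun y => \prod_j g j (y j 0)).
  by apply/funext => y; rewrite /F /g expi_dotv rmorph_prod big_split.
have [|ig ->] := @cintegral_tensor R d g.
  move=> j; have hint (h : R -> R) : measurable_fun setT h -> (forall t, `|h t| <= 1) ->
      (@lebesgue_measure R).-integrable setT (EFin \o (fun t => hermf n t * h t)).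
    move=> mh h1; apply: (@integrable_le_gauss _ _ (hermK R ^+ n) 4^-1) => //.
      by apply: measurable_funM => //; exact: measurable_hermf.
    move=> t; rewrite normrM; apply: le_trans (ler_wpM2l _ (h1 t)) _ => //.
    by rewrite mulr1 hermf_le_gauss.
  have mt : measurable_fun [set: R] (fun t => - (t * xi j 0)).
    by apply: measurableT_comp => //; exact: measurable_funM.
  split.
    apply: eq_integrable (hint (fun t => cos (- (t * xi j 0))) _ _) => //.
    - by move=> t _; rewrite /g /= mul0r subr0.
    - by apply: measurableT_comp mt; apply: continuous_measurable_fun; exact: continuous_cos.
    - by move=> t; rewrite ler_norml cos_geN1 cos_le1.
  apply: eq_integrable (hint (fun t => sin (- (t * xi j 0))) _ _) => //.
  - by move=> t _; rewrite /g /= mul0r addr0.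
  - by apply: measurableT_comp mt; apply: continuous_measurable_fun; exact: continuous_sin.
  - by move=> t; rewrite ler_norml sin_geN1 sin_le1.
split => //.
under eq_bigr do rewrite hermf_fourier.
rewrite !big_split/= !prodr_const card_ord -exprM rmorphXn/= /hprod rmorph_prod.
by [].
Qed.

End fourier_hprod.

(** * Diagonal Hermite series *)

Section hermite_series.
Context (R : realType) (d : nat).
Local Notation mu := (lebesgue_cV R d).
Implicit Types b : R^nat.

(** Decay that beats the growth [(hermK^d)^n] in [hprod_le] geometrically. *)
Definition rapid b (C : R) := forall n, `|b n| * (hermK R ^+ d) ^+ n <= C * 2^-1 ^+ n.

Definition hsum b (N : nat) (y : 'cV[R]_d) : R := \sum_(n < N) b n * hprod n y.

Definition hser b (y : 'cV[R]_d) : R := limn (series (fun n => b n * hprod n y)).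

Lemma rapid_ge0 b C : rapid b C -> 0 <= C.
Proof. by move=> /(_ 0%N); rewrite !expr0 !mulr1; exact: le_trans. Qed.

Lemma rapid_le b c C : (forall n, `|c n| <= `|b n|) -> rapid b C -> rapid c C.
Proof.
move=> cb rb n; apply: le_trans (rb n).
by rewrite ler_wpM2r// !exprn_ge0// (le_trans ler01 (hermK_ge1 R)).
Qed.

Lemma hterm_le b C n (y : 'cV[R]_d) : rapid b C ->
  `|b n * hprod n y| <= C * gaussd 4^-1 y * 2^-1 ^+ n.
Proof.
move=> rb; rewrite normrM; apply: le_trans (ler_wpM2l _ (hprod_le n y)) _ => //.
by rewrite mulrA [leRHS]mulrAC ler_wpM2r// gaussd_ge0.
Qed.

Lemma hser_approx b C N (y : 'cV[R]_d) : rapid b C ->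
  `|hser b y - hsum b N y| <= 2 * C * 2^-1 ^+ N * gaussd 4^-1 y.
Proof.
move=> rb; have [_ /(_ N)] := dominated_series (fun n => hterm_le n y rb).
by rewrite -!mulrA [gaussd _ _ * _]mulrC.
Qed.

Lemma hser_le b C (y : 'cV[R]_d) : rapid b C -> `|hser b y| <= 2 * C * gaussd 4^-1 y.
Proof.
by move=> rb; have := hser_approx 0 y rb; rewrite /hsum big_ord0 subr0 expr0 mulr1.
Qed.

Lemma hsum_le b C N (y : 'cV[R]_d) : rapid b C -> `|hsum b N y| <= 4 * C * gaussd 4^-1 y.
Proof.
move=> rb; have -> : hsum b N y = hser b y - (hser b y - hsum b N y) by ring.
apply: le_trans (ler_normB _ _) _.
have h1 := hser_le y rb; have h2 := hser_approx N y rb.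
have C0 := rapid_ge0 rb.
have : 2 * C * 2^-1 ^+ N * gaussd 4^-1 y <= 2 * C * gaussd 4^-1 y.
  rewrite ler_wpM2r ?gaussd_ge0// ler_piMr ?mulr_ge0// exprn_ile1// ?invr_ge0//.
  by rewrite invf_le1// ler1n.
lra.
Qed.

Lemma measurable_hsum b N : measurable_fun setT (hsum b N).
Proof.
apply: measurable_sum => n.
by apply: measurable_funM => //; exact: measurable_hprod.
Qed.

Lemma measurable_hser b C : rapid b C -> measurable_fun setT (hser b).
Proof.
move=> rb; apply: (measurable_fun_cvg (h := hsum b)) => [n|y _].
  exact: measurable_hsum.
have [cv _] := dominated_series (fun n => hterm_le n y rb).
have -> : hsum b ^~ y = series (fun n => b n * hprod n y).
  by apply/funext => n; rewrite /hsum /series/= big_mkord.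
exact: cv.
Qed.

(** By orthogonality, the partial sums have this integral as soon as they contain
    the index [n]; and their integrals approach that of the series at a geometric
    rate. *)
Lemma hser_coef b C n : (0 < d)%N -> rapid b C ->
  \int[mu]_y (hser b y * hprod n y) = b n * gauss_mass R ^+ d.
Proof.
move=> d0 rb.
have C0 := rapid_ge0 rb.
pose H := (hermK R ^+ d) ^+ n.
have H0 : 0 <= H by rewrite !exprn_ge0// (le_trans ler01 (hermK_ge1 R)).
have g4 : 0 < 4^-1 :> R by rewrite invr_gt0.
have prod_le (u : 'cV[R]_d -> R) D : (forall y, `|u y| <= D * gaussd 4^-1 y) -> 0 <= D ->
    forall y, `|u y * hprod n y| <= D * H * gaussd 4^-1 y.
  move=> uD D0 y; rewrite normrM.
  apply: le_trans (ler_pM _ _ (uD y) (hprod_le n y)) _ => //.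
  rewrite -/H mulrACA ler_wpM2l ?mulr_ge0//.
  by rewrite ler_piMr ?gaussd_ge0// gaussd_le1// ltW.
have iM (u : 'cV[R]_d -> R) D : measurable_fun setT u ->
    (forall y, `|u y| <= D * gaussd 4^-1 y) -> 0 <= D ->
    mu.-integrable setT (EFin \o (fun y => u y * hprod n y)).
  move=> mu_ uD D0; apply: (integrable_le_gaussd (C := D * H) g4).
    by apply: measurable_funM => //; exact: measurable_hprod.
  exact: prod_le.
have mser := measurable_hser rb.
have isum N : mu.-integrable setT (EFin \o (fun y => hsum b N y * hprod n y)).
  apply: iM (fun y => hsum_le N y rb) _; first exact: measurable_hsum.
  by rewrite mulr_ge0.
have iser : mu.-integrable setT (EFin \o (fun y => hser b y * hprod n y)).
  by apply: iM (fun y => hser_le y rb) _ => //; rewrite mulr_ge0.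
have sumE N : (n < N)%N ->
    \int[mu]_y (hsum b N y * hprod n y) = b n * gauss_mass R ^+ d.
  move=> nN; have [|_] := @cintegral_scale_sum R d b (fun m y => (hprod m y * hprod n y)%:C%C) N.
    move=> m; split; last exact: integrable0.
    apply: iM (fun y => hprod_le m y) _; first exact: measurable_hprod.
    by rewrite !exprn_ge0// (le_trans ler01 (hermK_ge1 R)).
  have sE (y : 'cV[R]_d) : \sum_(m < N) (b m)%:C%C * (hprod m y * hprod n y)%:C%C =
      (hsum b N y * hprod n y)%:C%C.
    rewrite /hsum mulr_suml rmorph_sum; apply: eq_bigr => m _.
    by rewrite -rmorphM mulrA.
  move=> /(congr1 (@complex.Re R)); rewrite /cintegral/=.
  under eq_Rintegral do rewrite sE/=.
  move=> ->; under eq_bigr => m _ do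
    rewrite hprod_ortho// Rintegral_cst// mul0r -[(_ +i* 0)%C]/(_%:C%C) -rmorphM/=.
  rewrite -rmorph_sum/= (bigD1 (Ordinal nN))//= eqxx mul1r big1 ?addr0// => m mn.
  by rewrite (_ : (m == n :> nat) = false) ?mul0r ?mulr0//; apply/negbTE.
pose G := \int[mu]_y gaussd 4^-1 y.
have G0 : 0 <= G by apply: Rintegral_ge0 => y _; exact: gaussd_ge0.
(* The two numbers are the integrals of [hser b] and [hsum b N] against [hprod n]. *)
have close N : (n < N)%N ->
    `|\int[mu]_y (hser b y * hprod n y) - b n * gauss_mass R ^+ d| <=
    2 * C * H * G * 2^-1 ^+ N.
  move=> nN; rewrite -(sumE N)// -RintegralB//.
  under eq_Rintegral do rewrite -mulrBl.
  have D0 : 0 <= 2 * C * 2^-1 ^+ N by rewrite !mulr_ge0// exprn_ge0// invr_ge0.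
  have mD : measurable_fun setT (fun y => hser b y - hsum b N y).
    by apply: measurable_funB => //; exact: measurable_hsum.
  have iD := iM _ _ mD (fun y => hser_approx N y rb) D0.
  apply: le_trans (le_normr_Rintegral _ _) _ => //.
  have -> : 2 * C * H * G * 2^-1 ^+ N = \int[mu]_y (2 * C * 2^-1 ^+ N * H * gaussd 4^-1 y).
    by rewrite RintegralZl//; [rewrite -/G; ring|exact: integrable_gaussd].
  apply: le_Rintegral => //.
  - by apply: eq_integrable (integrable_abse iD).
  - by apply: eq_integrable (integrableZl measurableT (2 * C * 2^-1 ^+ N * H)
      (integrable_gaussd d g4)).
  - by move=> y _; exact: prod_le (fun y => hser_approx N y rb) D0 y.
apply/eqP; rewrite -subr_eq0 -normr_le0.
exact: le0_of_geometric close.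
Qed.

End hermite_series.

(** * Coordinates of the square root *)

Section sqrt_coordinates.
Context (R : realType) (d : nat).
Variable A : 'M[R]_d.
Hypothesis A_spd : spd A.
Local Notation B := (sqrtmx A).

Lemma sqrtmx_tr : B^T = B.
Proof. by have [[]] := sqrtmxP A_spd. Qed.

Lemma sqrtmx_unit : B \in unitmx.
Proof. by have [sB _] := sqrtmxP A_spd; exact: spd_unitmx. Qed.

Lemma sqrtmx_invr : invmx A = invmx B *m invmx B.
Proof.
have [_ BB] := sqrtmxP A_spd; have uB := sqrtmx_unit; have uA := spd_unitmx A_spd.
have AK : A *m (invmx B *m invmx B) = 1%:M.
  transitivity (B *m B *m (invmx B *m invmx B)); first by rewrite BB.
  by rewrite mulmxA -(mulmxA B) mulmxV// mulmx1 mulmxV.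
by rewrite -[LHS]mulmx1 -AK mulmxA mulVmx// mul1mx.
Qed.

Lemma dotv_basis_vec (u : 'cV[R]_d) j : dotv u (basis_vec R j) = u j 0.
Proof.
rewrite /dotv (bigD1 j)//= basis_vecE eqxx mulr1 big1 ?addr0// => i ij.
by rewrite basis_vecE (negbTE ij) mulr0.
Qed.

(** The vectors [vvec] and [wvec] are chosen such that the weights depend on one
    coordinate of [B x] and of [B^-1 xi]. *)
Lemma dotv_vvec x j : dotv (A *m x) (vvec A j) = (B *m x) j 0.
Proof.
have [_ BB] := sqrtmxP A_spd; have uB := sqrtmx_unit.
rewrite /vvec -[invmx B]trmxK -dotv_mulmx dotv_basis_vec trmx_inv sqrtmx_tr.
have -> : A *m x = B *m (B *m x) by rewrite mulmxA BB.
by rewrite mulmxA mulVmx// mul1mx.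
Qed.

Lemma dotv_wvec xi j : dotv (invmx A *m xi) (wvec A j) = (invmx B *m xi) j 0.
Proof.
have uB := sqrtmx_unit.
rewrite /wvec -{1}sqrtmx_tr -dotv_mulmx dotv_basis_vec sqrtmx_invr.
by rewrite !mulmxA mulmxV// mul1mx.
Qed.

Lemma dotv_sqrtmx x xi : dotv x xi = dotv (B *m x) (invmx B *m xi).
Proof. by rewrite dotv_mulmx sqrtmx_tr mulmxA mulmxV ?sqrtmx_unit// mul1mx. Qed.

End sqrt_coordinates.

(** * Fourier transform of a diagonal Hermite series *)

Lemma unit_root_le (R : realType) n :
  `|complex.Re ((0 +i* -1 : R[i])%C ^+ n)| <= 1 /\
  `|complex.Im ((0 +i* -1 : R[i])%C ^+ n)| <= 1.
Proof.
have nw : normc ((0 +i* -1 : R[i])%C ^+ n) = 1.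
  elim: n => [|n IH]; first by rewrite expr0 Normc.normc1.
  by rewrite exprS Normc.normcM IH mulr1/= expr0n/= add0r sqrrN expr1n sqrtr1.
move: nw; case: (_ ^+ n) => u v /= uv.
have uv1 : u ^+ 2 + v ^+ 2 = 1.
  by rewrite -(expr1n _ 2) -uv sqr_sqrtr// addr_ge0// sqr_ge0.
have h (x y : R) : x ^+ 2 + y ^+ 2 = 1 -> `|x| <= 1.
  move=> E; apply: ler_sqrr => //; rewrite real_normK ?num_real// expr1n -E lerDl.
  exact: sqr_ge0.
by split; [exact: h uv1|apply: (h _ u); rewrite addrC].
Qed.

Section hermite_series_fourier.
Context (R : realType) (d : nat).
Variables (A : 'M[R]_d) (k : R).
Hypotheses (A_spd : spd A) (k0 : 0 < k) (scales_k : scales_lebesgue (sqrtmx A) k).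
Variables (b : R^nat) (C : R).
Hypothesis rb : rapid d b C.
Local Notation B := (sqrtmx A).
Local Notation w := (0 +i* -1 : R[i])%C.

Definition fourier_const : R := (2 * pi) `^ (- (d%:R / 2)) * (k * gauss_mass_half R ^+ d).

Definition hser_mx (x : 'cV[R]_d) : R[i] := (hser b (B *m x))%:C%C.

Let bRe n := b n * complex.Re (w ^+ (n * d)).
Let bIm n := b n * complex.Im (w ^+ (n * d)).

(** The eigenvalues [(-i)^(n d)] turn the coefficients into complex numbers; their
    real and imaginary parts are summed separately. *)
Definition hser_mx_hat (xi : 'cV[R]_d) : R[i] :=
  fourier_const%:C%C * (hser bRe (invmx B *m xi) +i* hser bIm (invmx B *m xi))%C.

(** Substitute [y = B x]; as [B] is symmetric, [<x, xi> = <B x, B^-1 xi>]. *)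
Lemma fourier_hsum N xi :
  fourier (fun x => (hsum b N (B *m x))%:C%C) xi =
  fourier_const%:C%C * (hsum bRe N (invmx B *m xi) +i* hsum bIm N (invmx B *m xi))%C.
Proof.
set eta := invmx B *m xi.
pose F n (y : 'cV[R]_d) : R[i] := (hprod n y)%:C%C * expi (- dotv y eta).
have intF n : cintegrable (lebesgue_cV R d) (F n) by have [] := hprod_fourier n eta.
have [intS S_E] := cintegral_scale_sum b N intF.
rewrite /fourier.
have -> : (fun x : 'cV[R]_d => (hsum b N (B *m x))%:C%C * expi (- dotv x xi)) =
    (fun x => (fun y => \sum_(n < N) (b n)%:C%C * F n y) (B *m x)).
  apply/funext => x; rewrite (dotv_sqrtmx A_spd) /hsum rmorph_sum mulr_suml.
  by apply: eq_bigr => n _; rewrite rmorphM/= /F mulrA.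
have [_ ->] := scales_cintegral k0 scales_k intS.
rewrite S_E (eq_bigr (fun n : 'I_N => (gauss_mass_half R ^+ d)%:C%C *
    (bRe n * hprod n eta +i* (bIm n * hprod n eta))%C)); last first.
  move=> n _; have [_ ->] := hprod_fourier n eta; rewrite /bRe /bIm.
  case: (w ^+ (n * d)) => u v; apply/eqP; rewrite eq_complex/=.
  by apply/andP; split; apply/eqP; ring.
rewrite -mulr_sumr !mulrA -!rmorphM/= /fourier_const -!mulrA; congr (_ * _).
rewrite /hsum; apply/eqP; rewrite eq_complex/= !raddf_sum/=.
by rewrite !eqxx.
Qed.

Let rbRe : rapid d bRe C.
Proof.
by apply: rapid_le rb => n; rewrite normrM ler_piMr//; have [] := unit_root_le R (n * d).
Qed.

Let rbIm : rapid d bIm C.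
Proof.
by apply: rapid_le rb => n; rewrite normrM ler_piMr//; have [] := unit_root_le R (n * d).
Qed.

Lemma fourier_const_gt0 : 0 < fourier_const.
Proof.
rewrite !mulr_gt0// ?powR_gt0 ?mulr_gt0 ?pi_gt0// exprn_gt0//.
by apply: Rintegral_gauss_gt0; rewrite invr_gt0.
Qed.

Let C0 : 0 <= C := rapid_ge0 rb.
Let q0 : 0 < 4^-1 :> R. Proof. by rewrite invr_gt0. Qed.

Let measurable_comp_mx (h : 'cV[R]_d -> R) (M : 'M[R]_d) : measurable_fun setT h ->
  measurable_fun setT (fun x : 'cV[R]_d => h (M *m x)).
Proof. by move=> mh; exact: measurableT_comp mh (measurable_mulmx M). Qed.

Lemma measurable_hser_mx : measurable_cfun hser_mx.
Proof. by apply: measurable_cfun_real; apply: measurable_comp_mx; exact: measurable_hser rb. Qed.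

Lemma hser_mx_L2 : memLp 2%:E hser_mx.
Proof.
apply: (memLp_gaussian q0 _ k0 scales_k measurable_hser_mx (C := 2 * C)).
- by rewrite ler1n.
- by rewrite mulr_ge0.
- by move=> x; rewrite normc_real; exact: hser_le.
Qed.

(** The partial sums are the approximating sequence, on both sides. *)
Lemma hser_mx_fourier : is_fourier_L2 hser_mx hser_mx_hat.
Proof.
have kV0 : 0 < k^-1 by rewrite invr_gt0.
have sV := scales_invmx (sqrtmx_unit A_spd) k0 scales_k.
have K0 := fourier_const_gt0.
have mhat : measurable_cfun hser_mx_hat.
  apply: measurable_cfunM; first exact: measurable_cfun_cst.
  by split => /=; apply: measurable_comp_mx; [exact: measurable_hser rbRe|exact: measurable_hser rbIm].
have hat_le (u v D : R) : `|u| <= D -> `|v| <= D ->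
    normc (fourier_const%:C%C * (u +i* v)%C) <= fourier_const * (2 * D).
  move=> uD vD; rewrite Normc.normcM normc_real ger0_norm ?(ltW K0)//.
  rewrite ler_wpM2l ?(ltW K0)//; apply: le_trans (normc_le _) _ => /=.
  by rewrite mulr_natl mulr2n lerD.
have D0 : 0 <= fourier_const * (2 * (2 * C)).
  by rewrite mulr_ge0 ?(ltW K0)// !mulr_ge0.
split.
  apply: (memLp_gaussian q0 _ kV0 sV mhat (C := fourier_const * (2 * (2 * C)))).
  - by rewrite ler1n.
  - exact: D0.
  - move=> x; rewrite (_ : fourier_const * (2 * (2 * C)) * _ =
      fourier_const * (2 * (2 * C * gaussd 4^-1 (invmx B *m x)))); last by ring.
    by apply: hat_le; exact: hser_le.
exists (fun N x => (hsum b N (B *m x))%:C%C).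
have mF N : measurable_cfun (fun x => (hsum b N (B *m x))%:C%C).
  by apply: measurable_cfun_real; apply: measurable_comp_mx; exact: measurable_hsum.
split.
- move=> N; have le4 x : normc (hsum b N (B *m x))%:C%C <= 4 * C * gaussd 4^-1 (B *m x).
    by rewrite normc_real; exact: hsum_le.
  have C4 : 0 <= 4 * C by rewrite mulr_ge0.
  split; first exact: (memLp_gaussian q0 (lexx 1) k0 scales_k (mF N) C4 le4).
  by apply: (memLp_gaussian q0 _ k0 scales_k (mF N) C4 le4); rewrite ler1n.
- apply: (cLnorm_cvg0 q0 _ k0 scales_k (C := 2 * C)).
  + by rewrite ler1n.
  + move=> N; rewrite /hser_mx; under eq_fun do rewrite -rmorphB/=.
    apply: measurable_cfun_real.
    apply: (measurable_comp_mx (h := fun y => hsum b N y - hser b y)).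
    by apply: measurable_funB; [exact: measurable_hsum|exact: measurable_hser rb].
  + by rewrite mulr_ge0.
  + by move=> N x; rewrite /hser_mx -rmorphB normc_real distrC; exact: hser_approx.
- apply: (cLnorm_cvg0 q0 _ kV0 sV (C := fourier_const * (2 * (2 * C)))).
  + by rewrite ler1n.
  + move=> N; under eq_fun do rewrite fourier_hsum /hser_mx_hat -mulrBr.
    apply: measurable_cfunM; first exact: measurable_cfun_cst.
    split => /=.
      apply: (measurable_comp_mx (h := fun y => hsum bRe N y - hser bRe y)).
      by apply: measurable_funB; [exact: measurable_hsum|exact: measurable_hser rbRe].
    apply: (measurable_comp_mx (h := fun y => hsum bIm N y - hser bIm y)).
    by apply: measurable_funB; [exact: measurable_hsum|exact: measurable_hser rbIm].
  + exact: D0.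
  move=> N x; rewrite fourier_hsum /hser_mx_hat -mulrBr.
  rewrite (_ : fourier_const * (2 * (2 * C)) * _ * _ =
    fourier_const * (2 * (2 * C * 2^-1 ^+ N * gaussd 4^-1 (invmx B *m x)))); last by ring.
  by apply: hat_le; rewrite distrC; exact: hser_approx.
Qed.

End hermite_series_fourier.

(** * Hermite coefficients of a diagonal Hermite series *)

Section hermite_series_coef.
Context (R : realType) (d : nat).
Variables (A : 'M[R]_d) (k : R).
Hypotheses (d0 : (0 < d)%N) (A_spd : spd A) (k0 : 0 < k).
Hypothesis (scales_k : scales_lebesgue (sqrtmx A) k).
Variables (b : R^nat) (C : R).
Hypothesis rb : rapid d b C.
Local Notation B := (sqrtmx A).

Definition coef_const : R :=
  k * ((\det A) `^ 4^-1 * pi `^ (- (d%:R / 4)) * gauss_mass R ^+ d).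

Lemma coef_const_gt0 : 0 < coef_const.
Proof.
have detA : \det A != 0 by have := spd_unitmx A_spd; rewrite unitmxE unitfE.
rewrite !mulr_gt0//.
- by rewrite /powR (negbTE detA) expR_gt0.
- by rewrite powR_gt0// pi_gt0.
- by rewrite exprn_gt0//; apply: Rintegral_gauss_gt0.
Qed.

Lemma hser_mx_coef n :
  hermite_coef A (hser_mx A b) (fun=> n) = (coef_const * b n)%:C%C.
Proof.
pose c := (\det A) `^ 4^-1 * pi `^ (- (d%:R / 4)).
have C0 := rapid_ge0 rb.
have q0 : 0 < 4^-1 :> R by rewrite invr_gt0.
have fE : (fun x : 'cV[R]_d => hser_mx A b x * ((hermite_mx A (fun=> n) x)%:C)^*%C) =
    (fun x => (c * (hser b (B *m x) * hprod n (B *m x)))%:C%C).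
  apply/funext => x; rewrite /hser_mx /hermite_mx hermite_prod conjc_real -rmorphM/=.
  by congr (_%:C)%C; rewrite /c /hprod; ring.
rewrite /hermite_coef /inner_L2 fE /cintegral/= Rintegral_cst// mul0r.
have ih : (lebesgue_cV R d).-integrable setT (EFin \o (fun y : 'cV[R]_d => hser b y * hprod n y)).
  apply: (integrable_le_gaussd (C := 2 * C * (hermK R ^+ d) ^+ n) q0).
    by apply: measurable_funM; [exact: measurable_hser rb|exact: measurable_hprod].
  move=> y; rewrite normrM; apply: le_trans (ler_pM _ _ (hser_le y rb) (hprod_le n y)) _ => //.
  rewrite mulrACA ler_wpM2l//.
    by rewrite !mulr_ge0// !exprn_ge0// (le_trans ler01 (hermK_ge1 R)).
  by rewrite ler_piMr ?gaussd_ge0// gaussd_le1// ltW.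
have [ihB E] := scales_integral k0 scales_k ih.
congr (_ +i* _)%C; rewrite (RintegralZl c measurableT ihB) (E : _ = _) (hser_coef n d0 rb).
by rewrite /coef_const -/c; ring.
Qed.

End hermite_series_coef.

(** * Pointwise decay of a diagonal Hermite series *)

Section decay.
Context (R : realType) (d : nat).
Variable omega : R -> R.
Hypothesis omega_weight : weight_function omega.
Hypothesis omega_alpha : weight_alpha omega.
Hypothesis omega_littleo : omega t / t ^+ 2 @[t --> +oo] --> 0.
Hypothesis phi_superlinear : forall K, exists C, forall u, 0 <= u -> K * u <= phi omega u + C.

(** Coefficients small enough for the decay with [lambda] of order [1 / r]. *)
Definition young_coef (r : R) (n : nat) : R :=
  Num.sqrt n`!%:R * expR (- r^-1 * young omega (r * n%:R)).

Lemma young_coef_gt0 r n : 0 < young_coef r n.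
Proof. by rewrite mulr_gt0 ?expR_gt0// sqrtr_gt0 ltr0n fact_gt0. Qed.

Let K1 : 1 <= hermK R ^+ d. Proof. by rewrite exprn_ege1// hermK_ge1. Qed.

Lemma sqrt_fact_le n : Num.sqrt n`!%:R <= Num.sqrt n%:R ^+ n :> R.
Proof.
apply: ler_sqrr; first by rewrite exprn_ge0.
by rewrite sqr_sqrtr// exprAC sqr_sqrtr// -natrX ler_nat fact_le_expn.
Qed.

(** This is [young_term_le] at [y = 0], where [lambda] may be as large as [r]
    requires. *)
Lemma young_rapid (b : R^nat) (r M : R) : 0 < r -> 0 <= M ->
  (forall n, `|b n| <= M * young_coef r n) -> exists C, rapid d b C.
Proof.
move=> r0 M0 b_le; have [La La0 HLa] := young_term_le omega_weight omega_alpha omega_littleo phi_superlinear K1.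
have [||C C0 HC] := HLa (La / r) r _ _ r0; first by rewrite divr_gt0.
  by rewrite mulrC divfK// gt_eqF.
exists (M * (C * expR (La / r * omega 0))) => n.
have Kn0 : 0 <= (hermK R ^+ d) ^+ n by rewrite exprn_ge0// (le_trans ler01 K1).
apply: (@le_trans _ _ (M * young_coef r n * (hermK R ^+ d) ^+ n)); first by rewrite ler_wpM2r.
rewrite -!(mulrA M) ler_wpM2l// (mulrAC C).
apply: le_trans (HC n 0 (lexx _)).
rewrite mulr0 add0r (exprMn _ (hermK R ^+ d)) /young_coef mulrC mulrA.
by rewrite ler_wpM2r ?expR_ge0// ler_wpM2l// sqrt_fact_le.
Qed.

(** The coordinate [j] keeps its full Gaussian; the others only cost a geometric
    factor. *)
Lemma hprod_le_coord n (y : 'cV[R]_d) j :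
  Num.sqrt n`!%:R * `|hprod n y| <=
  (hermK R ^+ d * (Num.sqrt 2 * `|y j 0| + Num.sqrt n%:R)) ^+ n * expR (- 2^-1 * y j 0 ^+ 2).
Proof.
have F0 : 0 < Num.sqrt n`!%:R :> R by rewrite sqrtr_gt0 ltr0n fact_gt0.
have K0 : 0 <= hermK R by rewrite (le_trans ler01 (hermK_ge1 R)).
rewrite /hprod (bigD1 j)//= normrM normr_prod.
have le1 : \prod_(i < d | i != j) `|hermf n (y i 0)| <= (hermK R ^+ d) ^+ n.
  apply: (@le_trans _ _ (\prod_(i < d | i != j) hermK R ^+ n)).
    apply: ler_prod => i _; rewrite normr_ge0/=; apply: le_trans (hermf_le_gauss _ _) _.
    rewrite ler_piMr ?exprn_ge0//.
    by rewrite -expR0 ler_expR mulNr oppr_le0 mulr_ge0// sqr_ge0.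
  rewrite exprAC -[X in _ <= _ ^+ X]card_ord -prodr_const [leRHS](bigD1 j)//= ler_peMl//.
    by rewrite prodr_ge0// => i _; rewrite exprn_ge0.
  by rewrite exprn_ege1// hermK_ge1.
apply: le_trans (_ : _ <= Num.sqrt n`!%:R * (`|hermf n (y j 0)| * (hermK R ^+ d) ^+ n)) _.
  by rewrite !ler_wpM2l// ltW.
rewrite (exprMn _ (hermK R ^+ d)) mulrA mulrC -mulrA ler_wpM2l ?exprn_ge0//.
by rewrite mulrC -ler_pdivlMr// mulrAC; exact: hermf_le.
Qed.

(** Up to the factor [2^-n], every term of the series is bounded by the weight in
    the coordinate [j]. *)
Lemma hser_decay : exists2 La, 0 < La & forall (b : R^nat) (lambda r M : R),
  0 < lambda -> 0 < r -> La <= r * lambda -> 0 <= M ->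
  (forall n, `|b n| <= M * young_coef r n) ->
  exists2 C, 0 < C & forall (y : 'cV[R]_d) j, `|hser b y| <= C * gauss_weight omega lambda (y j 0).
Proof.
have [La La0 HLa] := young_term_le omega_weight omega_alpha omega_littleo phi_superlinear K1.
exists La => // b lambda r M lambda0 r0 Lr M0 b_le.
have [C C0 HC] := HLa lambda r lambda0 Lr r0.
exists (2 * (M * C + 1)); first by rewrite mulr_gt0// ltr_wpDl// mulr_ge0// ltW.
move=> y j; pose W := gauss_weight omega lambda (y j 0).
have W0 : 0 < W by exact: expR_gt0.
have term n : `|b n * hprod n y| <= M * C * W * 2^-1 ^+ n.
  rewrite normrM; apply: le_trans (ler_wpM2r _ (b_le n)) _ => //.
  rewrite -!(mulrA M) ler_wpM2l// /young_coef mulrAC.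
  apply: le_trans (ler_wpM2r (expR_ge0 _) (hprod_le_coord n y j)) _; rewrite mulrAC.
  apply: le_trans (ler_wpM2r (expR_ge0 _) (HC n _ (normr_ge0 (y j 0)))) _.
  rewrite /W /gauss_weight expRD real_normK ?num_real// le_eqVlt.
  by apply/orP; left; apply/eqP; ring.
have [_ /(_ 0%N)] := dominated_series term.
rewrite big_ord0 subr0 expr0 mulr1 => /le_trans; apply.
rewrite -!mulrA ler_pM2l// mulrA ler_pM2r//; lra.
Qed.

End decay.

Section decay_mx.
Context (R : realType) (d : nat).
Variable omega : R -> R.
Hypothesis omega_weight : weight_function omega.
Hypothesis omega_alpha : weight_alpha omega.
Hypothesis omega_littleo : omega t / t ^+ 2 @[t --> +oo] --> 0.
Hypothesis phi_superlinear : forall K, exists C, forall u, 0 <= u -> K * u <= phi omega u + C.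
Variable A : 'M[R]_d.
Hypothesis A_spd : spd A.

(** The coefficients of the transform are not larger than those of the function, so
    one [La] serves for both. *)
Lemma hser_mx_decay : exists2 La, 0 < La & forall (b : R^nat) (lambda r M : R),
  0 < lambda -> 0 < r -> La <= r * lambda -> 0 <= M ->
  (forall n, `|b n| <= M * young_coef omega r n) ->
  time_freq_decay A omega lambda (hser_mx A b).
Proof.
have [La La0 HLa] := hser_decay d omega_weight omega_alpha omega_littleo phi_superlinear.
exists La => // b lambda r M lambda0 r0 Lr M0 b_le.
have [C rb] := young_rapid d omega_weight omega_alpha omega_littleo phi_superlinear r0 M0 b_le.
have [k k0 scales_k] := spd_scales (sqrtmxP A_spd).1.
have dec (c : R^nat) : (forall n, `|c n| <= `|b n|) -> exists2 D, 0 < D &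
    forall (y : 'cV[R]_d) j, `|hser c y| <= D * gauss_weight omega lambda (y j 0).
  by move=> cb; apply: HLa Lr M0 _ => // n; exact: le_trans (cb n) (b_le n).
exists (hser_mx_hat A k b); first exact: hser_mx_fourier rb.
have [D D0 HD] := dec b (fun=> lexx _).
have [|E E0 HE] := dec (fun n => b n * complex.Re ((0 +i* -1)%C ^+ (n * d))) _.
  by move=> n; rewrite normrM ler_piMr//; have [] := unit_root_le R (n * d).
have [|G G0 HG] := dec (fun n => b n * complex.Im ((0 +i* -1)%C ^+ (n * d))) _.
  by move=> n; rewrite normrM ler_piMr//; have [] := unit_root_le R (n * d).
have K0 := fourier_const_gt0 d k0.
move=> j; split.
  exists D => //; apply: aeW => x; rewrite normc_real (dotv_vvec A_spd); exact: HD.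
exists (fourier_const d k * (E + G)); first by rewrite mulr_gt0// addr_gt0.
apply: aeW => xi; rewrite (dotv_wvec A_spd) Normc.normcM normc_real gtr0_norm//.
rewrite -mulrA ler_pM2l// mulrDl; apply: le_trans (normc_le _) _ => /=.
by apply: lerD; [exact: HE|exact: HG].
Qed.

End decay_mx.

(** * Size of the Hermite coefficients *)

Section coefficients.
Context (R : realType) (d : nat).
Variables (A : 'M[R]_d) (omega : R -> R) (f : 'cV[R]_d -> R[i]) (K : R) (b : R^nat).
Hypotheses (d0 : (0 < d)%N) (K0 : 0 < K).
Hypothesis fb : forall n, hermite_coef A f (fun=> n) = (K * b n)%:C%C.

(** The denominator of the growth condition at the multi-index [(n, ..., n)]. *)
Definition young_bound (eps : R) (n : nat) : R :=
  Num.sqrt n`!%:R ^+ d * expR (- eps^-1 * young omega (eps * (d * n)%:R)).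

Lemma young_bound_gt0 eps n : 0 < young_bound eps n.
Proof. by rewrite mulr_gt0 ?expR_gt0// exprn_gt0// sqrtr_gt0 ltr0n fact_gt0. Qed.

Lemma mi_abs_cst n : mi_abs (fun _ : 'I_d => n) = (d * n)%N.
Proof. by rewrite /mi_abs sum_nat_const card_ord. Qed.

Lemma mi_fact_cst n : mi_fact (fun _ : 'I_d => n) = (n`! ^ d)%N.
Proof. by rewrite /mi_fact prod_nat_const card_ord. Qed.

(** It is enough to look at the constant multi-indices. *)
Lemma unbounded_ratio eps : (forall M, exists n, M * young_bound eps n < b n) ->
  unbounded_hermite_ratio A omega eps f.
Proof.
move=> unb; apply/eqyP => M M0.
have [n Mn] := unb (M / K).
apply: le_trans (_ : _ <= (normc (hermite_coef A f (fun=> n)) /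
  (Num.sqrt (mi_fact (fun _ : 'I_d => n))%:R *
   expR (- eps^-1 * young omega (eps * (mi_abs (fun _ : 'I_d => n))%:R))))%:E)%E _.
  rewrite lee_fin mi_abs_cst mi_fact_cst natrX fb normc_real.
  have -> : Num.sqrt (n`!%:R ^+ d) = Num.sqrt n`!%:R ^+ d :> R.
    by elim: (d) => [|m IH]; rewrite ?expr0 ?sqrtr1// !exprS sqrtrM// IH.
  rewrite -/(young_bound eps n) ler_pdivlMr ?young_bound_gt0//.
  apply: le_trans (ler_norm _); rewrite -ler_pdivrMl// mulrA [_^-1 * _]mulrC.
  exact: ltW.
by apply: ereal_sup_ubound; exists (fun=> n).
Qed.

(** Along the constant multi-indices, of size [d N] and with [mi_fact = N!^d], the
    quotient is equal to [K]. *)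
Lemma limsup_gt0 r : 0 < r -> (forall n, b n = young_coef omega r n) ->
  (0 < hermite_limsup A omega r f)%E.
Proof.
move=> r0 bE; apply: (@lt_le_trans _ _ K%:E); first by rewrite lte_fin.
apply/ereal_infP => _ [N _ <-].
apply: ereal_sup_ubound; exists (fun=> N); first by rewrite /= mi_abs_cst leq_pmull.
congr EFin; rewrite mi_abs_cst mi_fact_cst natrX fb normc_real bE (gtr0_norm (mulr_gt0 K0 (young_coef_gt0 _ _ _))).
have dR : d%:R != 0 :> R by rewrite pnatr_eq0 -lt0n.
have -> : (N`!%:R ^+ d) `^ (2 * d%:R)^-1 = Num.sqrt N`!%:R :> R.
  rewrite -powR_mulrn// -powRrM invfM mulrCA mulfV// mulr1 powR12_sqrt//.
have -> : r * (d * N)%:R / d%:R = r * N%:R by rewrite natrM; field.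
by rewrite -/(young_coef omega r N) mulfK// gt_eqF// young_coef_gt0.
Qed.

End coefficients.

(** * A sparse sequence *)

Section sparse.
Context (R : realType) (d : nat).
Variable omega : R -> R.
Hypothesis omega_weight : weight_function omega.
Hypothesis phi_superlinear : forall K, exists C, forall u, 0 <= u -> K * u <= phi omega u + C.
Hypothesis ratio : forall r eps M : R, 0 < r -> 0 < eps ->
  exists n, M * young_bound d omega eps n < young_coef omega r n.

Lemma young_coef_mono r s n : 0 < r -> r <= s -> young_coef omega s n <= young_coef omega r n.
Proof.
move=> r0 rs; rewrite ler_wpM2l// ler_expR !mulNr lerN2 ![_^-1 * _]mulrC.
exact: young_div_mono.
Qed.

Lemma young_bound_mono r s n : 0 < r -> r <= s -> young_bound d omega s n <= young_bound d omega r n.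
Proof.
move=> r0 rs; rewrite ler_wpM2l ?exprn_ge0// ler_expR !mulNr lerN2 ![_^-1 * _]mulrC.
exact: young_div_mono.
Qed.

(** On finitely many indices the quotient is bounded, so a large bound can only be
    exceeded beyond them. *)
Lemma ratio_tail (r eps M : R) N : 0 < r -> 0 < eps -> 0 <= M ->
  exists2 n, (N <= n)%N & M * young_bound d omega eps n < young_coef omega r n.
Proof.
move=> r0 e0 M0.
pose q (n : nat) := young_coef omega r n / young_bound d omega eps n.
have q0 n : 0 <= q n.
  exact: divr_ge0 (ltW (young_coef_gt0 _ _ _)) (ltW (young_bound_gt0 _ _ _ _)).
have [n Hn] := ratio (M + \sum_(n < N) q n) r0 e0.
have B0 := young_bound_gt0 d omega eps n.
have S0 : 0 <= \sum_(n < N) q n by exact: sumr_ge0.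
exists n; last by apply: le_lt_trans Hn; rewrite ler_pM2r// lerDl.
rewrite leqNgt; apply/negP => nN; move: Hn; rewrite ltNge => /negP; apply.
rewrite -ler_pdivrMr// -/(q n) (bigD1 (Ordinal nN))//= addrCA lerDl.
by rewrite addr_ge0// sumr_ge0.
Qed.

(** For each [k] pick an index [nu k >= k] at which the ratio for [r = k + 1] and
    [eps = 1 / (k + 1)] exceeds [k + 1], and give it the coefficient for
    [r = k + 1]. For a fixed [r], all but finitely many [k] give coefficients
    bounded by those for [r]; for a fixed [eps], all large [k] are good, since the
    bound decreases with [eps]. *)
Lemma sparse_sequence : exists b : R^nat,
  (forall r, 0 < r -> exists2 M, 0 <= M & forall n, `|b n| <= M * young_coef omega r n) /\
  forall eps M, 0 < eps -> exists n, M * young_bound d omega eps n < b n.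
Proof.
have /choice [nu nuP] k : exists n, (k <= n)%N /\
    k.+1%:R * young_bound d omega k.+1%:R^-1 n < young_coef omega k.+1%:R n.
  have kV : 0 < k.+1%:R^-1 :> R by rewrite invr_gt0.
  by have [n kn Hn] := ratio_tail k (ltr0Sn R k) kV (ler0n R k.+1); exists n.
(* A maximum because several [k] may share an index. *)
pose b n := \big[Num.max/0]_(k < n.+1 | nu k == n) young_coef omega k.+1%:R n.
have b0 n : 0 <= b n by exact: bigmax_ge_id.
exists b; split => [r r0|eps M e0].
  have [K rK] : exists K : nat, r <= K%:R.
    by exists (Num.truncn r).+1; rewrite ltW// truncnS_gt.
  pose q k := young_coef omega k.+1%:R (nu k) / young_coef omega r (nu k).
  have q0 k : 0 <= q k.
    exact: divr_ge0 (ltW (young_coef_gt0 _ _ _)) (ltW (young_coef_gt0 _ _ _)).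
  have S0 : 0 <= \sum_(k < K) q k by exact: sumr_ge0.
  exists (1 + \sum_(k < K) q k); first by rewrite addr_ge0.
  move=> n; rewrite ger0_norm//.
  have Y0 := young_coef_gt0 omega r n.
  apply: bigmax_le; first by rewrite mulr_ge0 ?(ltW Y0)// addr_ge0.
  move=> k /eqP nk; have [kK|Kk] := ltnP k K.
    rewrite -ler_pdivrMr//.
    have -> : young_coef omega k.+1%:R n / young_coef omega r n = q k by rewrite /q nk.
    rewrite (bigD1 (Ordinal kK))//= addrCA lerDl.
    by rewrite addr_ge0// sumr_ge0.
  apply: le_trans (young_coef_mono n r0 (_ : r <= k.+1%:R)) _.
    by apply: le_trans rK _; rewrite ler_nat leqW.
  by rewrite ler_peMl ?(ltW Y0)// lerDl.
pose k := (Num.truncn (Num.max M eps^-1)).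
have [Mk ek] : M <= k.+1%:R /\ k.+1%:R^-1 <= eps.
  have : Num.max M eps^-1 < k.+1%:R by rewrite truncnS_gt.
  rewrite gt_max => /andP[/ltW Mk /ltW ek]; split => //.
  by rewrite -(invrK eps) lef_pV2 ?posrE ?invr_gt0 ?ltr0Sn.
have [kn Hn] := nuP k.
exists (nu k).
apply: (@lt_le_trans _ _ (young_coef omega k.+1%:R (nu k))); last first.
  exact: (le_bigmax_cond 0 (fun j : 'I_(nu k).+1 => young_coef omega j.+1%:R (nu k))
    (eqxx _ : (fun j : 'I_(nu k).+1 => nu j == nu k) (Ordinal (kn : (k < (nu k).+1)%N)))).
apply: le_lt_trans Hn.
apply: (@le_trans _ _ (k.+1%:R * young_bound d omega eps (nu k))).
  by rewrite ler_wpM2r// ltW// young_bound_gt0.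
by rewrite ler_pM2l// young_bound_mono// invr_gt0.
Qed.

End sparse.

(** * The two diagonal series *)

Theorem theorem4p8 (R : realType) (d : nat) (d_ge2 : (2 <= d)%N)
    (A : 'M[R]_d) (A_spd : spd A) (omega : R -> R)
    (omega_weight : weight_function omega)
    (omega_alpha : weight_alpha omega)
    (omega_delta : weight_delta omega)
    (omega_littleo : omega t / t ^+ 2 @[t --> +oo] --> 0)
    (omega_not_qi : ~ quadratic_interpolation d omega) :
  (forall lambda : R, 0 < lambda ->
    exists f : 'cV[R]_d -> R[i],
      [/\ memLp 2%:E f,
          forall eps : R, 0 < eps -> unbounded_hermite_ratio A omega eps f,
          time_freq_decay A omega lambda f &
          exists2 r : R, 0 < r & (0 < hermite_limsup A omega r f)%E]) /\
  (exists f : 'cV[R]_d -> R[i],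
    [/\ memLp 2%:E f,
        forall eps : R, 0 < eps -> unbounded_hermite_ratio A omega eps f &
        forall lambda : R, 0 < lambda -> time_freq_decay A omega lambda f]).
Proof.
have d0 : (0 < d)%N by exact: ltnW.
have superlin := not_qi_superlinear omega_weight omega_delta d_ge2 omega_not_qi.
have ratio (r eps M : R) : 0 < r -> 0 < eps ->
    exists n, M * young_bound d omega eps n < young_coef omega r n.
  exact: young_ratio_unbounded.
have [k k0 scales_k] := spd_scales (sqrtmxP A_spd).1.
have [La La0 decay] := hser_mx_decay omega_weight omega_alpha omega_littleo superlin A_spd.
have K0 := coef_const_gt0 A_spd k0.
split=> [lambda lambda0|].
  (* Equality in [La <= r * lambda]. *)
  pose r := La / lambda; pose b := young_coef omega r.
  have r0 : 0 < r by rewrite divr_gt0.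
  have Lr : La <= r * lambda by rewrite /r divfK// gt_eqF.
  have b_le n : `|b n| <= 1 * b n by rewrite mul1r gtr0_norm// young_coef_gt0.
  have [C rb] := young_rapid d omega_weight omega_alpha omega_littleo superlin r0 ler01 b_le.
  have coef := hser_mx_coef d0 k0 scales_k rb.
  exists (hser_mx A b); split.
  - exact (hser_mx_L2 k0 scales_k rb).
  - by move=> eps e0; apply: (unbounded_ratio K0 coef) => M; exact: ratio.
  - exact (decay b lambda r 1 lambda0 r0 Lr ler01 b_le).
  - by exists r => //; exact: (limsup_gt0 d0 K0 coef).
have [b [b_le b_ratio]] := sparse_sequence omega_weight superlin ratio.
have [M1 M10 b_le1] := b_le 1 ltr01.
have [C rb] := young_rapid d omega_weight omega_alpha omega_littleo superlin ltr01 M10 b_le1.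
have coef := hser_mx_coef d0 k0 scales_k rb.
exists (hser_mx A b); split.
- exact (hser_mx_L2 k0 scales_k rb).
- by move=> eps e0; apply: (unbounded_ratio K0 coef) => M; exact: b_ratio.
move=> lambda lambda0; have r0 : 0 < La / lambda by rewrite divr_gt0.
have [M M0 b_leM] := b_le _ r0.
have Lr : La <= La / lambda * lambda by rewrite divfK// gt_eqF.
exact (decay b lambda (La / lambda) M lambda0 r0 Lr M0 b_leM).
Qed.
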